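(* Let $\Omega(x,t)=e^t\bigl(x+i\sqrt{1-x^2}\bigr)$ for $-1\le x\le1$. Let $h$ denote the Gaussian free field on the upper half-plane $\mathbb H$ with vanishing Dirichlet boundary conditions. Let $d(\cdot)$ and $H_s(x,t)$ be as defined in the context. For any polynomials $p_1(x),\dots,p_n(x)\in\mathbb C[x]$ and times $t_1,\dots,t_n\ge 0$, $$\Bigl(\int_{-\infty}^\infty p_i(x)H_s(x,t_i)\,dx,\ 1\le i\le n\Bigr)\ \longrightarrow\ \Bigl(\int_{-1}^1p_i(x)h(\Omega(x,t_i))\,dx,\ 1\le i\le n\Bigr)$$ in law as $s\to\infty$.
   Context: Growing graphs. A tower of random permutations is a sequence $(\pi^{(n)},n\in\mathbb N)$ with $\pi^{(n)}$ uniform on permutations of $\{1,\dots,n\}$ and $\pi^{(n-1)}$ obtained from $\pi^{(n)}$ by deleting $n$ from its cycle. Let $(\pi_l^{(n)})_{n\ge1}$, $l\in\mathbb N$, be independent towers. $G(n,2d)$ is the $2d$-regular multigraph on $\{1,\dots,n\}$ with an edge between $i$ and $\pi_l^{(n)}(i)$ for each $l\le d$ and $i$ (a loop contributes 2 to the degree and to the diagonal of the adjacency matrix). With $T_i\sim\mathrm{Exp}(i)$ independent of each other and of the towers and $M_t=\max\{m:\sum_{i=1}^mT_i\le t\}$, the continuous-time process is $G(t,2d)=G(M_t,2d)$ (same $M_t$ for all $d$), and $N(t)=M_t$ is its number of vertices. Traces. Let $T_k$ be the Chebyshev polynomials of the first kind. For given $d$ put $\widehat\Gamma_0=1$, $\widehat\Gamma_{2k}=2T_{2k}+\frac{2d-2}{(2d-1)^k}$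 ($k\ge1$), $\widehat\Gamma_{2k+1}=2T_{2k+1}$ ($k\ge0$). For a $2d$-regular graph $G$ on $n$ vertices and $f=\sum_ja_j\widehat\Gamma_j$, $\operatorname{tr}f(G)=\sum_{i=1}^nf(\lambda_i)-na_0$, with $\lambda_i$ the eigenvalues of the adjacency matrix divided by $2\sqrt{2d-1}$. The function $d(t)$: a fixed increasing (nondecreasing), right-continuous function taking positive integer values and growing to infinity such that, as $s\to\infty$, the process $$\Bigl(\operatorname{tr}T_k\bigl(G(s+t,2d(s+t))\bigr)-\mathbf E\bigl[\operatorname{tr}T_k\bigl(G(s+t,2d(s+t))\bigr)\mid N(s+t)\bigr],\ k\in\mathbb N,\ t\ge0\Bigr)$$ converges weakly in $D_{\mathbb R^\infty}[0,\infty)$ to independent stationary Ornstein–Uhlenbeck processes $(U_k)$ with $dU_k=-kU_k\,dt+k\,dW_k$ ($W_k$ i.i.d. standard Brownian motions) and equilibrium law $N(0,k/2)$. (Such a function exists.) Height function. $F_t(x)$ is the number of eigenvalues of the adjacency matrix of $G(t,2d(t))$ that are at most $2\sqrt{2d(t)-1}\,x$; $\overline F_t(x)=F_t(x)-\mathbf E[F_t(x)\mid N(t)]$; $H_s(x,t)=\sqrt{\pi/2}\;\overline F_{s+t}(x)$. Gaussian free field. $h$ is a generalized Gaussian field on $\mathbb H$ with covariance $-\frac1{2\pi}\log\bigl|\frac{z-w}{z-\overline w}\bigr|$. The integrals $\int_{-1}^1p(x)h(\Omega(x,t))\,dx$ form a centered Gaussian family, (complex-)linear in $p$ and real for real $p$,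 with $$\mathbf E\Bigl[\int_{-1}^1p(x)h(\Omega(x,t))dx\int_{-1}^1q(y)h(\Omega(y,t'))dy\Bigr]=-\frac1{2\pi}\int_{-1}^1\!\int_{-1}^1p(x)\log\Bigl|\frac{\Omega(x,t)-\Omega(y,t')}{\Omega(x,t)-\overline{\Omega(y,t')}}\Bigr|q(y)\,dx\,dy.$$ *)

(* Defs.v *)
From HB Require Import structures.
From mathcomp Require Import all_boot all_order all_algebra all_fingroup.
From mathcomp Require Import finmap complex.
From mathcomp Require Import all_classical all_reals all_analysis.

Set Implicit Arguments.
Unset Strict Implicit.
Unset Printing Implicit Defensive.

Import Order.TTheory GRing.Theory Num.Theory.
Import numFieldNormedType.Exports.

Local Open Scope classical_set_scope.
Local Open Scope complex_scope.
Local Open Scope ring_scope.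

Section Probability.
Context {disp : measure_display} {Om : measurableType disp} {R : realType}.
Variable P : probability Om R.

Definition has_law (X : Om -> R) (mu : set R -> \bar R) : Prop :=
  forall A : set R, measurable A -> P (X @^-1` A) = mu A.

(* N(m, v), v being the variance.  The case v = 0 is separate because
   normal_prob m 0 is not a Dirac mass but the uniform law on [0, 1]. *)
Definition gaussian_law (m v : R) (A : set R) : \bar R :=
  if v == 0 then \d_m A else normal_prob m (Num.sqrt v) A.

Definition mutually_independent {I : choiceType} (G : I -> set (set Om)) : Prop :=
  forall (J : {fset I}) (A : I -> set Om),
    (forall i, i \in J -> G i (A i)) ->
    P (\bigcap_(i in [set` J]) A i) = (\prod_(i <- J) P (A i))%E.

(* Conditional expectation given the discrete random variable N, in its
   elementary form: on the event N = n, it is E[X ; N = n] / P(N = n)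
   (and 0 if that event is null).  This fixes one version for each X. *)
Definition cond_exp (X : Om -> R) (N : Om -> nat) (w : Om) : R :=
  (\int[P]_(v in N @^-1` [set N w]) X v) / fine (P (N @^-1` [set N w])).

End Probability.

Definition sigma_process {disp : measure_display} {Om : measurableType disp}
    {R : realType} (D : set R) (X : R -> Om -> R) : set (set Om) :=
  <<s \bigcup_(t in D) g_sigma_algebra_preimage (X t) >>.

Definition cvg_in_law {R : realType} {E : topologicalType}
    {d1 : measure_display} {Om1 : measurableType d1} (P : probability Om1 R)
    (X : R -> Om1 -> E)
    {d2 : measure_display} {Om2 : measurableType d2} (Q : probability Om2 R)
    (Y : Om2 -> E) : Prop :=
  forall f : E -> R, continuous f -> (exists M : R, forall x, `|f x| <= M) ->
    'E_P[fun w => f (X s w)]%E @[s --> +oo] --> 'E_Q[fun w => f (Y w)]%E.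

Section Skorokhod.
Context {R : realType}.

(* Elements of D_{R^oo}[0, oo) are represented by functions x : R -> nat -> R,
   where x t k is coordinate k at time t; only times t >= 0 matter.  R^oo has
   the product topology, so limits in R^oo are coordinatewise. *)
Definition cadlag (x : R -> nat -> R) : Prop :=
  forall k,
    (forall t : R, 0 <= t -> x u k @[u --> t^'+] --> x t k) /\
    (forall t : R, 0 < t -> cvg (x u k @[u --> t^'-])).

Definition time_change (lam : R -> R) : Prop :=
  [/\ lam 0 = 0,
      forall u v : R, 0 <= u -> u < v -> lam u < lam v &
      forall v : R, 0 <= v -> exists2 u, 0 <= u & lam u = v].

(* The sets {y | skorokhod_near x T K e y} (T, e > 0, K : nat) are a base of
   neighbourhoods of x for the Skorokhod (J1) topology of D_{R^oo}[0, oo):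
   y is e-close, on [0, T] and for the first K coordinates, to x run with a
   clock that is e-close to the true one on [0, T].  See Ethier and Kurtz,
   Markov Processes, Proposition 3.5.3. *)
Definition skorokhod_near (x : R -> nat -> R) (T : R) (K : nat) (e : R)
    (y : R -> nat -> R) : Prop :=
  exists2 lam, time_change lam &
    forall t : R, 0 <= t <= T ->
      `|lam t - t| < e /\
      forall k, (k < K)%N -> `|y t k - x (lam t) k| < e.

Definition skorokhod_continuous (f : (R -> nat -> R) -> R) : Prop :=
  forall x, cadlag x -> forall e : R, 0 < e ->
    exists (T : R) (K : nat) (del : R), [/\ 0 < T, 0 < del &
      forall y, cadlag y -> skorokhod_near x T K del y -> `|f y - f x| < e].

(* Weak convergence in D_{R^oo}[0, oo) of the processes X s as s -> +oo, when
   all paths are almost surely in D: the values of f outside D do not matter. *)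
Definition skorokhod_cvg_in_law
    {d1 : measure_display} {Om1 : measurableType d1} (P : probability Om1 R)
    (X : R -> Om1 -> R -> nat -> R)
    {d2 : measure_display} {Om2 : measurableType d2} (Q : probability Om2 R)
    (Y : Om2 -> R -> nat -> R) : Prop :=
  forall f : (R -> nat -> R) -> R,
    skorokhod_continuous f -> (exists M : R, forall x, `|f x| <= M) ->
    'E_P[fun w => f (X s w)]%E @[s --> +oo] --> 'E_Q[fun w => f (Y w)]%E.

End Skorokhod.

Section OrnsteinUhlenbeck.
Context {disp : measure_display} {Om : measurableType disp} {R : realType}.
Variable P : probability Om R.

Definition brownian_motion (W : R -> {RV P >-> R}) : Prop :=
  [/\ {ae P, forall w, W 0 w = 0},
      {ae P, forall w, {within `[0, +oo[, continuous (fun t : R => W t w)}},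
      forall u v : R, 0 <= u -> u <= v ->
        has_law P (W v \- W u) (gaussian_law 0 (v - u)) &
      forall tt : nat -> R, 0 <= tt 0%N -> {homo tt : i j / (i <= j)%N >-> i <= j} ->
        mutually_independent P
          (fun i => g_sigma_algebra_preimage (W (tt i.+1) \- W (tt i)))].

(* U k and W k stand for the processes numbered k + 1 >= 1.  The noise being
   additive, the equation dU = - k U dt + k dW is taken in integral form, path
   by path. *)
Definition stationary_OU_family (U W : nat -> R -> {RV P >-> R}) : Prop :=
  [/\ forall k, brownian_motion (W k),
      forall k, has_law P (U k 0) (gaussian_law 0 (k.+1%:R / 2)),
      forall k, {ae P, forall w, {within `[0, +oo[, continuous (fun t : R => U k t w)}},
      forall k, {ae P, forall w, forall t : R, 0 <= t ->
        U k t w = U k 0 w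
                  - k.+1%:R * (\int[lebesgue_measure]_(u in `[0, t]) U k u w)
                  + k.+1%:R * W k t w} &
      mutually_independent P (fun i : nat + nat =>
        match i with
        | inl k => g_sigma_algebra_preimage (U k 0)
        | inr k => sigma_process `[0, +oo[ (W k)
        end)].

End OrnsteinUhlenbeck.

Section Traces.
Context {R : realType}.

Fixpoint chebyshev (k : nat) : {poly R} :=
  match k with
  | 0 => 1
  | k1.+1 => match k1 with
             | 0 => 'X
             | k2.+1 => 2%:R *: ('X * chebyshev k1) - chebyshev k2
             end
  end.

Definition Gamma_hat (d k : nat) : {poly R} :=
  if k == 0%N then 1
  else if odd k then 2%:R *: chebyshev k
  else 2%:R *: chebyshev k + ((2 * d%:R - 2) / (2 * d%:R - 1) ^+ (k./2))%:P.

(* The sequence (a_j) with f = sum_j a_j Gamma_hat_j, encoded as a polynomial;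
   it exists and is unique because Gamma_hat_j has degree j. *)
Definition Gamma_coef (d : nat) (f : {poly R}) : {poly R} :=
  xget 0 [set a : {poly R} | f = \sum_(j < size a) a`_j *: Gamma_hat d j].

(* The eigenvalues listed with multiplicity, in an unspecified order.  The list
   exists when A is symmetric. *)
Definition eigenvalues (n : nat) (A : 'M[R]_n) : seq R :=
  xget [::] [set s : seq R | char_poly A = \prod_(a <- s) ('X - a%:P)].

Definition spectral_scale (d : nat) : R := 2 * Num.sqrt (2 * d%:R - 1).

(* A is the adjacency matrix of a 2d-regular multigraph on n vertices. *)
Definition graph_trace (d n : nat) (A : 'M[R]_n) (f : {poly R}) : R :=
  \sum_(a <- eigenvalues A) f.[a / spectral_scale d] - n%:R * (Gamma_coef d f)`_0.

End Traces.

Section GrowingGraphs.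
Local Open Scope group_scope.

(* s1 is obtained from s by deleting the last point from its cycle. *)
Definition deletes_last (n : nat) (s : 'S_n.+1) (s1 : 'S_n) : Prop :=
  forall i : 'I_n,
    widen_ord (leqnSn n) (s1 i) =
      let j := s (widen_ord (leqnSn n) i) in
      if j == ord_max then s ord_max else j.

End GrowingGraphs.

Section Model.
Context {disp : measure_display} {Om : measurableType disp} {R : realType}.
Variable P : probability Om R.

Definition permutation_tower (tau : forall n, Om -> 'S_n) : Prop :=
  [/\ forall n (s : 'S_n), measurable (tau n @^-1` [set s]),
      forall n (s : 'S_n), P (tau n @^-1` [set s]) = ((n`!%:R)^-1)%:E &
      forall n w, deletes_last (tau n.+1 w) (tau n w)].

Definition sigma_tower (tau : forall n, Om -> 'S_n) : set (set Om) :=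
  <<s [set A | exists n (s : 'S_n), A = tau n @^-1` [set s]] >>.

(* Towers and waiting times are numbered from 0: T i is the waiting time
   written T_{i+1} in the mathematical notation, of law Exp(i + 1). *)
Definition growing_graph_model (tau : nat -> forall n, Om -> 'S_n)
    (T : nat -> {RV P >-> R}) : Prop :=
  [/\ forall l, permutation_tower (tau l),
      forall i, has_law P (T i) (exponential_prob i.+1%:R) &
      mutually_independent P (fun i : nat + nat =>
        match i with
        | inl l => sigma_tower (tau l)
        | inr i => g_sigma_algebra_preimage (T i)
        end)].

(* Adjacency matrix of the multigraph with an edge {i, s l i} for each l < d
   and each i; a loop contributes 2 to the diagonal. *)
Definition adjacency (d n : nat) (s : nat -> 'S_n) : 'M[R]_n :=
  \matrix_(i, j) \sum_(l < d) ((s l i == j)%:R + (s l j == i)%:R).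

Variables (tau : nat -> forall n, Om -> 'S_n) (T : nat -> {RV P >-> R}).

(* N(t) = max {m | T_1 + ... + T_m <= t}; it is 0 on the null event where this
   set has no maximum. *)
Definition num_vertices (t : R) (w : Om) : nat :=
  xget 0%N [set m : nat | \sum_(i < m) T i w <= t /\
                    forall k, \sum_(i < k) T i w <= t -> (k <= m)%N].

Definition growing_adjacency (t : R) (d : nat) (w : Om) :
    'M[R]_(num_vertices t w) :=
  adjacency d (fun l => tau l (num_vertices t w) w).

Variable d : R -> nat.

Definition trace_chebyshev (k : nat) (t : R) (w : Om) : R :=
  graph_trace (d t) (growing_adjacency t (d t) w) (chebyshev k).

(* Coordinate k is the centered trace of T_{k+1}. *)
Definition centered_traces (s : R) (w : Om) (t : R) (k : nat) : R :=
  trace_chebyshev k.+1 (s + t) w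
  - cond_exp P (trace_chebyshev k.+1 (s + t)) (num_vertices (s + t)) w.

Definition admissible_degree : Prop :=
  [/\ forall t : R, 0 <= t -> (0 < d t)%N,
      forall t u : R, 0 <= t -> t <= u -> (d t <= d u)%N,
      forall t : R, 0 <= t -> d u @[u --> t^'+] --> d t,
      d t @[t --> +oo] --> \oo &
      exists (disp' : measure_display) (Om' : measurableType disp')
        (Q : probability Om' R) (U W : nat -> R -> {RV Q >-> R}),
        stationary_OU_family U W /\
        skorokhod_cvg_in_law P centered_traces Q (fun w t k => U k t w)].

Definition eigenvalue_count (t x : R) (w : Om) : R :=
  (count (fun a => a <= spectral_scale (d t) * x)
     (eigenvalues (growing_adjacency t (d t) w)))%:R.

Definition height (s x t : R) (w : Om) : R :=
  Num.sqrt (pi / 2) *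
    (eigenvalue_count (s + t) x w
     - cond_exp P (eigenvalue_count (s + t) x) (num_vertices (s + t)) w).

Definition height_integral (p : {poly R[i]}) (s t : R) (w : Om) : R[i] :=
  let F x := p.[x%:C] * (height s x t w)%:C in
  (\int[lebesgue_measure]_x complex.Re (F x)) +i*
  (\int[lebesgue_measure]_x complex.Im (F x)).

End Model.

Section GaussianFreeField.
Context {disp : measure_display} {Om : measurableType disp} {R : realType}.
Variable P : probability Om R.

Definition Omega (x t : R) : R[i] :=
  (expR t)%:C * (x +i* Num.sqrt (1 - x ^+ 2)).

(* Covariance kernel of the free field on the upper half-plane with Dirichlet
   boundary conditions. *)
Definition gff_covariance (z w : R[i]) : R :=
  - (2 * pi)^-1 * ln (complex.Re `|(z - w) / (z - w^*)|).

(* The free field h0 has no pointwise values; it enters through its integrals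
   h p t = int_{-1}^1 p(x) h0(Omega(x, t)) dx, which for real p are by definition
   the centered Gaussian family, linear in p, with the covariance below.
   gff_integral is the complex-linear extension to complex p. *)
Definition gff_integrals (h : {poly R} -> R -> {RV P >-> R}) : Prop :=
  [/\ forall (a : R) (p q : {poly R}) (t : R), 0 <= t ->
        {ae P, forall w, h (a *: p + q) t w = a * h p t w + h q t w},
      forall (m : nat) (a : 'I_m -> R) (p : 'I_m -> {poly R}) (t : 'I_m -> R),
        (forall j, 0 <= t j) ->
        exists2 v : R, 0 <= v &
          has_law P (fun w => \sum_(j < m) a j * h (p j) (t j) w)
            (gaussian_law 0 v) &
      forall (p q : {poly R}) (t u : R), 0 <= t -> 0 <= u ->
        'E_P[(fun w => h p t w * h q u w)%R]%E =
        (\int[lebesgue_measure]_(x in `[(-1)%R, 1])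
           \int[lebesgue_measure]_(y in `[(-1)%R, 1])
             (p.[x] * gff_covariance (Omega x t) (Omega y u) * q.[y]))%:E].

Definition gff_integral (h : {poly R} -> R -> {RV P >-> R})
    (p : {poly R[i]}) (t : R) (w : Om) : R[i] :=
  h (map_poly (@complex.Re R) p) t w +i* h (map_poly (@complex.Im R) p) t w.

End GaussianFreeField.

(* Main.v *)
Require Import Defs.
From HB Require Import structures.
From mathcomp Require Import all_boot all_order all_algebra all_fingroup.
From mathcomp Require Import finmap complex.
From mathcomp Require Import all_classical all_reals all_analysis.
From mathcomp Require Import measurable_realfun.
From mathcomp Require Import ring lra zify.

Set Implicit Arguments.
Unset Strict Implicit.
Unset Printing Implicit Defensive.

Import Order.TTheory GRing.Theory Num.Theory.
Import numFieldNormedType.Exports.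

Local Open Scope classical_set_scope.
Local Open Scope complex_scope.
Local Open Scope ring_scope.

(* Let p = Q' with Q = sum_(k >= 1) c_k T_k.  Integrating p against the step
   functions 1_(a <= x) of the eigenvalues a turns the integral of p H_s(., t)
   into - sqrt (pi / 2) sum_k c_k Y_k, where Y_k is the centered trace of
   T_k; the divergent and the constant terms cancel against the conditional
   expectation, which is a finite average because the graph is a discrete random
   variable.  The joint limit of the Y_k at the times t_i is Gaussian, with
   Cov (Y_k(t), Y_k(t')) = (k / 2) e^{- k |t - t'|}.  On the other side, with
   x = cos a, y = cos b and r = e^{- |t - t'|} the covariance kernel of the free
   field is (1 / pi) sum_k (r^k / k) sin (k a) sin (k b), and sin (k a) is
   orthogonal to T_j'(x) for j <> k, so that both Gaussian families have
   covariance (pi / 4) sum_k k r^k c_k c'_k.  Convergence of characteristic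
   functions together with tightness then gives convergence in law. *)

(** Three obstacles shape the argument. Skorokhod convergence speaks only of continuous functionals,
    and evaluation at a fixed time is not one; since the limit paths are continuous, evaluation is
    squeezed by continuous functionals that optimise over nearby times. Measurability of these is
    never established: only monotonicity of the expectation is used, until a measurable majorant
    appears. Next, the limit processes are given by a pathwise integral equation; instead of
    stochastic calculus, an exponential Euler scheme is used, which at each mesh is an exact linear
    combination of independent Gaussian variables and converges path by path. Finally, when the two
    times agree (r = 1), the free field kernel is singular on the diagonal; the integrals are
    computed for r < 1, and r tends to 1 under domination by the singular kernel itself.
    Characteristic functions are handled in real form, as expectations of cos(x + b) with an
    arbitrary phase b; a general bounded continuous test function is reached through Bernstein
    polynomials in sines, which keep its bound on the whole space. *)

Section RealIntegrable.
Context {disp : measure_display} {T : measurableType disp} {R : realType}.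
Variables (mu : {measure set T -> \bar R}) (D : set T).
Hypothesis mD : measurable D.
Implicit Types f g : T -> R.

Lemma integrable_fctD f g : mu.-integrable D (EFin \o f) ->
  mu.-integrable D (EFin \o g) -> mu.-integrable D (EFin \o (fun x => f x + g x)).
Proof. exact: integrableD. Qed.

Lemma integrable_fctB f g : mu.-integrable D (EFin \o f) ->
  mu.-integrable D (EFin \o g) -> mu.-integrable D (EFin \o (fun x => f x - g x)).
Proof. exact: integrableB. Qed.

Lemma integrable_fctZ (k : R) f : mu.-integrable D (EFin \o f) ->
  mu.-integrable D (EFin \o (fun x => k * f x)).
Proof. exact: integrableZl. Qed.

Lemma integrable_fct_sum (I : Type) (r : seq I) (f : I -> T -> R) :
  (forall i, mu.-integrable D (EFin \o f i)) ->
  mu.-integrable D (EFin \o (fun x => \sum_(i <- r) f i x)).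
Proof.
move=> h; elim: r => [|i r IH].
  by under eq_fun do rewrite big_nil; exact: integrable0.
under eq_fun do rewrite big_cons; exact: integrable_fctD.
Qed.

Lemma Rintegral_fct_sum (I : Type) (r : seq I) (f : I -> T -> R) :
  (forall i, mu.-integrable D (EFin \o f i)) ->
  \int[mu]_(x in D) (\sum_(i <- r) f i x) = \sum_(i <- r) \int[mu]_(x in D) f i x.
Proof.
move=> h; elim: r => [|i r IH].
  rewrite big_nil -[RHS](mul0r (fine (mu D))) -Rintegral_cst//.
  by apply: eq_Rintegral => x _; rewrite big_nil.
rewrite big_cons -IH -RintegralD//; last exact: integrable_fct_sum.
by apply: eq_Rintegral => x _; rewrite big_cons.
Qed.

End RealIntegrable.

(** * Expectations of bounded variables and real-valued integration *)

Section BoundedExpectation.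
Context {disp : measure_display} {Om : measurableType disp} {R : realType}.
Variable P : probability Om R.

Lemma bounded_integrable (X : Om -> R) (M : R) :
  measurable_fun [set: Om] X -> (forall w, `|X w| <= M) ->
  P.-integrable [set: Om] (EFin \o X).
Proof.
move=> mX XM; apply/integrableP; split; first exact/measurable_EFinP.
apply: (@le_lt_trans _ _ (\int[P]_w (cst M%:E) w)%E).
  apply: ge0_le_integral => //=.
  - by do 2 apply: measurableT_comp.
  - by move=> w _; rewrite lee_fin.
by rewrite integral_cst//= probability_setT mule1 ltry.
Qed.

Lemma Rintegral_norm_le (X : Om -> R) (c : R) :
  P.-integrable [set: Om] (EFin \o X) -> (forall w, `|X w| <= c) -> `|\int[P]_w X w| <= c.
Proof.
move=> iX Xc; apply: (le_trans (le_normr_Rintegral _ _)) => //.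
rewrite (_ : c = \int[P]_w c); last by rewrite Rintegral_cst//= probability_setT mulr1.
apply: le_Rintegral => //; first exact: integrable_norm iX.
exact: finite_measure_integrable_cst.
Qed.

Lemma Rintegral_close (X Y : Om -> R) (c : R) :
  P.-integrable [set: Om] (EFin \o X) -> P.-integrable [set: Om] (EFin \o Y) ->
  (forall w, `|X w - Y w| <= c) -> `|\int[P]_w X w - \int[P]_w Y w| <= c.
Proof.
move=> iX iY XY; rewrite -RintegralB//.
by apply: Rintegral_norm_le => //; exact: integrable_fctB.
Qed.

Lemma indic_norm_le1 (A : set Om) w : `|\1_A w : R| <= 1.
Proof. by rewrite indicE; case: (_ \in _); rewrite ?normr1 ?normr0. Qed.

Lemma Rintegral_indicT (A : set Om) : measurable A -> \int[P]_w \1_A w = fine (P A).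
Proof. by move=> mA; rewrite /Rintegral integral_indic// setIT. Qed.

Lemma expectation_Rintegral (X : Om -> R) (M : R) :
  measurable_fun [set: Om] X -> (forall w, `|X w| <= M) ->
  'E_P[X]%E = (\int[P]_w X w)%:E.
Proof.
move=> mX XM; rewrite unlock /Rintegral fineK//.
exact: (integrable_fin_num _ (bounded_integrable mX XM)).
Qed.

End BoundedExpectation.

Lemma measurable_cos_affine {disp : measure_display} {T : measurableType disp}
    {R : realType} (D : set T) (X : T -> R) (th b : R) :
  measurable_fun D X -> measurable_fun D (fun x => cos (th * X x + b)).
Proof.
move=> mX; apply: (measurableT_comp (f := @cos R)).
  by apply: continuous_measurable_fun; exact: continuous_cos.
by apply: measurable_funD => //; exact: measurable_funM.
Qed.

Lemma ae_eq_EFin_integral {disp : measure_display} {T : measurableType disp}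
    {R : realType} (mu : {measure set T -> \bar R}) (f g : T -> R) :
  measurable_fun [set: T] f -> measurable_fun [set: T] g ->
  {ae mu, forall x, f x = g x} ->
  (\int[mu]_x (f x)%:E = \int[mu]_x (g x)%:E)%E.
Proof.
move=> mf mg fg; apply: ae_eq_integral => //; [exact/measurable_EFinP..|].
by apply: filterS fg => x -> _.
Qed.

Lemma ae_eq_Rintegral {disp : measure_display} {T : measurableType disp}
    {R : realType} (mu : {measure set T -> \bar R}) (f g : T -> R) :
  measurable_fun [set: T] f -> measurable_fun [set: T] g ->
  {ae mu, forall x, f x = g x} -> \int[mu]_x f x = \int[mu]_x g x.
Proof. by move=> mf mg fg; rewrite /Rintegral (ae_eq_EFin_integral mf mg fg). Qed.

Lemma dominated_integrable {disp : measure_display} {T : measurableType disp}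
    {R : realType} (mu : {measure set T -> \bar R}) (D : set T) (f g : T -> R) :
  measurable D -> measurable_fun D f -> (forall x, D x -> `|f x| <= g x) ->
  mu.-integrable D (EFin \o g) -> mu.-integrable D (EFin \o f).
Proof.
move=> mD mf fg; apply: le_integrable => //; first exact/measurable_EFinP.
by move=> x Dx; rewrite !abse_EFin lee_fin (le_trans (fg x Dx))// ler_norm.
Qed.

Lemma Rintegral_dominated_cvg {disp : measure_display} {T : measurableType disp}
    {R : realType} (mu : {measure set T -> \bar R}) (D : set T)
    (f_ : nat -> T -> R) (f g : T -> R) :
  measurable D ->
  (forall n, measurable_fun D (f_ n)) -> measurable_fun D f ->
  {ae mu, forall x, D x -> f_ ^~ x @ \oo --> f x} ->
  mu.-integrable D (EFin \o g) ->
  {ae mu, forall x n, D x -> `|f_ n x| <= g x} ->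
  \int[mu]_(x in D) f_ n x @[n --> \oo] --> \int[mu]_(x in D) f x.
Proof.
move=> mD mf_ mf f_f ig f_g.
have [||||ifin _ c] := @dominated_convergence _ _ R mu D mD (fun n => EFin \o f_ n)
  (EFin \o f) (EFin \o g) _ _ _ ig _.
- by move=> n; exact/measurable_EFinP.
- exact/measurable_EFinP.
- apply: filterS f_f => x h Dx; apply: cvg_EFin; last exact: h.
  by apply: nearW.
- apply: filterS f_g => x h n Dx /=; by rewrite lee_fin h.
rewrite /Rintegral; apply: fine_cvg; rewrite fineK ?(integrable_fin_num _ ifin)//.
Qed.

Lemma Rintegral_FTC {R : realType} (f F : R -> R) (a b : R) :
  (forall x : R, is_derive x (1 : R) F (f x)) -> continuous f -> a < b ->
  \int[lebesgue_measure]_(x in `[a, b]) f x = F b - F a.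
Proof.
move=> dF cf ab; rewrite /Rintegral (@continuous_FTC2 _ f F)//.
- exact: continuous_subspaceT.
- have cF x : {for x, continuous F}.
    by apply: differentiable_continuous; apply/derivable1_diffP; have [] := dF x.
  split.
  + by move=> x _; have [] := dF x.
  + exact: cvg_at_right_filter (cF _).
  + exact: cvg_at_left_filter (cF _).
- by move=> x _; rewrite derive1E; exact: derive_val.
Qed.

(** * Moments and characteristic function of the normal density *)

Section GaussianIntegrals.
Context {R : realType}.
Local Notation mu := (@lebesgue_measure R).

(** On [[-(n+1), n+1]] the integral is a difference of two boundary values of [F], each at most
    [K / (n+1)]; domination by [|f|] passes to the whole line. *)
Lemma Rintegral_derivative_eq0 (f F : R -> R) (K : R) :
  (forall x : R, is_derive x (1 : R) F (f x)) -> continuous f ->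
  mu.-integrable [set: R] (EFin \o f) -> (forall x, `|x * F x| <= K) ->
  \int[mu]_x f x = 0.
Proof.
move=> dF cf intf FK.
have mf : measurable_fun [set: R] f by exact: continuous_measurable_fun.
have K0 : 0 <= K by apply: le_trans (FK 0).
pose I n : set R := [set` `[(- n.+1%:R)%R, n.+1%:R]].
have lim1 : \int[mu]_x (f \_ (I n)) x @[n --> \oo] --> \int[mu]_x f x.
  apply: (@Rintegral_dominated_cvg _ _ R mu [set: R] (fun n => f \_ (I n)) f (fun x => `|f x|)) => //.
  - move=> n; apply/(measurable_restrictT _ _).1; first exact: measurable_itv.
    exact: measurable_funTS.
  - apply: nearW => x _; apply: cvg_near_cst.
    have [m xm] : exists m : nat, `|x| <= m%:R.
      by exists (Num.truncn `|x|).+1; exact: ltW (truncnS_gt _).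
    near=> n; rewrite patchE ifT// inE /I /= in_itv /= -ler_norml.
    apply: (le_trans xm); rewrite ler_nat; near: n; exists m => // n /=; lia.
  - exact: (integrable_norm intf).
  - apply: nearW => x n _; rewrite patchE; case: ifP => // _; by rewrite normr0.
have lim2 : \int[mu]_x (f \_ (I n)) x @[n --> \oo] --> (0 : R).
  apply/cvgrPdist_le => e e0; near=> n.
  rewrite sub0r normrN -Rintegral_mkcond Rintegral_FTC//; last first.
    by rewrite -subr_gt0 opprK addr_gt0.
  have n0 : 0 < n.+1%:R :> R by [].
  have b x : `|x| = n.+1%:R -> `|F x| <= K / n.+1%:R.
    by move=> xn; rewrite ler_pdivlMr// mulrC -xn -normrM.
  apply: (le_trans (ler_normB _ _)).
  apply: (@le_trans _ _ (K / n.+1%:R + K / n.+1%:R)).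
    by apply: lerD; apply: b; rewrite ?normrN ger0_norm.
  rewrite -mulrDl ler_pdivrMr// mulrC -ler_pdivrMr//.
  apply: (le_trans (ltW (truncnS_gt _))); rewrite ler_nat ltnS.
  near: n; exact: nbhs_infty_ge.
exact: cvg_unique lim1 lim2.
Unshelve. all: by end_near. Qed.

Variable s : R.
Hypothesis s0 : 0 < s.
Let g := normal_pdf 0 s.

Let sn0 : s != 0. Proof. exact: lt0r_neq0. Qed.

Lemma normal_pdf_derive (x : R) : is_derive x (1 : R) g (- (x / s ^+ 2) * g x).
Proof.
rewrite /g normal_pdfE// /normal_fun.
have -> : (fun x => normal_peak s * expR (- (x - 0) ^+ 2 / (s ^+ 2 *+ 2))) =
   normal_peak s *: (expR \o (fun x : R => (- (s ^+ 2 *+ 2)^-1) *: (id : R -> R) x ^+ 2)).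
  by apply/funext => y /=; rewrite /GRing.scale/= subr0; congr (_ * expR _); field.
apply: is_derive_eq.
rewrite /GRing.scale/= subr0 !mulr1.
have -> : - (s ^+ 2 *+ 2)^-1 * x ^+ 2 = - x ^+ 2 / (s ^+ 2 *+ 2) by ring.
by field.
Qed.

(** The quadratic factor is absorbed by doubling the variance. With u = x^2 / (4 s^2) the exponent
    is -2u; one factor e^(-u) is the wider density, the other gives (1 + 4 s^2 u) e^(-u) <= 1 + 4
    s^2. The [Num.sqrt 2] compensates the lower peak. *)
Lemma normal_pdf_sqr_ub (x : R) :
  (1 + x ^+ 2) * g x <= (1 + 4 * s ^+ 2) * Num.sqrt 2 * normal_pdf 0 (Num.sqrt 2 * s) x.
Proof.
have r20 : 0 < Num.sqrt 2 :> R by rewrite sqrtr_gt0.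
rewrite /g !normal_pdfE ?mulf_neq0 ?gt_eqF// /normal_fun subr0.
have -> : normal_peak (Num.sqrt 2 * s) = (Num.sqrt 2)^-1 * normal_peak s.
  rewrite /normal_peak exprMn -invfM; congr (_^-1).
  rewrite sqr_sqrtr// -mulrnAr -!mulrA sqrtrM// -mulrnAr; congr (_ * Num.sqrt _).
  by ring.
rewrite exprMn sqr_sqrtr//.
have -> : (1 + 4 * s ^+ 2) * Num.sqrt 2 * ((Num.sqrt 2)^-1 * normal_peak s *
    expR (- x ^+ 2 / (2 * s ^+ 2 *+ 2))) =
  normal_peak s * ((1 + 4 * s ^+ 2) * expR (- x ^+ 2 / (2 * s ^+ 2 *+ 2))).
  by field; rewrite gt_eqF.
rewrite mulrCA; apply: ler_wpM2l; first exact: normal_peak_ge0.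
set u := x ^+ 2 / (4 * s ^+ 2).
have u0 : 0 <= u by rewrite divr_ge0 ?sqr_ge0// mulr_ge0 ?sqr_ge0.
have -> : - x ^+ 2 / (2 * s ^+ 2 *+ 2) = - u by rewrite /u; field.
have -> : - x ^+ 2 / (s ^+ 2 *+ 2) = - u + - u by rewrite /u; field.
rewrite expRD mulrA; apply: ler_wpM2r; first exact: expR_ge0.
have -> : x ^+ 2 = 4 * s ^+ 2 * u by rewrite /u; field.
rewrite mulrDl mul1r; apply: lerD; first by rewrite expRN invf_le1 ?expR_gt0// -[leLHS]expR0 ler_expR.
rewrite -[leLHS]mulrA -[leRHS]mulr1; apply: ler_wpM2l; first by rewrite mulr_ge0 ?sqr_ge0.
rewrite expRN ler_pdivrMr ?expR_gt0// mul1r.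
by apply: le_trans (expR_ge1Dx u); rewrite lerDr.
Qed.

Lemma integrable_normal_pdfM (h : R -> R) (C : R) :
  measurable_fun [set: R] h -> (forall x, `|h x| <= C * (1 + x ^+ 2)) ->
  mu.-integrable [set: R] (fun x => (h x * g x)%:E).
Proof.
move=> mh hC.
pose D := C * ((1 + 4 * s ^+ 2) * Num.sqrt 2).
have C0 : 0 <= C by have := le_trans (normr_ge0 _) (hC 0); rewrite expr0n/= addr0 mulr1.
apply: (@dominated_integrable _ _ _ mu setT (fun x => h x * g x)
  (fun x => D * normal_pdf 0 (Num.sqrt 2 * s) x)) => //.
- by apply: measurable_funM => //; exact: measurable_normal_pdf.
- move=> x _; rewrite normrM (ger0_norm (normal_pdf_ge0 _ _ _)) /D -mulrA.
  apply: (@le_trans _ _ (C * ((1 + x ^+ 2) * g x))).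
    by rewrite mulrA ler_wpM2r// normal_pdf_ge0.
  by rewrite ler_wpM2l// normal_pdf_sqr_ub.
- rewrite (_ : _ \o _ = (fun x => D%:E * (normal_pdf 0 (Num.sqrt 2 * s) x)%:E)%E)//.
  by apply: integrableZl => //; exact: integrable_normal_pdf.
Qed.

(** Supplies the boundary bound of [Rintegral_derivative_eq0] for the primitive [h * g]: linear
    growth of [h] makes [x * h x] quadratic, which the wider Gaussian controls. *)
Lemma normal_pdf_decay (h : R -> R) (C : R) :
  (forall x, `|h x| <= C * (1 + `|x|)) ->
  exists K : R, forall x, `|x * (h x * g x)| <= K.
Proof.
move=> hC; have C0 : 0 <= C by have := le_trans (normr_ge0 _) (hC 0); rewrite normr0 addr0 mulr1.
exists (2 * C * ((1 + 4 * s ^+ 2) * Num.sqrt 2 * normal_peak (Num.sqrt 2 * s))) => x.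
rewrite !normrM mulrA (ger0_norm (normal_pdf_ge0 _ _ _)).
apply: (@le_trans _ _ (2 * C * ((1 + x ^+ 2) * g x))).
  rewrite mulrA ler_wpM2r ?normal_pdf_ge0//.
  apply: (@le_trans _ _ (`|x| * (C * (1 + `|x|)))); first by rewrite ler_wpM2l.
  rewrite mulrCA (mulrC 2) -mulrA; apply: ler_wpM2l => //.
  rewrite -(real_normK (num_real x)); set y := `|x|; nra.
apply: ler_wpM2l; first by rewrite mulr_ge0.
apply: (le_trans (normal_pdf_sqr_ub x)); apply: ler_wpM2l.
  by apply: mulr_ge0; [apply: addr_ge0 => //; apply: mulr_ge0 => //; exact: sqr_ge0|exact: sqrtr_ge0].
by apply: normal_pdf_ub; rewrite mulf_neq0 ?gt_eqF ?sqrtr_gt0.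
Qed.

Lemma cont_normal_pdf : continuous g. Proof. exact: continuous_normal_pdf. Qed.

(* Both identities integrate the derivative of [h * g], which vanishes at infinity. *)
Lemma normal_pdf_parts (h h' : R -> R) (C : R) :
  (forall x : R, is_derive x (1 : R) h (h' x)) -> continuous h' ->
  (forall x, `|h x| <= C * (1 + `|x|)) -> (forall x, `|h' x| <= C * (1 + x ^+ 2)) ->
  \int[mu]_x (x * h x * g x) = s ^+ 2 * \int[mu]_x (h' x * g x).
Proof.
move=> dh ch' hC h'C.
have C0 : 0 <= C by have := le_trans (normr_ge0 _) (hC 0); rewrite normr0 addr0 mulr1.
have ch : continuous h.
  by move=> x; apply: differentiable_continuous; apply/derivable1_diffP; have [] := dh x.
have [K hK] := normal_pdf_decay hC.
have i1 : mu.-integrable [set: R] (EFin \o (fun x => h' x * g x)).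
  by apply: integrable_normal_pdfM h'C; exact: continuous_measurable_fun.
have i2 : mu.-integrable [set: R] (EFin \o (fun x => x * h x * g x)).
  apply: (@integrable_normal_pdfM _ (2 * C)).
    by apply: measurable_funM => //; exact: continuous_measurable_fun.
  move=> x; rewrite normrM.
  apply: (@le_trans _ _ (`|x| * (C * (1 + `|x|)))); first by rewrite ler_wpM2l.
  rewrite mulrCA (mulrC 2) -mulrA; apply: ler_wpM2l => //.
  rewrite -(real_normK (num_real x)); set y := `|x|; nra.
have i3 := integrable_fctZ measurableT (s ^+ 2)^-1 i2.
have : \int[mu]_x (h' x * g x - (s ^+ 2)^-1 * (x * h x * g x)) = 0.
  apply: (@Rintegral_derivative_eq0 _ (h * g) K) => //.
  - move=> x; have dg := normal_pdf_derive x; apply: is_derive_eq.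
    by rewrite /GRing.scale/=; field.
  - move=> x; apply: cvgB; first by apply: cvgM; [exact: ch' | exact: cont_normal_pdf].
    apply: cvgM; first exact: cvg_cst.
    apply: cvgM; last exact: cont_normal_pdf.
    by apply: cvgM; [exact: cvg_id | exact: ch].
  - exact: integrable_fctB.
rewrite RintegralB//.
rewrite RintegralZl// => /eqP; rewrite subr_eq0 => /eqP ->.
by rewrite mulVKf// expf_neq0.
Qed.

Lemma normal_pdf_int1 : \int[mu]_x g x = 1.
Proof. by rewrite /Rintegral integral_normal_pdf. Qed.

Lemma normal_pdf_variance : \int[mu]_x (x ^+ 2 * g x) = s ^+ 2.
Proof.
have := @normal_pdf_parts id (cst 1) 1.
under eq_Rintegral do rewrite -expr2.
under [X in _ * X]eq_Rintegral do rewrite mul1r.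
rewrite normal_pdf_int1 mulr1; apply => //.
- by move=> x; exact: cst_continuous.
- by move=> x; rewrite mul1r lerDr.
- by move=> x; rewrite normr1 mul1r lerDl sqr_ge0.
Qed.

Let F b th := \int[mu]_x (cos (th * x + b) * g x).

Let intF b th : mu.-integrable [set: R] (fun x => (cos (th * x + b) * g x)%:E).
Proof.
apply: (@integrable_normal_pdfM _ 1).
  exact: measurable_cos_affine.
move=> x; rewrite mul1r (le_trans (cos_max _))// lerDl sqr_ge0//.
Qed.

(** Differentiating under the integral produces - x sin(th x + b), and integration by parts turns x
    sin back into s^2 th cos. So [F b] solves a linear differential equation in th. *)
Let F_derive b th : is_derive (th : R) (1 : R) (F b) (- (s ^+ 2 * th) * F b th).
Proof.
pose f th x := cos (th * x + b) * g x.
have df t x : is_derive (t : R) (1 : R) (f ^~ x) (- (x * sin (t * x + b) * g x)).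
  have -> : f ^~ x = g x *: (cos \o (fun t : R => x *: (id : R -> R) t + cst b t)).
    by apply/funext => u; rewrite /f /= /GRing.scale/= mulrC (mulrC u).
  apply: is_derive_eq; rewrite /GRing.scale/= !mulr1 addr0 (mulrC t); ring.
have pdf y x : partial1of2 f y x = - (x * sin (y * x + b) * g x).
  by have d := df y x; rewrite partial1of2E derive_val.
have intD : \int[mu]_y partial1of2 f th y = - (s ^+ 2 * th) * F b th.
  under eq_Rintegral do rewrite pdf -mulN1r.
  have dh (x : R) : is_derive x (1 : R) (fun x => sin (th * x + b)) (th * cos (th * x + b)).
    rewrite (_ : (fun x => _) = sin \o (fun x : R => th *: (id : R -> R) x + cst b x)).
      by apply: is_derive_eq; rewrite /GRing.scale/= !mulr1 addr0 mulrC.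
    by apply/funext.
  rewrite RintegralZl//; last first.
    apply: (@integrable_normal_pdfM _ 1).
      apply: measurable_funM => //; apply: (measurableT_comp (f := @sin R)).
        by apply: continuous_measurable_fun; exact: continuous_sin.
      by apply: measurable_funD => //; exact: measurable_funM.
    move=> x; rewrite normrM mul1r.
    apply: (@le_trans _ _ `|x|); first by rewrite ler_piMr ?sin_max.
    by rewrite -(real_normK (num_real x)); set y := `|x|; nra.
  rewrite (@normal_pdf_parts _ _ (1 + `|th|) dh).
  - under eq_Rintegral do rewrite -mulrA.
    by rewrite RintegralZl ?intF// /F; ring.
  - move=> x; apply: cvgM; first exact: cvg_cst.
    apply: continuous_comp; last exact: continuous_cos.
    by apply: cvgD; [apply: cvgM; [exact: cvg_cst|exact: cvg_id]|exact: cvg_cst].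
  - move=> x; apply: (le_trans (sin_max _)); have := normr_ge0 x; have := normr_ge0 th; nra.
  - move=> x; rewrite normrM; have := cos_max (th * x + b).
    have := normr_ge0 (cos (th * x + b)); have := normr_ge0 th; have := sqr_ge0 x; nra.
have := @cvg_differentiation_under_integral R _ _ mu f setT measurableT th (th - 1) (th + 1).
rewrite intD => /(_ _ _ _ (fun x => `|x| * g x)) c.
have {}c : h^-1 *: ((F b (h *: 1 + th)) - F b th) @[h --> 0^'] --> (- (s ^+ 2 * th) * F b th : R).
  under eq_fun do rewrite /GRing.scale/= mulr1.
  apply: c.
  - by rewrite /= in_itv /=; apply/andP; split; lra.
  - by move=> x _; exact: intF.
  - by move=> x y _ _; have [] := df x y.
  - by move=> y; rewrite mulr_ge0// normal_pdf_ge0.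
  - apply: (@integrable_normal_pdfM (fun x => `|x|) 1); first exact: normr_measurable.
    move=> x; rewrite normr_id mul1r -(real_normK (num_real x)); set y := `|x|; nra.
  - move=> x y _ _; rewrite pdf normrN !normrM (ger0_norm (normal_pdf_ge0 _ _ _)).
    by apply: ler_wpM2r; [exact: normal_pdf_ge0|rewrite ler_piMr ?sin_max].
by split; [apply/cvg_ex; eexists; exact: c|exact: (cvg_lim _ c)].
Qed.

(** The integrating factor e^(t^2 s^2 / 2) makes [F b] constant, and its value at 0 is cos b. *)
Lemma normal_pdf_cos (th b : R) :
  \int[mu]_x (cos (th * x + b) * g x) = cos b * expR (- (th ^+ 2 * s ^+ 2 / 2)).
Proof.
pose E (t : R) := F b t * expR (t ^+ 2 * s ^+ 2 / 2).
have dE (t : R) : is_derive (t : R) (1 : R) E 0.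
  rewrite /E (_ : (fun t => _) = F b *
     (expR \o (fun t : R => (s ^+ 2 / 2) *: (id : R -> R) t ^+ 2))); last first.
    apply/funext => x; transitivity (F b x * expR (s ^+ 2 / 2 * x ^+ 2)); last by [].
    by congr (_ * expR _); rewrite -mulrA mulrC.
  have dF := F_derive b t.
  apply: is_derive_eq; rewrite /GRing.scale/= !mulr1; by field.
have : E th = E 0 by exact: is_derive_0_is_cst.
rewrite /E expr0n /= !mul0r expR0 mulr1 {2}/F.
under eq_Rintegral do rewrite mul0r add0r.
rewrite RintegralZl//; last exact: integrable_normal_pdf.
rewrite normal_pdf_int1 mulr1 => <-.
by rewrite -[RHS]mulrA -expRD subrr expR0 mulr1.
Qed.

End GaussianIntegrals.

(** * Integration against a density and Gaussian laws *)

Section Density.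
Import HBNNSimple.
Context {disp : measure_display} {T : measurableType disp} {R : realType}.
Variables (mu nu : {measure set T -> \bar R}) (p : T -> R).
Hypothesis p0 : forall x, 0 <= p x.
Hypothesis mp : measurable_fun [set: T] p.
Hypothesis nuE : forall A, measurable A -> nu A = (\int[mu]_(x in A) (p x)%:E)%E.

Let density_nnsfun (f : {nnsfun T >-> R}) :
  (\int[nu]_x (f x)%:E = \int[mu]_x ((f x)%:E * (p x)%:E))%E.
Proof.
have mpE : measurable_fun [set: T] (EFin \o p) by exact/measurable_EFinP.
under [LHS]eq_integral do rewrite fimfunE -fsumEFin//.
rewrite [LHS]ge0_integral_fsum//; last 2 first.
  - by move=> r; exact/measurable_EFinP/measurableT_comp.
  - by move=> n x _; rewrite EFinM nnfun_muleindic_ge0.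
under [RHS]eq_integral.
  move=> x xD; rewrite fimfunE -fsumEFin// muleC ge0_mule_fsumr; last first.
    by move=> r; rewrite EFinM nnfun_muleindic_ge0.
  over.
rewrite [RHS]ge0_integral_fsum//; last 2 first.
  - by move=> r; apply: emeasurable_funM => //; exact/measurable_EFinP/measurableT_comp.
  - by move=> n x _; rewrite mule_ge0 ?lee_fin// -lee_fin EFinM nnfun_muleindic_ge0.
apply: eq_fsbigr => r _.
rewrite integralZl_indic_nnsfun// integral_indic// setIT nuE//.
under [RHS]eq_integral do rewrite EFinM muleCA.
(* A nonnegative simple function takes no negative value, so both sides vanish for r < 0. *)
have [r0|r0] := leP 0 r; last first.
  rewrite (preimage_nnfun0 _ r0) integral_set0 mule0.
  by under eq_integral do rewrite indic0 mule0 mule0; rewrite integral0.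
rewrite ge0_integralZl//.
- congr (_ * _)%E; rewrite integral_mkcond; apply: eq_integral => x _.
  by rewrite restrict_EFin/= patch_indic/= EFinM.
- by apply: emeasurable_funM => //; exact/measurable_EFinP.
- by move=> x _; rewrite mule_ge0 ?lee_fin.
Qed.

Lemma ge0_integral_density (f : T -> \bar R) :
  measurable_fun [set: T] f -> (forall x, 0 <= f x)%E ->
  (\int[nu]_x f x = \int[mu]_x (f x * (p x)%:E))%E.
Proof.
move=> mf f0.
have mpE : measurable_fun [set: T] (EFin \o p) by exact/measurable_EFinP.
pose f_ := nnsfun_approx measurableT mf.
transitivity (lim (\int[nu]_x (f_ n x)%:E @[n --> \oo])%E).
  rewrite -monotone_convergence//=.
  - apply: eq_integral => ? /[!inE] xD; apply/esym/cvg_lim => //=.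
    exact: cvg_nnsfun_approx.
  - by move=> n; exact/measurable_EFinP/measurable_funTS.
  - by move=> n ? _; rewrite lee_fin.
  - by move=> ? _ ? ? mn; rewrite lee_fin; exact/lefP/nd_nnsfun_approx.
transitivity (lim (\int[mu]_x ((f_ n x)%:E * (p x)%:E) @[n --> \oo])%E).
  by apply: congr_lim; apply/funext => n /=; exact: density_nnsfun.
rewrite -monotone_convergence//=.
- apply: eq_integral => x _; apply/cvg_lim => //=.
  by apply: cvgeZr => //; exact: cvg_nnsfun_approx.
- by move=> n; apply: emeasurable_funM => //; exact/measurable_EFinP.
- by move=> n x _; rewrite mule_ge0 ?lee_fin.
- move=> x _ m n mn; apply: lee_wpmul2r; first by rewrite lee_fin.
  by rewrite lee_fin; exact/lefP/nd_nnsfun_approx.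
Qed.
End Density.

Section GaussianLaw.
Context {disp : measure_display} {Om : measurableType disp} {R : realType}.
Variable P : probability Om R.

Lemma ge0_has_law_expectation (X : Om -> R) (s : R) (f : R -> R) : s != 0 ->
  measurable_fun [set: Om] X -> has_law P X (normal_prob 0 s) ->
  measurable_fun [set: R] f -> (forall x, 0 <= f x) ->
  (\int[P]_w (f (X w))%:E = \int[lebesgue_measure]_x (f x * normal_pdf 0 s x)%:E)%E.
Proof.
move=> s0 mX lawX mf f0.
have mX' : @measurable_fun _ _ Om (measurableTypeR R) [set: Om] X by exact: mX.
pose X' : {mfun Om >-> measurableTypeR R} := HB.pack X (isMeasurableFun.Build _ _ _ _ _ mX').
rewrite -(@ge0_integral_distribution _ _ _ (measurableTypeR R) _ P X' (EFin \o f))//;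
  last exact/measurable_EFinP.
transitivity (\int[normal_prob 0 s]_x (f x)%:E)%E.
  by apply: eq_measure_integral => A mA _; exact: lawX.
have -> := @ge0_integral_density _ _ R lebesgue_measure (normal_prob 0 s)
  (normal_pdf 0 s) _ _ _ (EFin \o f) _ _ => //.
- exact: normal_pdf_ge0.
- exact: measurable_normal_pdf.
- exact/measurable_EFinP.
Qed.

Lemma gaussian_law0_ae (X : Om -> R) : measurable_fun [set: Om] X ->
  has_law P X (gaussian_law 0 0) -> {ae P, forall w, X w = 0}.
Proof.
move=> mX lX; exists (X @^-1` [set~ 0]); split => //.
- by rewrite -[X @^-1` _]setTI; apply: mX => //; exact: measurableC.
- rewrite lX; last exact: measurableC.
  by rewrite /gaussian_law eqxx diracE memNset// => h; exact: h.
Qed.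

Lemma gaussian_cos (X : Om -> R) (v th b : R) : 0 <= v ->
  measurable_fun [set: Om] X -> has_law P X (gaussian_law 0 v) ->
  \int[P]_w cos (th * X w + b) = cos b * expR (- (th ^+ 2 * v / 2)).
Proof.
move=> v0 mX lX.
have iP := bounded_integrable P (measurable_cos_affine th b mX) (fun w => cos_max _).
have [v00|vn0] := eqVneq v 0.
  rewrite v00 in lX *; have X0 := gaussian_law0_ae mX lX.
  rewrite mulr0 mul0r oppr0 expR0 mulr1 (ae_eq_Rintegral (g := cst (cos b)))//.
  - by rewrite Rintegral_cst//= probability_setT mulr1.
  - exact: measurable_cos_affine.
  - by apply: filterS X0 => w -> /=; rewrite mulr0 add0r.
have s0 : 0 < Num.sqrt v by rewrite sqrtr_gt0 lt_def vn0.
have {}lX : has_law P X (normal_prob 0 (Num.sqrt v)).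
  by move=> A mA; rewrite lX// /gaussian_law (negbTE vn0).
have mc : measurable_fun [set: R] (fun x : R => cos (th * x + b)).
  exact: measurable_cos_affine.
have c1 (x : R) : 0 <= 1 + cos x by have := cos_geN1 x; rewrite -lerBlDl sub0r.
(* The change of variables is stated for nonnegative functions; adding 1 to the cosine makes it
   applicable, and the total mass 1 is subtracted from both sides afterwards. *)
have := @ge0_has_law_expectation X _ (fun x => 1 + cos (th * x + b)) (lt0r_neq0 s0) mX lX.
move=> /(_ (measurable_funD (measurable_cst _) mc) (fun x => c1 _)) /(congr1 fine).
have ic : lebesgue_measure.-integrable [set: R]
   (EFin \o (fun x => cos (th * x + b) * normal_pdf 0 (Num.sqrt v) x)).
  apply: (@integrable_normal_pdfM _ _ s0 _ 1) => //.
  by move=> x; rewrite mul1r (le_trans (cos_max _))// lerDl sqr_ge0//.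
rewrite -[X in X = _]/(\int[P]_w (1 + cos (th * X w + b))).
rewrite -[X in _ = X]/(\int[lebesgue_measure]_x _).
rewrite RintegralD//; last exact: finite_measure_integrable_cst.
under [X in _ = X]eq_Rintegral do rewrite mulrDl mul1r.
rewrite RintegralD//; last exact: integrable_normal_pdf.
rewrite normal_pdf_int1// Rintegral_cst//= probability_setT mulr1 => /addrI ->.
by rewrite (normal_pdf_cos s0) sqr_sqrtr.
Qed.

(** The equality holds between extended reals, so that it also yields integrability of the
    square. *)
Lemma gaussian_variance (X : Om -> R) (v : R) : 0 <= v ->
  measurable_fun [set: Om] X -> has_law P X (gaussian_law 0 v) ->
  (\int[P]_w (X w ^+ 2)%:E = v%:E)%E.
Proof.
move=> v0 mX lX.
have [v00|vn0] := eqVneq v 0.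
  rewrite v00 in lX *; have X0 := gaussian_law0_ae mX lX.
  rewrite (ae_eq_EFin_integral (g := cst 0))//.
  - by apply: integral0_eq.
  - exact: measurable_funX.
  - by apply: filterS X0 => w -> /=; rewrite expr0n.
have s0 : 0 < Num.sqrt v by rewrite sqrtr_gt0 lt_def vn0.
have {}lX : has_law P X (normal_prob 0 (Num.sqrt v)).
  by move=> A mA; rewrite lX// /gaussian_law (negbTE vn0).
rewrite (@ge0_has_law_expectation X (Num.sqrt v) (fun x => x ^+ 2))//.
- have i2 : lebesgue_measure.-integrable [set: R]
      (EFin \o (fun x => x ^+ 2 * normal_pdf 0 (Num.sqrt v) x)).
    apply: (@integrable_normal_pdfM _ _ s0 (fun x => x ^+ 2) 1).
      by apply: measurable_funX.
    by move=> x; rewrite mul1r ger0_norm ?sqr_ge0// lerDr.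
  rewrite -[LHS]fineK; last exact: (integrable_fin_num _ i2).
  by rewrite -[X in X%:E]/(\int[lebesgue_measure]_x _) (normal_pdf_variance s0) sqr_sqrtr.
- exact: lt0r_neq0.
- by move=> x; exact: sqr_ge0.
Qed.
End GaussianLaw.

(** * Sums of independent Gaussian variables *)

Section Independence.
Context {disp : measure_display} {Om : measurableType disp} {R : realType}.
Variable P : probability Om R.

(** The characteristic function of N(0, v) in real form: the phase b = 0 is its real part and b = -
    pi / 2 its imaginary part. *)
Definition gaussian_cf (X : Om -> R) (v : R) : Prop :=
  forall th b : R, \int[P]_w cos (th * X w + b) = cos b * expR (- (th ^+ 2 * v / 2)).

Let le1_integrable (g : Om -> R) (M : R) : measurable_fun [set: Om] g ->
  (forall w, `|g w| <= M) -> P.-integrable [set: Om] (EFin \o g).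
Proof. exact: bounded_integrable. Qed.

(* [Y] is approximated uniformly by step functions with values in [Z / n]. *)
Lemma uncorrelated_events (G : set (set Om)) (g Y : Om -> R) (M : R) :
  measurable_fun [set: Om] g -> (forall w, `|g w| <= M) ->
  (forall A, G A -> measurable A) ->
  (forall A, G A -> \int[P]_w (g w * \1_A w) = (\int[P]_w g w) * fine (P A)) ->
  (forall A, measurable A -> G (Y @^-1` A)) -> (forall w, `|Y w| <= 1) ->
  \int[P]_w (g w * Y w) = (\int[P]_w g w) * \int[P]_w Y w.
Proof.
move=> mg gM mG gG GY Y1.
have M0 : 0 <= M by apply: le_trans (gM point).
have mY : measurable_fun [set: Om] Y by move=> _ A mA; rewrite setTI; exact/mG/GY.
have ig := le1_integrable mg gM.
have iY := le1_integrable mY Y1.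
have igY : P.-integrable [set: Om] (EFin \o (fun w => g w * Y w)).
  apply: (@le1_integrable _ M); first exact: measurable_funM.
  by move=> w; rewrite normrM -[leRHS]mulr1 ler_pM.
apply/eqP; rewrite -subr_eq0 -normr_le0; apply/ler_addgt0Pr => e e0; rewrite add0r.
pose n := (Num.truncn ((M + M) / e)).+1.
have n0 : 0 < n%:R :> R by [].
have Mn : (M + M) / n%:R <= e.
  by rewrite ler_pdivrMr// mulrC -ler_pdivrMr// ltW// truncnS_gt.
pose c (j : nat) : R := j%:R / n%:R - 1.
pose A (j : nat) := Y @^-1` [set` `[c j, c j.+1[].
have GA j : G (A j) by apply: GY; exact: measurable_itv.
have mA j : measurable (A j) by exact: mG.
(* The cells have width 1/n and start at -1; the extra index 2n is there to catch the value Y =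
   1. *)
pose Z w := \sum_(j < (2 * n).+1) c j * \1_(A j) w.
have m1 j : measurable_fun [set: Om] (\1_(A j) : Om -> R) by exact: measurable_indic.
have i1 j : P.-integrable [set: Om] (EFin \o (\1_(A j) : Om -> R)).
  by apply: (@le1_integrable _ 1) => // w; exact: indic_norm_le1.
have ig1 j : P.-integrable [set: Om] (EFin \o (fun w => g w * \1_(A j) w)).
  apply: (@le1_integrable _ M); first exact: measurable_funM.
  by move=> w; rewrite normrM -[leRHS]mulr1 ler_pM// indic_norm_le1.
have YZ w : `|Y w - Z w| <= n%:R^-1.
  have yw : 0 <= (Y w + 1) * n%:R.
    by rewrite mulr_ge0// -lerBlDr sub0r; have := Y1 w; rewrite ler_norml => /andP[].
  have /andP[j1 j2] := truncn_itv yw.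
  set j := Num.truncn _ in j1 j2.
  have jn : (j < (2 * n).+1)%N.
    rewrite ltnS -(ler_nat R) (le_trans j1)// natrM ler_pM2r//.
    by have := Y1 w; rewrite ler_norml => /andP[_]; lra.
  have Aj : A j w.
    rewrite /A /= in_itv /= /c; apply/andP; split.
      by rewrite lerBlDr ler_pdivrMr.
    by rewrite ltrBrDr ltr_pdivlMr.
  rewrite /Z (bigD1 (Ordinal jn))//= indicE mem_set// mulr1 big1 ?addr0.
    move: Aj; rewrite /A /= in_itv /= => /andP[c1 c2].
    rewrite ger0_norm ?subr_ge0// lerBlDl ltW// (lt_le_trans c2)//.
    by rewrite /c -natr1 mulrDl mul1r; lra.
  move=> i /eqP ij; rewrite indicE memNset ?mulr0//.
  rewrite /A /= in_itv /= /c lerBlDr ltrBrDr ler_pdivrMr// ltr_pdivlMr// => /andP[i1' i2'].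
  apply: ij; apply/val_inj => /=; apply/esym; rewrite /j.
  apply/eqP; by rewrite truncn_eq// i1' i2'.
have mZ : measurable_fun [set: Om] Z.
  by apply: measurable_sum => j; exact: measurable_funM.
have Z2 w : `|Z w| <= 1 + n%:R^-1.
  rewrite (_ : Z w = Y w - (Y w - Z w)); last by ring.
  by apply: (le_trans (ler_normB _ _)); exact: lerD.
have iZ := le1_integrable mZ Z2.
have igZ : P.-integrable [set: Om] (EFin \o (fun w => g w * Z w)).
  apply: (@le1_integrable _ (M * (1 + n%:R^-1))); first exact: measurable_funM.
  by move=> w; rewrite normrM ler_pM.
have gZ : \int[P]_w (g w * Z w) = (\int[P]_w g w) * \int[P]_w Z w.
  under eq_Rintegral do rewrite mulr_sumr.
  under eq_Rintegral do under eq_bigr do rewrite mulrCA.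
  rewrite !Rintegral_fct_sum//; [|by move=> j; exact: integrable_fctZ..].
  rewrite mulr_sumr; apply: eq_bigr => j _.
  by rewrite !RintegralZl// gG// Rintegral_indicT//; ring.
have d1 : `|\int[P]_w (g w * Y w) - \int[P]_w (g w * Z w)| <= M / n%:R.
  by apply: Rintegral_close => // w; rewrite -mulrBr normrM ler_pM.
have d2 : `|\int[P]_w Y w - \int[P]_w Z w| <= n%:R^-1 by exact: Rintegral_close.
have d3 : `|\int[P]_w g w| <= M by exact: Rintegral_norm_le.
rewrite (_ : _ - _ = (\int[P]_w (g w * Y w) - \int[P]_w (g w * Z w)) -
   (\int[P]_w g w) * (\int[P]_w Y w - \int[P]_w Z w)); last by rewrite gZ; ring.
apply: (le_trans (ler_normB _ _)); apply: le_trans Mn.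
by rewrite normrM mulrDl lerD// ler_pM.
Qed.

Section Sum.
Variables (I : choiceType) (G : I -> set (set Om)) (X : I -> Om -> R) (v : I -> R).
Hypothesis indG : mutually_independent P G.
Hypothesis mG : forall i A, G i A -> measurable A.
Hypothesis GX : forall i A, measurable A -> G i (X i @^-1` A).
Hypothesis Xv : forall i, gaussian_cf (X i) (v i).

Let mX i : measurable_fun [set: Om] (X i).
Proof. by move=> _ A mA; rewrite setTI; exact/mG/GX. Qed.

Let msum (s : seq I) : measurable_fun [set: Om] (fun w => \sum_(i <- s) X i w).
Proof. exact: measurable_sum. Qed.

Let mind (s : seq I) (A : I -> set Om) : (forall i, i \in s -> G i (A i)) ->
  measurable_fun [set: Om] (fun w => \prod_(i <- s) \1_(A i) w : R).
Proof.
elim: s => [|i s IH] GA; first by under eq_fun do rewrite big_nil; exact: measurable_cst.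
under eq_fun do rewrite big_cons; apply: measurable_funM.
  by apply/measurable_indic/mG/GA; rewrite mem_head.
by apply: IH => j js; apply: GA; rewrite in_cons js orbT.
Qed.

Let ind1 (s : seq I) (A : I -> set Om) w : `|\prod_(i <- s) \1_(A i) w : R| <= 1.
Proof.
elim: s => [|i s IH]; first by rewrite big_nil normr1.
by rewrite big_cons normrM -[leRHS]mulr1 ler_pM// indic_norm_le1.
Qed.

Let prod_indic (s : seq I) (A : I -> set Om) : uniq s -> (forall i, i \in s -> G i (A i)) ->
  \int[P]_w (\prod_(i <- s) \1_(A i) w) = \prod_(i <- s) fine (P (A i)).
Proof.
move=> us GA; pose J := seq_fset tt s.
have Js i : (i \in J) = (i \in s) by rewrite seq_fsetE.
have sJ : perm_eq s J by apply: uniq_perm => // i; rewrite Js.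
have mcap : measurable (\bigcap_(i in [set` J]) A i).
  by apply: fin_bigcap_measurable; [exact: finite_fset|move=> i /=; rewrite Js => /GA/mG].
rewrite (_ : (fun w => _) = \1_(\bigcap_(i in [set` J]) A i)); last first.
  apply/funext => w; rewrite indicE.
  have [iA|niA] := boolP (w \in _).
    rewrite big_seq big1//= => i si; rewrite indicE mem_set//.
    by move: iA; rewrite inE; apply; rewrite /= Js.
  have /existsNP[i /not_implyP[iJ nA]] : ~ (forall i, i \in J -> A i w).
    by move=> h; move: niA; rewrite notin_setE; apply => i /h.
  rewrite (big_rem i) -?Js//= indicE memNset ?mul0r//.
rewrite Rintegral_indicT// indG; last by move=> i; rewrite Js; exact: GA.
rewrite -(perm_big _ sJ)/=.
elim: s us GA {J Js sJ mcap} => [|i s IH] /=; first by rewrite !big_nil.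
move=> /andP[_ us] GA; rewrite !big_cons fineM ?IH//.
- by move=> j js; apply: GA; rewrite in_cons js orbT.
- by apply: fin_num_measure; apply/mG/GA; rewrite mem_head.
- rewrite big_seq; elim/big_ind: _ => [//|x y|j js]; first exact: fin_numM.
  by apply: fin_num_measure; apply/mG/GA; rewrite in_cons js orbT.
Qed.

(** Independence is given for events only. Carrying indicators of events of further indices through
    the induction provides, at each step, that the cosine of the partial sum is uncorrelated with
    every event of the next index, which is what [uncorrelated_events] requires. *)
Lemma gaussian_cf_joint (s1 s2 : seq I) (A : I -> set Om) (th b : R) :
  uniq (s1 ++ s2) -> (forall i, i \in s2 -> G i (A i)) ->
  \int[P]_w (cos (th * (\sum_(i <- s1) X i w) + b) * \prod_(i <- s2) \1_(A i) w) =
  cos b * expR (- (th ^+ 2 * (\sum_(i <- s1) v i) / 2)) * \prod_(i <- s2) fine (P (A i)).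
Proof.
elim: s1 s2 A b => [|i s1 IH] s2 A b.
  move=> us GA; under eq_Rintegral do rewrite big_nil mulr0 add0r.
  rewrite big_nil mulr0 mul0r oppr0 expR0 mulr1 RintegralZl ?prod_indic//.
  by apply: (@le1_integrable _ 1) => //; exact: mind.
rewrite cat_cons /= => /andP[ins us] GA.
have i_s2 : i \notin s2 by apply: contraNN ins; rewrite mem_cat => ->; rewrite orbT.
have us2 : uniq (s1 ++ i :: s2).
  by rewrite -cat1s uniq_catCA /= ins.
pose g b w := cos (th * (\sum_(i <- s1) X i w) + b) * \prod_(i <- s2) \1_(A i) w.
have mg b' : measurable_fun [set: Om] (g b').
  by apply: measurable_funM; [exact: measurable_cos_affine|exact: mind].
have g1 b' w : `|g b' w| <= 1 by rewrite normrM -[leRHS]mulr1 ler_pM// cos_max.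
have gE b' : \int[P]_w g b' w =
    cos b' * expR (- (th ^+ 2 * (\sum_(i <- s1) v i) / 2)) * \prod_(i <- s2) fine (P (A i)).
  by rewrite IH.
have gG b' B : G i B -> \int[P]_w (g b' w * \1_B w) = (\int[P]_w g b' w) * fine (P B).
  move=> GB; rewrite gE.
  (* [B] becomes the event of index i, so that the induction hypothesis applies to [i :: s2]. *)
  pose A' j := if j == i then B else A j.
  have A's2 j : j \in s2 -> A' j = A j.
    by move=> js2; rewrite /A'; case: eqP => // ji; move: i_s2; rewrite -ji js2.
  have A'i : A' i = B by rewrite /A' eqxx.
  transitivity (\int[P]_w (cos (th * (\sum_(i <- s1) X i w) + b') *
      \prod_(i <- (i :: s2)) \1_(A' i) w)).
    apply: eq_Rintegral => w _; rewrite /g big_cons A'i.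
    have -> : \prod_(j <- s2) \1_(A' j) w = \prod_(j <- s2) \1_(A j) w :> R.
      by apply: eq_big_seq => j js; rewrite A's2.
    by ring.
  rewrite IH//; last first.
    move=> j; rewrite in_cons => /orP[/eqP ->|js]; first by rewrite A'i.
    by rewrite A's2 //; exact: GA.
  have -> : \prod_(j <- (i :: s2)) fine (P (A' j)) = fine (P B) * \prod_(j <- s2) fine (P (A j)).
    by rewrite big_cons A'i; congr (_ * _); apply: eq_big_seq => j js; rewrite A's2.
  by ring.
have mc b' : forall B, measurable B -> G i ((fun w => cos (th * X i w + b')) @^-1` B).
  move=> B mB; apply: (@GX i ((fun x : R => cos (th * x + b')) @^-1` B)).
  by have := @measurable_cos_affine _ _ R setT id th b' (@measurable_id _ _ _) measurableT B mB;
    rewrite setTI.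
have mulE b' b'' : \int[P]_w (g b' w * cos (th * X i w + b'')) = (\int[P]_w g b' w) *
     (cos b'' * expR (- (th ^+ 2 * v i / 2))).
  rewrite -Xv; apply: (@uncorrelated_events (G i) _ _ 1) => //.
  - exact: mG.
  - by move=> A0 /gG.
  - exact: mc.
  - by move=> w; exact: cos_max.
have igc b' b'' : P.-integrable [set: Om] (EFin \o (fun w => g b' w * cos (th * X i w + b''))).
  apply: (@le1_integrable _ 1).
    by apply: measurable_funM => //; exact: measurable_cos_affine.
  by move=> w; rewrite normrM -[leRHS]mulr1 ler_pM// cos_max.
(* Addition formula for the cosine, with both sines written as cosines of phase - pi / 2. The second
   product integrates to 0 because cos(- pi / 2) = 0 in the formula for [X i]. *)
transitivity (\int[P]_w (g b w * cos (th * X i w + 0) -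
    g (b - pi / 2) w * cos (th * X i w + - (pi / 2)))).
  apply: eq_Rintegral => w _; rewrite /g big_cons.
  have cs x : cos (x - pi / 2) = sin x :> R.
    by rewrite cosBpihalf.
  rewrite addr0 (addrA (th * \sum_(j <- s1) X j w)) !cs.
  have -> : th * (X i w + \sum_(j <- s1) X j w) + b =
    th * X i w + (th * (\sum_(j <- s1) X j w) + b) by ring.
  by rewrite cosD; ring.
rewrite RintegralB// !mulE cos0 cosN cos_pihalf mul0r mulr0 subr0 mul1r gE.
by rewrite big_cons mulrDr mulrDl opprD expRD; ring.
Qed.

Lemma gaussian_cf_sum (s : seq I) : uniq s ->
  gaussian_cf (fun w => \sum_(i <- s) X i w) (\sum_(i <- s) v i).
Proof.
move=> us th b; have := @gaussian_cf_joint s [::] (fun=> set0) th b.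
rewrite cats0 big_nil mulr1 => <- //; apply: eq_Rintegral => w _.
by rewrite big_nil mulr1.
Qed.
End Sum.
End Independence.

(** * Exponential Euler scheme for a linear integral equation *)

Lemma near_infty_natSge {R : realType} (x : R) : \forall n \near \oo, x <= n.+1%:R.
Proof.
exists (Num.truncn x) => // m /= xm.
by apply: (le_trans (ltW (truncnS_gt _))); rewrite ler_nat ltnS.
Qed.

(** Heine-Cantor for continuity relative to [A]: half of the local radius is spent on moving the
    centre, and the near-covering form of compactness makes the rest uniform. *)
Lemma compact_unif_continuous {R : realType} {T : pseudoMetricType R} (A : set T)
    (f : T -> R) : compact A ->
  (forall x, A x -> f y @[y --> within A (nbhs x)] --> f x) ->
  forall e : R, 0 < e -> exists2 r : R, 0 < r &
    forall x y, A x -> A y -> ball x r y -> `|f x - f y| < e.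
Proof.
move=> /compact_near_coveringP cA cf e e0.
pose P (r : R) (x : T) := A x -> forall y, A y -> ball x r y -> `|f x - f y| < e.
have : \forall r \near 0^'+, A `<=` P r.
  apply: cA => x Ax.
  have e2 : 0 < e / 2 by rewrite divr_gt0.
  have /cvgrPdist_lt/(_ _ e2) := cf x Ax.
  rewrite near_withinE => /nbhs_ballP[r /= r0 xr].
  have r2 : 0 < r / 2 by rewrite divr_gt0.
  near=> x' r'.
  have xx' : ball x (r / 2) x' by near: x'; exact: nbhsx_ballx.
  have r'r : r' <= r / 2 by near: r'; exact: nbhs_right_le.
  move=> /= Ax' y Ay x'y.
  have xy : ball x r y.
    rewrite [r]splitr; apply: ball_triangle xx' _.
    exact: le_ball x'y.
  have x'r : ball x r x' by apply: le_ball xx'; lra.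
  rewrite (_ : f x' - f y = (f x - f y) - (f x - f x')); last by ring.
  by rewrite [e]splitr (le_lt_trans (ler_normB _ _))// ltrD// xr.
move=> [r /= r0 h]; exists (r / 2); first by rewrite divr_gt0.
have h2 : P (r / 2) `&` A `<=` P (r / 2) by move=> ? [].
move=> x y Ax Ay xy; apply: (h (r / 2)) => //=; last by rewrite divr_gt0.
by rewrite sub0r normrN gtr0_norm ?divr_gt0// ltr_pdivrMr// ltr_pMr// ltr1n.
Unshelve. all: by end_near. Qed.

(** The second-order error of replacing 1 - x by e^(-x), from e^(-x) <= 1 / (1 + x) and (1 + x) (1 -
    x + x^2) = 1 + x^3. *)
Lemma expRN_le (R : realType) (x : R) : 0 <= x -> expR (- x) <= 1 - x + x ^+ 2.
Proof.
move=> x0; have x1 : 0 < 1 + x by lra.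
rewrite expRN; apply: (@le_trans _ _ (1 + x)^-1).
  by rewrite lef_pV2 ?posrE ?expR_gt0// expR_ge1Dx.
rewrite -div1r ler_pdivrMr//.
by rewrite (_ : _ * _ = 1 + x ^+ 3); [rewrite lerDl exprn_ge0|ring].
Qed.

Section EulerScheme.
Context {R : realType}.
Variable kap : R.
Hypothesis kap0 : 0 < kap.

(* The scheme with exact exponential damping of [df = - kap f dt + kap dg]. *)
Fixpoint damped_scheme (g : R -> R) (f0 del : R) (j : nat) : R :=
  if j is i.+1 then
    expR (- (kap * del)) * damped_scheme g f0 del i
    + kap * (g (i.+1%:R * del) - g (i%:R * del))
  else f0.

Variables f g : R -> R.
Hypothesis cf : {within `[0, +oo[, continuous f}.
Hypothesis fE : forall t : R, 0 <= t ->
  f t = f 0 - kap * (\int[lebesgue_measure]_(u in `[0, t]) f u) + kap * g t.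

Let cf_sub (a b : R) : 0 <= a -> {within `[a, b], continuous f}.
Proof.
move=> a0; apply: continuous_subspaceW cf => x /=.
by rewrite !in_itv /= andbT => /andP[ax _]; exact: le_trans ax.
Qed.

Let intf (a b : R) : 0 <= a -> lebesgue_measure.-integrable `[a, b] (EFin \o f).
Proof. by move=> a0; apply: continuous_compact_integrable; [exact: segment_compact|exact: cf_sub]. Qed.

(** Local error of one step, with x = kap (b - a): freezing [f] at [a] under the integral costs x
    om, and replacing 1 - x by e^(-x) costs x^2 M. *)
Let fstep (a b M om : R) : 0 <= a -> a < b -> `|f a| <= M ->
  (forall u, a <= u <= b -> `|f u - f a| <= om) ->
  `|f b - (expR (- (kap * (b - a))) * f a + kap * (g b - g a))|
    <= kap * (b - a) * om + (kap * (b - a)) ^+ 2 * M.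
Proof.
move=> a0 ab fM fom; have b0 : 0 <= b by exact: le_trans (ltW ab).
have := Rintegral_itvB (x := a) (@intf 0 b (lexx 0)).
rewrite !bnd_simp => /(_ a0 (ltW ab)) I1.
have i3 : lebesgue_measure.-integrable `]a, b] (EFin \o f).
  apply: (integrableS _ _ _ (@intf a b a0)) => //.
  by move=> x /=; rewrite !in_itv /= => /andP[/ltW -> ->].
have mab : lebesgue_measure `]a, b] = (b - a)%:E.
  by rewrite lebesgue_measure_itv /= lte_fin ab.
have icst : lebesgue_measure.-integrable `]a, b] (EFin \o cst (f a)).
  apply/integrableP; split; first exact/measurable_EFinP.
  by under eq_integral do rewrite /=; rewrite integral_cst//= mab -EFinM ltry.
have i2 : \int[lebesgue_measure]_(u in `]a, b]) (f u - f a) =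
    \int[lebesgue_measure]_(u in `]a, b]) f u - (b - a) * f a.
  rewrite RintegralB//; congr (_ - _); rewrite Rintegral_cst// mulrC; congr (_ * _);
    exact: (congr1 fine mab).
have b2 : `|\int[lebesgue_measure]_(u in `]a, b]) (f u - f a)| <= (b - a) * om.
  have ifa : lebesgue_measure.-integrable `]a, b] (EFin \o (fun u => f u - f a)).
    exact: integrable_fctB.
  apply: (le_trans (le_normr_Rintegral _ _)) => //.
  have -> : (b - a) * om = \int[lebesgue_measure]_(u in `]a, b]) om.
    by rewrite Rintegral_cst// mulrC; congr (_ * _); apply: esym; exact: (congr1 fine mab).
  apply: le_Rintegral => //; first exact: integrable_norm ifa.
  - apply/integrableP; split; first exact/measurable_EFinP.
    by under eq_integral do rewrite /=; rewrite integral_cst//= mab -EFinM ltry.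
  - by move=> u /=; rewrite in_itv /= => /andP[/ltW u1 u2]; rewrite fom ?u1.
have gab : kap * (g b - g a) = f b - f a + kap * \int[lebesgue_measure]_(u in `]a, b]) f u.
  by rewrite (fE b0) (fE a0) -I1; ring.
rewrite gab.
set x := kap * (b - a).
have x0 : 0 <= x by rewrite mulr_ge0 ?subr_ge0 ?ltW.
have -> : f b - (expR (- x) * f a +
    (f b - f a + kap * \int[lebesgue_measure]_(u in `]a, b]) f u)) =
   - (kap * \int[lebesgue_measure]_(u in `]a, b]) (f u - f a)) - (expR (- x) - 1 + x) * f a.
  by rewrite i2 /x; ring.
apply: (le_trans (ler_normB _ _)); rewrite normrN !normrM (gtr0_norm kap0).
apply: lerD; first by rewrite -mulrA ler_pM2l.
apply: ler_pM => //; rewrite ger0_norm.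
  by have := expRN_le x0; lra.
by have := expR_ge1Dx (- x); lra.
Qed.

(** The damping factor is at most 1, so local errors add up without amplification; about t (n + 1)
    steps contribute kap t om plus a term of order 1 / (n + 1). *)
Lemma damped_scheme_cvg (t : R) : 0 <= t ->
  damped_scheme g (f 0) (n.+1%:R^-1) (Num.truncn (t * n.+1%:R)) @[n --> \oo] --> f t.
Proof.
move=> t0.
have [M fM] : exists M : R, forall x, 0 <= x <= t -> `|f x| <= M.
  have cab := @cf_sub 0 t (lexx 0).
  have [c _ h1] := EVT_max t0 cab; have [c' _ h2] := EVT_min t0 cab.
  exists (`|f c| + `|f c'|) => x xt.
  have xi : x \in `[0, t] by rewrite in_itv.
  have := h1 _ xi; have := h2 _ xi; have := ler_norm (f c); have := ler_norm (- f c').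
  by rewrite normrN ler_norml; have := normr_ge0 (f c); have := normr_ge0 (f c');
    move=> *; apply/andP; split; lra.
have M0 : 0 <= M by apply: le_trans (fM 0 _); rewrite ?lexx.
apply/cvgrPdist_le => e e0.
(* With this choice both the accumulated error kap t om and the single oscillation om between the
   last grid point and t are at most e / 3. *)
pose om := e / 3 / (kap * t + 1).
have kt1 : 0 < kap * t + 1 by rewrite ltr_wpDl// mulr_ge0// ltW.
have om0 : 0 < om by rewrite !divr_gt0.
have [r r0 fr] : exists2 r : R, 0 < r &
    forall x y, 0 <= x <= t -> 0 <= y <= t -> `|x - y| < r -> `|f x - f y| < om.
  have h := @compact_unif_continuous R R `[0, t] f (@segment_compact _ _ _) _ _ om0.
  have [x|r r0 fr] := h.
    rewrite /= in_itv /= => /andP[x0 xt].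
    move/subspace_continuousP : (@cf_sub 0 t (lexx 0)); apply.
    by rewrite /= in_itv /= x0.
  by exists r => // x y xt yt xy; apply: fr => //; rewrite /= in_itv.
near=> n.
set del := n.+1%:R^-1.
have del0 : 0 < del by rewrite invr_gt0.
have delr : del < r.
  apply: (@le_lt_trans _ _ (r / 2)); last by lra.
  rewrite /del -[leRHS]invrK lef_pV2 ?posrE ?invr_gt0 ?divr_gt0//; near: n.
  exact: near_infty_natSge.
have delM : t * kap ^+ 2 * M * del <= e / 3.
  rewrite /del ler_pdivrMr// -ler_pdivrMl ?divr_gt0//; near: n.
  exact: near_infty_natSge.
set N := Num.truncn _.
have Nt : N%:R * del <= t by rewrite ler_pdivrMr// truncn_le mulr_ge0.
have tN : t < N%:R * del + del.
  rewrite -{2}[del]mul1r -mulrDl natr1 ltr_pdivlMr//; exact: truncnS_gt.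
have err j : (j <= N)%N -> `|f (j%:R * del) - damped_scheme g (f 0) del j|
    <= j%:R * (kap * del * om + (kap * del) ^+ 2 * M).
  elim: j => [|j IH] jN; first by rewrite !mul0r /= subrr normr0.
  have jt : j.+1%:R * del <= t.
    by apply: le_trans Nt; rewrite ler_pM2r// ler_nat.
  have st : j.+1%:R * del - j%:R * del = del by rewrite -natr1; ring.
  have j0 : 0 <= j%:R * del by rewrite mulr_ge0// ltW.
  have := @fstep (j%:R * del) (j.+1%:R * del) M om j0.
  rewrite st => /(_ _ _ _); set D := damped_scheme _ _ _ _; move=> h.
  have {}h : `|f (j.+1%:R * del) - (expR (- (kap * del)) * f (j%:R * del) +
      kap * (g (j.+1%:R * del) - g (j%:R * del)))| <= kap * del * om + (kap * del) ^+ 2 * M.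
    apply: h; first by rewrite -subr_gt0 st.
      by apply: fM; rewrite j0 (le_trans _ jt)// -subr_ge0 st ltW.
    move=> u /andP[u1 u2]; apply: ltW; apply: fr.
    - by rewrite (le_trans j0 u1) (le_trans u2).
    - by rewrite j0 (le_trans _ jt)// -subr_ge0 st ltW.
    - by rewrite ger0_norm ?subr_ge0// (le_lt_trans _ delr)// -{2}st lerB.
  rewrite /D /= -/D.
  rewrite (_ : f (j.+1%:R * del) - _ = (f (j.+1%:R * del) - (expR (- (kap * del)) * f (j%:R * del) +
      kap * (g (j.+1%:R * del) - g (j%:R * del)))) +
    expR (- (kap * del)) * (f (j%:R * del) - damped_scheme g (f 0) del j)); last by ring.
  apply: (le_trans (ler_normD _ _)).
  rewrite -[in leRHS]natr1 [leRHS]mulrDl mul1r [leRHS]addrC; apply: lerD => //.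
  rewrite normrM (gtr0_norm (expR_gt0 _)); apply: le_trans (IH (ltnW jN)).
  by rewrite ler_piMl// -expR0 ler_expR oppr_le0 mulr_ge0// ltW.
have Nt' : 0 <= N%:R * del by rewrite mulr_ge0// ltW.
rewrite (_ : f t - _ = (f t - f (N%:R * del)) +
  (f (N%:R * del) - damped_scheme g (f 0) del N)); last by ring.
apply: (le_trans (ler_normD _ _)).
have h1 : `|f t - f (N%:R * del)| <= e / 3.
  apply: (@le_trans _ _ om).
    apply/ltW/fr; rewrite ?t0 ?lexx ?Nt ?Nt'//.
    by rewrite ger0_norm ?subr_ge0//; lra.
  by rewrite /om ler_pdivrMr// ler_peMr// ?divr_ge0// ?(ltW e0)// lerDr mulr_ge0// ltW.
have h2 : `|f (N%:R * del) - damped_scheme g (f 0) del N| <= kap * t * om + t * kap ^+ 2 * M * del.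
  apply: (le_trans (err N (leqnn _))).
  rewrite (_ : _ * _ = (N%:R * del) * (kap * om + kap ^+ 2 * del * M)); last by ring.
  rewrite (_ : kap * t * om + t * kap ^+ 2 * M * del = t * (kap * om + kap ^+ 2 * del * M)); last by ring.
  apply: ler_wpM2r => //; apply: addr_ge0; first by rewrite mulr_ge0// ltW.
  by apply: mulr_ge0 => //; apply: mulr_ge0; [exact: sqr_ge0|exact: ltW].
have h3 : kap * t * om <= e / 3.
  by rewrite /om mulrA ler_pdivrMr//; lra.
by lra.
Unshelve. all: by end_near. Qed.

End EulerScheme.

Lemma cvg_fct_sum {R : realType} {T I : Type} {F : set_system T} {FF : Filter F}
    (r : seq I) (P : pred I) (u : I -> T -> R) (l : I -> R) :
  (forall i, P i -> u i x @[x --> F] --> l i) ->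
  \sum_(i <- r | P i) u i x @[x --> F] --> \sum_(i <- r | P i) l i.
Proof. by apply: cvg_big => //; exact: add_continuous. Qed.

(** * Covariances of the Euler scheme *)

Section DampedCovariance.
Context {R : realType}.
Variables (q kap del : R).

(** Coefficient of the increment number [l] of the driving path in the iterate number [j] of the
    scheme. *)
Definition damped_coef (j l : nat) : R := if (l < j)%N then kap * q ^+ (j - l.+1) else 0.

(** Covariance of the iterates [i] and [j] when the initial value has variance kap / 2 and is
    independent of the first [L] increments, themselves independent of variance [del]. *)
Definition damped_cov (L i j : nat) : R :=
  q ^+ i * q ^+ j * (kap / 2) + \sum_(l < L) damped_coef i l * damped_coef j l * del.

Lemma damped_coefS (j l : nat) :
  damped_coef j.+1 l = q * damped_coef j l + (if l == j then kap else 0).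
Proof.
rewrite /damped_coef ltnS; case: (ltngtP l j) => [lj|lj|->].
- by rewrite addr0 mulrCA -exprS; congr (_ * _ ^+ _); lia.
- by rewrite mulr0 addr0.
- by rewrite mulr0 add0r subSS subnn expr0 mulr1.
Qed.

Lemma damped_covC L i j : damped_cov L i j = damped_cov L j i.
Proof.
rewrite /damped_cov (mulrC (q ^+ i)); congr (_ + _).
by apply: eq_bigr => l _; rewrite (mulrC (damped_coef i l)).
Qed.

(** Markov property of the scheme: passing from j to j + 1 multiplies by [q] and adds the increment
    j, which has coefficient 0 in the iterate i <= j. *)
Lemma damped_cov_shift L i j : (i <= j)%N ->
  damped_cov L i j = q ^+ (j - i) * damped_cov L i i.
Proof.
elim: j => [|j IH]; first by rewrite leqn0 => /eqP ->; rewrite subnn expr0 mul1r.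
rewrite leq_eqVlt => /predU1P[->|]; first by rewrite subnn expr0 mul1r.
rewrite ltnS => ij; rewrite subSn// exprS -mulrA -IH// /damped_cov mulrDr exprS.
congr (_ + _); first by ring.
rewrite mulr_sumr; apply: eq_bigr => l _; rewrite damped_coefS.
case: eqP => [->|_]; last by rewrite addr0; ring.
rewrite (_ : damped_coef i j = 0); first by ring.
by rewrite /damped_coef ltnNge ij.
Qed.

Lemma damped_covSS L i : (i < L)%N ->
  damped_cov L i.+1 i.+1 = q ^+ 2 * damped_cov L i i + kap ^+ 2 * del.
Proof.
move=> iL; rewrite /damped_cov mulrDr -addrA; congr (_ + _); first by rewrite exprS; ring.
have c0 : damped_coef i i = 0 by rewrite /damped_coef ltnn.
transitivity (\sum_(l < L) (q ^+ 2 * (damped_coef i l * damped_coef i l * del) +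
    (if l == i :> nat then kap ^+ 2 * del else 0))).
  by apply: eq_bigr => l _; rewrite damped_coefS; case: eqP => [->|_]; rewrite ?c0; ring.
rewrite big_split/= -mulr_sumr; congr (_ + _).
rewrite (bigD1 (Ordinal iL))//= eqxx big1 ?addr0// => l /eqP li.
by rewrite ifN//; apply/eqP => h; apply: li; exact: val_inj.
Qed.

End DampedCovariance.

Lemma damped_schemeE {R : realType} (kap del : R) (g : R -> R) (f0 : R) (L j : nat) : (j <= L)%N ->
  damped_scheme kap g f0 del j = expR (- (kap * del)) ^+ j * f0 +
   \sum_(l < L) damped_coef (expR (- (kap * del))) kap j l * (g (l.+1%:R * del) - g (l%:R * del)).
Proof.
elim: j => [|j IH] jL /=; first by rewrite mul1r big1 ?addr0// => l _; rewrite mul0r.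
rewrite IH ?(ltnW jL)//; set q := expR _.
under [in RHS]eq_bigr do rewrite damped_coefS mulrDl.
rewrite big_split/= exprS mulrDr -!addrA mulrA; congr (_ + _).
congr (_ + _); first by rewrite mulr_sumr; apply: eq_bigr => l _; rewrite mulrA.
rewrite (bigD1 (Ordinal jL))//= eqxx big1 ?addr0// => l /eqP lj.
rewrite ifN ?mul0r//; apply/eqP => h; apply: lj; exact: val_inj.
Qed.

(** The variances follow v -> q^2 v + kap^2 del, for which kap / 2 is almost a fixed point: its
    defect is (kap / 2) (q^2 - 1 + 2 kap del), at most (kap / 2) (2 kap del)^2. Since q^2 <= 1, the
    defects merely add up. *)
Lemma damped_cov_diag_le {R : realType} (kap del : R) (L i : nat) : 0 < kap -> 0 <= del -> (i <= L)%N ->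
  `|damped_cov (expR (- (kap * del))) kap del L i i - kap / 2|
    <= i%:R * (2 * kap ^+ 3 * del ^+ 2).
Proof.
move=> k0 d0; set q := expR _; set C := 2 * kap ^+ 3 * del ^+ 2.
have C0 : 0 <= C by rewrite /C; apply: mulr_ge0; [rewrite mulr_ge0// exprn_ge0// ltW|exact: sqr_ge0].
elim: i => [|i IH] iL.
  rewrite /damped_cov big1 ?addr0 => [|l _]; last by rewrite /damped_coef !mul0r.
  by rewrite expr0 !mul1r subrr normr0 mul0r.
rewrite damped_covSS//.
set D := damped_cov _ _ _ _ _ _ in IH *.
have x0 : 0 <= 2 * kap * del by rewrite !mulr_ge0// ltW.
have qq : q ^+ 2 = expR (- (2 * kap * del)).
  by rewrite /q -expRM_natl; congr expR; ring.
have q1 : 0 <= q ^+ 2 <= 1.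
  by rewrite sqr_ge0 qq -[leRHS]expR0 ler_expR oppr_le0.
rewrite (_ : _ - kap / 2 = q ^+ 2 * (D - kap / 2) +
   kap / 2 * (q ^+ 2 - 1 + 2 * kap * del)); last by field.
have e1 := expRN_le x0; have e2 := expR_ge1Dx (- (2 * kap * del)); rewrite -qq in e1 e2.
apply: (le_trans (ler_normD _ _)); rewrite -[in leRHS]natr1 [leRHS]mulrDl mul1r; apply: lerD.
  apply: le_trans (IH (ltnW iL)); rewrite normrM ger0_norm ?sqr_ge0//.
  by rewrite ler_piMl//; case/andP: q1.
rewrite normrM ger0_norm ?divr_ge0 ?(ltW k0)// ger0_norm; last by lra.
rewrite (_ : C = kap / 2 * (2 * kap * del) ^+ 2); last by rewrite /C; field.
by apply: ler_wpM2l; [rewrite divr_ge0// ltW|lra].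
Qed.

Lemma truncn_ratio_cvg {R : realType} (t : R) : 0 <= t ->
  (Num.truncn (t * n.+1%:R))%:R * n.+1%:R^-1 @[n --> \oo] --> t.
Proof.
move=> t0; apply/cvgrPdist_le => e e0; near=> n.
have n0 : 0 < n.+1%:R :> R by [].
have tn : 0 <= t * n.+1%:R by rewrite mulr_ge0.
have /andP[h1 h2] := truncn_itv tn.
have en : e^-1 <= n.+1%:R by near: n; exact: near_infty_natSge.
rewrite ger0_norm ?subr_ge0 ?ler_pdivrMr// lerBlDr -lerBlDl ler_pdivlMr//.
apply: (@le_trans _ _ (t * n.+1%:R - 1)); last by rewrite lerBlDr natr1 ltW.
by rewrite mulrBl lerB// -ler_pdivrMl// mulr1.
Unshelve. all: by end_near. Qed.

(** The power of q over the time gap tends to the exponential decay. On the diagonal, about t / del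
    defects of order del^2 leave an error of order del. *)
Lemma damped_cov_cvg {R : realType} (kap t u : R) (L : nat -> nat) : 0 < kap -> 0 <= t -> 0 <= u ->
  (forall n, Num.truncn (t * n.+1%:R) <= L n)%N -> (forall n, Num.truncn (u * n.+1%:R) <= L n)%N ->
  damped_cov (expR (- (kap * n.+1%:R^-1))) kap n.+1%:R^-1 (L n)
     (Num.truncn (t * n.+1%:R)) (Num.truncn (u * n.+1%:R)) @[n --> \oo]
  --> kap / 2 * expR (- (kap * `|t - u|)).
Proof.
move=> k0; wlog tu : t u / t <= u.
  move=> wl t0 u0 Lt Lu; case: (leP t u) => [/wl|/ltW ut]; first exact.
  under eq_fun do rewrite damped_covC.
  by rewrite distrC; exact: wl.
move=> t0 u0 Lt Lu; rewrite mulrC distrC ger0_norm ?subr_ge0//.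
have jj n : (Num.truncn (t * n.+1%:R) <= Num.truncn (u * n.+1%:R))%N.
  by apply: le_truncn; rewrite ler_pM2r.
under eq_fun do rewrite damped_cov_shift// -expRM_natl.
apply: cvgM.
  apply: continuous_cvg; first exact: continuous_expR.
  under eq_fun do rewrite mulrN mulrCA natrB// mulrBl.
  by apply: cvgN; apply: cvgM; [exact: cvg_cst|apply: cvgB; exact: truncn_ratio_cvg].
apply/cvgrPdist_le => e e0; near=> n.
have n0 : 0 < n.+1%:R :> R by [].
rewrite distrC; apply: (le_trans (damped_cov_diag_le k0 _ (Lt n))); first by rewrite invr_ge0.
have tn : 0 <= t * n.+1%:R by rewrite mulr_ge0.
have /andP[h1 _] := truncn_itv tn.
have C0 : 0 <= 2 * kap ^+ 3 by rewrite mulr_ge0// exprn_ge0// ltW.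
apply: (@le_trans _ _ (t * n.+1%:R * (2 * kap ^+ 3 * n.+1%:R^-1 ^+ 2))).
  by apply: ler_wpM2r => //; apply: mulr_ge0 => //; exact: sqr_ge0.
rewrite (_ : _ * _ = t * (2 * kap ^+ 3) / n.+1%:R); last by field; rewrite gt_eqF.
rewrite ler_pdivrMr// -ler_pdivrMl//; near: n; exact: near_infty_natSge.
Unshelve. all: by end_near. Qed.

(** * Finite-dimensional laws of the Ornstein-Uhlenbeck family *)

Section OrnsteinUhlenbeckLaw.
Context {disp : measure_display} {Om : measurableType disp} {R : realType}.
Variable P : probability Om R.

Lemma gaussian_cfZ (X : Om -> R) (v c : R) : gaussian_cf P X v ->
  gaussian_cf P (fun w => c * X w) (c ^+ 2 * v).
Proof.
move=> Xv th b; under eq_Rintegral do rewrite mulrA.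
by rewrite Xv exprMn; congr (_ * expR _); ring.
Qed.

Lemma gaussian_cf_cvg (X_ : nat -> Om -> R) (X : Om -> R) (v_ : nat -> R) (v : R) :
  (forall n, measurable_fun [set: Om] (X_ n)) -> measurable_fun [set: Om] X ->
  {ae P, forall w, X_ ^~ w @ \oo --> X w} ->
  (forall n, gaussian_cf P (X_ n) (v_ n)) -> v_ @ \oo --> v -> gaussian_cf P X v.
Proof.
move=> mX_ mX cX gX cv th b.
have c1 : \int[P]_w cos (th * X_ n w + b) @[n --> \oo] --> \int[P]_w cos (th * X w + b).
  apply: (@Rintegral_dominated_cvg _ _ _ P setT (fun n w => cos (th * X_ n w + b)) _ (cst 1)) => //.
  - by move=> n; exact: measurable_cos_affine.
  - exact: measurable_cos_affine.
  - apply: filterS cX => w cw _; apply: continuous_cvg; first exact: continuous_cos.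
    by apply: cvgD; [apply: cvgM; [exact: cvg_cst|exact: cw]|exact: cvg_cst].
  - exact: finite_measure_integrable_cst.
  - by apply: nearW => w n _; exact: cos_max.
have c2 : \int[P]_w cos (th * X_ n w + b) @[n --> \oo] --> cos b * expR (- (th ^+ 2 * v / 2)).
  under eq_fun do rewrite gX.
  apply: cvgM; first exact: cvg_cst.
  apply: continuous_cvg; first exact: continuous_expR.
  apply: cvgN; apply: cvgM; last exact: cvg_cst.
  by apply: cvgM; [exact: cvg_cst|exact: cv].
exact: cvg_unique c1 c2.
Qed.

Section Family.
Variables U W : nat -> R -> {RV P >-> R}.
Hypothesis OU : stationary_OU_family U W.

Let G (i : nat + nat) : set (set Om) :=
  match i with
  | inl k => g_sigma_algebra_preimage (U k 0)
  | inr k => sigma_process `[0, +oo[ (W k)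
  end.

Let preim_measurable (X : Om -> R) A : measurable_fun [set: Om] X ->
  g_sigma_algebra_preimage X A -> measurable A.
Proof. by move=> mX [B mB <-]; exact: mX. Qed.

Let mG i A : G i A -> measurable A.
Proof.
case: i => k /=; first exact: preim_measurable.
apply: smallest_sub; first exact: sigma_algebra_measurable.
by move=> B [t _]; exact: preim_measurable.
Qed.

Let brownian_combination (k : nat) (del : R) (L : nat) (c : nat -> R) w :=
  \sum_(l < L) c l * (W k (l.+1%:R * del) w - W k (l%:R * del) w).

(** Independence is assumed between the sigma-algebras of whole processes, so the combination must
    be measurable for the one generated by [W k] at nonnegative times, not just on [Om]. *)
Let brownian_combination_adapted k del L c A : 0 <= del -> measurable A ->
  G (inr k) (brownian_combination k del L c @^-1` A).
Proof.
move=> d0 mA; pose GT := g_sigma_algebraType (\bigcup_(t in `[0, +oo[) g_sigma_algebra_preimage (W k t)).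
have mW t : 0 <= t -> measurable_fun [set: GT] (W k t : GT -> R).
  move=> t0 _ B mB; apply: sub_sigma_algebra; exists t => /=; first by rewrite in_itv /= t0.
  by exists B.
have : measurable_fun [set: GT] (brownian_combination k del L c : GT -> R).
  apply: measurable_sum => l; apply: measurable_funM => //.
  by apply: measurable_funB; apply: mW; rewrite mulr_ge0.
by move=> /(_ measurableT A mA); rewrite setTI.
Qed.

Let brownian_combination_cf k del L c : 0 <= del ->
  gaussian_cf P (brownian_combination k del L c) (\sum_(l < L) c l ^+ 2 * del).
Proof.
move=> d0; have [bm _ _ _ _] := OU; have [_ _ law ind] := bm k.
pose tt (i : nat) : R := i%:R * del.
have := ind tt; rewrite /tt mul0r => /(_ (lexx 0)).
have h : {homo tt : i j / (i <= j)%N >-> i <= j}.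
  by move=> i j ij; apply: ler_wpM2r => //; rewrite ler_nat.
move=> /(_ h) {}ind.
pose D (i : nat) (w : Om) := W k (i.+1%:R * del) w - W k (i%:R * del) w.
have mD i : measurable_fun [set: Om] (D i) by exact: measurable_funB.
have := @gaussian_cf_sum _ _ _ P nat _ (fun i w => c i * D i w) (fun i => c i ^+ 2 * del) ind.
move=> /(_ _ _ _ (iota 0 L) (iota_uniq _ _)) h2.
rewrite /brownian_combination -(big_mkord xpredT (fun l => c l ^+ 2 * del)).
under eq_fun do rewrite -(big_mkord xpredT (fun l => c l * (W k (l.+1%:R * del) _ - W k (l%:R * del) _))).
rewrite /index_iota subn0; apply: h2.
- by move=> i A; apply: preim_measurable; exact: mD.
- move=> i A mA; exists ((fun x => c i * x) @^-1` A); last by rewrite setTI.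
  rewrite -[X in measurable X]setTI.
  have mc : measurable_fun [set: R] (fun x : R => c i * x) by exact: measurable_funM.
  exact: mc.
- move=> i; apply: gaussian_cfZ => th b; apply: gaussian_cos => //.
  have := law (tt i) (tt i.+1); rewrite /tt.
  have -> : i.+1%:R * del - i%:R * del = del by rewrite -natr1; ring.
  apply; first by rewrite mulr_ge0.
  by apply: ler_wpM2r => //; rewrite ler_nat.
Qed.

Variables (m : nat) (a : 'I_m -> R) (k : 'I_m -> nat) (t : 'I_m -> R).
Hypothesis t0 : forall i, 0 <= t i.

Let kap (j : nat) : R := j.+1%:R.
Let del (n : nat) : R := n.+1%:R^-1.
Let qn n j := expR (- (kap j * del n)).
Let tn (n : nat) i := Num.truncn (t i * n.+1%:R).
Let Ln n := (\max_(i < m) tn n i)%N.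
Let K := (\max_(i < m) k i).+1.

Let S_ n w := \sum_(i < m) a i * damped_scheme (kap (k i))
  (fun u => W (k i) u w) (U (k i) 0 w) (del n) (tn n i).

Let tL n i : (tn n i <= Ln n)%N. Proof. exact: (leq_bigmax i). Qed.
Let kK i : (k i < K)%N. Proof. by rewrite ltnS; exact: (leq_bigmax i). Qed.

(** Several indices i may share one process. Regrouping by process j < K writes the scheme through
    independent pieces: the initial values, with coefficients [Ac], and one Brownian combination per
    process, with coefficients [Bc]. *)
Let Ac n j := \sum_(i < m | k i == j) a i * qn n j ^+ tn n i.
Let Bc n j l := \sum_(i < m | k i == j) a i * damped_coef (qn n j) (kap j) (tn n i) l.

Let S_E n w : S_ n w = \sum_(j < K) Ac n j * U j 0 w
  + \sum_(j < K) brownian_combination j (del n) (Ln n) (Bc n j) w.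
Proof.
rewrite -big_split/=.
transitivity (\sum_(j < K) \sum_(i < m | k i == j) a i *
   damped_scheme (kap j) (fun u => W j u w) (U j 0 w) (del n) (tn n i)).
  rewrite (exchange_big_dep xpredT)//=; apply: eq_bigr => i _.
  rewrite (bigD1 (Ordinal (kK i)))//= [X in _ + X]big1 ?addr0// => j /andP[/eqP kj /eqP h].
  by exfalso; apply: h; apply: val_inj => /=.
apply: eq_bigr => j _; rewrite mulr_suml.
have -> : brownian_combination j (del n) (Ln n) (Bc n j) w = \sum_(i < m | k i == j)
    a i * \sum_(l < Ln n) damped_coef (qn n j) (kap j) (tn n i) l *
      (W j (l.+1%:R * del n) w - W j (l%:R * del n) w).
  rewrite /brownian_combination.
  under eq_bigr do rewrite mulr_suml.
  rewrite exchange_big/=; apply: eq_bigr => i _; rewrite mulr_sumr.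
  by apply: eq_bigr => l _; rewrite mulrA.
rewrite -big_split/=; apply: eq_bigr => i _.
by rewrite (damped_schemeE _ _ _ _ (tL n i)) mulrDr mulrA.
Qed.

Let vn n := \sum_(j < K) Ac n j ^+ 2 * (kap j / 2)
  + \sum_(j < K) \sum_(l < Ln n) Bc n j l ^+ 2 * del n.

Let S_cf n : gaussian_cf P (S_ n) (vn n).
Proof.
have [_ lawU _ _ ind] := OU.
have dn0 : 0 <= del n by rewrite invr_ge0.
pose X (i : nat + nat) : Om -> R := match i with
  | inl j => fun w => Ac n j * U j 0 w
  | inr j => brownian_combination j (del n) (Ln n) (Bc n j) end.
pose v (i : nat + nat) : R := match i with
  | inl j => Ac n j ^+ 2 * (kap j / 2)
  | inr j => \sum_(l < Ln n) Bc n j l ^+ 2 * del n end.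
have Xv i : gaussian_cf P (X i) (v i).
  case: i => j; last exact: brownian_combination_cf.
  by apply: gaussian_cfZ => th b; apply: gaussian_cos; [rewrite divr_ge0|exact: measurable_funPT|exact: lawU].
have GX i A : measurable A -> G i (X i @^-1` A).
  case: i => j mA; last exact: brownian_combination_adapted.
  exists ((fun x => Ac n j * x) @^-1` A); last by rewrite setTI.
  rewrite -[X in measurable X]setTI.
  have mc : measurable_fun [set: R] (fun x : R => Ac n j * x) by exact: measurable_funM.
  exact: mc.
pose s : seq (nat + nat) := map inl (iota 0 K) ++ map inr (iota 0 K).
have us : uniq s.
  rewrite cat_uniq !map_inj_uniq ?iota_uniq//; [|by move=> ? ? []..].
  by rewrite andbT; apply/hasPn => x /mapP[y _ ->]; apply/mapP => -[].
have := @gaussian_cf_sum _ _ _ P _ G X v ind mG GX Xv s us.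
have iK : index_iota 0 K = iota 0 K by rewrite /index_iota subn0.
have -> : (fun w => \sum_(i <- s) X i w) = S_ n.
  apply/funext => w; rewrite S_E big_cat !big_map -iK.
  by rewrite (big_mkord xpredT (fun j => X (inl j) w)) (big_mkord xpredT (fun j => X (inr j) w)).
have -> // : \sum_(i <- s) v i = vn n.
rewrite /vn big_cat !big_map -iK.
by rewrite (big_mkord xpredT (fun j => v (inl j))) (big_mkord xpredT (fun j => v (inr j))).
Qed.

Let vnE n : vn n = \sum_(i < m) \sum_(i' < m | k i' == k i)
  a i * a i' * damped_cov (qn n (k i)) (kap (k i)) (del n) (Ln n) (tn n i) (tn n i').
Proof.
rewrite /vn -big_split/=.
transitivity (\sum_(j < K) \sum_(i < m | k i == j) \sum_(i' < m | k i' == j)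
  a i * a i' * damped_cov (qn n j) (kap j) (del n) (Ln n) (tn n i) (tn n i')).
  apply: eq_bigr => j _.
  transitivity (\sum_(i < m | k i == j) \sum_(i' < m | k i' == j)
    (a i * qn n j ^+ tn n i) * (a i' * qn n j ^+ tn n i') * (kap j / 2) +
    \sum_(i < m | k i == j) \sum_(i' < m | k i' == j) \sum_(l < Ln n)
    (a i * damped_coef (qn n j) (kap j) (tn n i) l) *
    (a i' * damped_coef (qn n j) (kap j) (tn n i') l) * del n).
    congr (_ + _).
      rewrite expr2 big_distrlr/= mulr_suml; apply: eq_bigr => i _.
      by rewrite mulr_suml.
    under eq_bigr do rewrite expr2 big_distrlr/= mulr_suml.
    rewrite exchange_big/=; apply: eq_bigr => i _.
    under eq_bigr do rewrite mulr_suml.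
    by rewrite exchange_big.
  rewrite -big_split/=; apply: eq_bigr => i _; rewrite -big_split/=; apply: eq_bigr => i' _.
  rewrite /damped_cov mulrDr; congr (_ + _); first by ring.
  by rewrite mulr_sumr; apply: eq_bigr => l _; ring.
rewrite (exchange_big_dep xpredT)//=; apply: eq_bigr => i _.
rewrite (bigD1 (Ordinal (kK i)))//= [X in _ + X]big1 ?addr0// => j /andP[/eqP kj /eqP h].
by exfalso; apply: h; apply: val_inj => /=.
Qed.

(** The schemes [S_] are exactly Gaussian at every mesh and converge almost surely, so only the
    limit of their variances has to be found. *)
Lemma stationary_OU_cf :
  gaussian_cf P (fun w => \sum_(i < m) a i * U (k i) (t i) w)
    (\sum_(i < m) \sum_(i' < m | k i' == k i)
      a i * a i' * ((k i).+1%:R / 2 * expR (- ((k i).+1%:R * `|t i - t i'|)))).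
Proof.
have [_ _ cU eU _] := OU.
apply: (@gaussian_cf_cvg S_ _ vn).
- move=> n; rewrite (funext (S_E n)); apply: measurable_funD; apply: measurable_sum => j.
    by apply: measurable_funM => //; exact: measurable_funPT.
  apply: measurable_sum => l; apply: measurable_funM => //.
  by apply: measurable_funB; exact: measurable_funPT.
- by apply: measurable_sum => i; apply: measurable_funM => //; exact: measurable_funPT.
- have cU' := (ae_foralln (fun k => cU k)).
  have eU' := (ae_foralln (fun k => eU k)).
  apply: filterS2 cU' eU' => w cw ew.
  apply: cvg_fct_sum => i _; apply: cvgM; first exact: cvg_cst.
  by apply: (@damped_scheme_cvg R (kap (k i)) _ (fun t => U (k i) t w)) => //; exact: ew.
- exact: S_cf.
- rewrite (funext vnE); apply: cvg_fct_sum => i _; apply: cvg_fct_sum => i' _.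
  apply: cvgM; first exact: cvg_cst.
  apply: (@damped_cov_cvg R (kap (k i)) (t i) (t i') Ln) => // n; exact: tL.
Qed.

End Family.
End OrnsteinUhlenbeckLaw.

(** * Fixed-time marginals of Skorokhod convergence *)

Section LowerIntegral.
Context {disp : measure_display} {Om : measurableType disp} {R : realType}.
Variable P : probability Om R.

(* The integral of a nonnegative function is defined as a supremum over simple
   functions, hence monotone without any measurability assumption. *)
Lemma ge0_le_expectation (f g : Om -> R) : (forall w, 0 <= f w) -> (forall w, f w <= g w) ->
  ('E_P[f] <= 'E_P[g])%E.
Proof.
move=> f0 fg; have g0 w : 0 <= g w by exact: le_trans (fg w).
rewrite unlock !ge0_integralTE => [|w|w]; rewrite ?lee_fin//.
apply: ereal_sup_le => x [h hf <-]; exists h => // w.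
by apply: (le_trans (hf w)); rewrite lee_fin.
Qed.

Lemma expectation_bound (f : Om -> R) (M : R) : (forall w, 0 <= f w <= M) ->
  ('E_P[f])%E \is a fin_num /\ 0 <= fine ('E_P[f])%E <= M.
Proof.
move=> fM; have f0 w : 0 <= f w by case/andP: (fM w).
have l0 : (0%:E <= 'E_P[f])%E by exact: expectation_ge0.
have lM : ('E_P[f] <= M%:E)%E.
  have := @ge0_le_expectation f (cst M) f0; rewrite expectation_cst; apply.
  by move=> w; case/andP: (fM w).
have fn : ('E_P[f])%E \is a fin_num by rewrite fin_numElt (lt_le_trans _ l0) ?ltNyr// (le_lt_trans lM)// ltry.
by rewrite fn -!lee_fin fineK// l0 lM.
Qed.

Lemma fine_le_expectation (f g : Om -> R) (M : R) : (forall w, 0 <= f w) ->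
  (forall w, f w <= g w) -> (forall w, g w <= M) -> fine ('E_P[f])%E <= fine ('E_P[g])%E.
Proof.
move=> f0 fg gM.
have [|ff _] := @expectation_bound f M; first by move=> w; rewrite f0 (le_trans (fg w)).
have [|gf _] := @expectation_bound g M; first by move=> w; rewrite (le_trans (f0 w)) /=.
by rewrite -lee_fin !fineK//; exact: ge0_le_expectation.
Qed.

End LowerIntegral.

Section TimeMarginals.
Context {R : realType}.
Variables (m : nat) (a : 'I_m -> R) (k : 'I_m -> nat) (t : 'I_m -> R).
Hypothesis t0 : forall i, 0 <= t i.
Variables (phi : R -> R) (M C : R).
Hypothesis phi0 : forall x, 0 <= phi x <= M.
Hypothesis C0 : 0 <= C.
Hypothesis phiC : forall x y, `|phi x - phi y| <= C * `|x - y|.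

Let ev (x : R -> nat -> R) (u : 'I_m -> R) : R := \sum_(i < m) a i * x (u i) (k i).
Let pen (u : 'I_m -> R) : R := \sum_(i < m) `|u i - t i|.
Let val (L : R) x u : R := phi (ev x u) - L * pen u.

(* Evaluation at fixed times is not Skorokhod continuous; taking the supremum
   over nearby times, at a cost proportional to the displacement, makes it so. *)
Definition time_penalized_sup (L : R) (x : R -> nat -> R) : R :=
  sup [set val L x u | u in [set u | forall i, 0 <= u i]].

Let pen0 u : 0 <= pen u. Proof. by apply: sumr_ge0. Qed.

Let M0 : 0 <= M.
Proof. by case/andP: (phi0 0) => h1 h2; exact: le_trans h1 h2. Qed.

Let valM (L : R) x u : 0 <= L -> val L x u <= M.
Proof.
move=> L0; rewrite /val lerBlDr; apply: le_trans (_ : M <= _); first by case/andP: (phi0 (ev x u)).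
by rewrite lerDl mulr_ge0.
Qed.

Let val_le (L : R) x (u : 'I_m -> R) : 0 <= L -> (forall i, 0 <= u i) -> val L x u <= time_penalized_sup L x.
Proof.
move=> L0 u0; apply: ub_le_sup; last by exists u.
by exists M => _ [v _ <-]; exact: valM.
Qed.

Let sup_le (L : R) x (c : R) : (forall u, (forall i, 0 <= u i) -> val L x u <= c) ->
  time_penalized_sup L x <= c.
Proof. by move=> h; apply: ge_sup; [exists (val L x t), t|move=> _ [u u0 <-]; exact: h]. Qed.

Lemma le_time_penalized_sup (L : R) x : 0 <= L -> phi (ev x t) <= time_penalized_sup L x.
Proof.
move=> L0; apply: le_trans (val_le x L0 t0).
by rewrite /val /pen big1 ?mulr0 ?subr0// => i _; rewrite subrr normr0.
Qed.

Lemma time_penalized_sup_bound (L : R) x : 0 <= L -> 0 <= time_penalized_sup L x <= M.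
Proof.
move=> L0; apply/andP; split; last by apply: sup_le => u _; exact: valM.
by apply: le_trans (le_time_penalized_sup x L0); case/andP: (phi0 (ev x t)).
Qed.

(** A displacement of [M / L] costs as much as [phi] can ever gain, so the supremum is decided by
    times in a bounded window. *)
Let val_far (L : R) x u i : 0 < L -> M <= L * `|u i - t i| -> val L x u <= 0.
Proof.
move=> L0 h; rewrite /val subr_le0; apply: (@le_trans _ _ M).
  by case/andP: (phi0 (ev x u)).
apply: (le_trans h); rewrite ler_pM2l// /pen (bigD1 i)//= lerDl.
exact: sumr_ge0.
Qed.

Let A : R := \sum_(i < m) `|a i|.

Let A0 : 0 <= A. Proof. exact: sumr_ge0. Qed.

Let val_close (L : R) x y u v (del : R) : 0 <= L -> (forall i, `|u i - v i| <= del) ->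
  (forall i, `|y (u i) (k i) - x (v i) (k i)| <= del) ->
  `|val L y u - val L x v| <= (C * A + L * m%:R) * del.
Proof.
move=> L0 uv yx.
rewrite (_ : _ - _ = (phi (ev y u) - phi (ev x v)) - L * (pen u - pen v)); last by rewrite /val; ring.
apply: (le_trans (ler_normB _ _)); rewrite mulrDl; apply: lerD.
  apply: (le_trans (phiC _ _)); rewrite -mulrA; apply: ler_wpM2l => //.
  rewrite /ev -sumrB; apply: (le_trans (ler_norm_sum _ _ _)).
  rewrite /A mulr_suml; apply: ler_sum => i _.
  by rewrite -mulrBr normrM; apply: ler_wpM2l.
rewrite normrM ger0_norm// -mulrA; apply: ler_wpM2l => //.
rewrite /pen -sumrB; apply: (le_trans (ler_norm_sum _ _ _)).
rewrite mulr_natl -[m in _ *+ m]card_ord -sumr_const; apply: ler_sum => i _.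
apply: (le_trans (ler_dist_dist _ _)).
by rewrite opprB addrA subrK.
Qed.

(** A time change carries candidate times for [y] to candidate times for [x], and back because it is
    onto; along this correspondence the penalised values differ by at most [D * del]. *)
Lemma time_penalized_sup_continuous (L : R) : 0 < L -> skorokhod_continuous (time_penalized_sup L).
Proof.
move=> L0 x _ e e0.
pose D := C * A + L * m%:R.
have D0 : 0 <= D by apply: addr_ge0; [exact: mulr_ge0|rewrite mulr_ge0// ltW].
(* Past [T] every time is more than [M / L] away from [t i], even after a time change that moves [T]
   by less than [del <= 1]; hence the margin 2. *)
pose T := \sum_(i < m) t i + M / L + 2.
have tT i : t i + M / L + 2 <= T.
  by rewrite /T lerD2r lerD2r (bigD1 i)//= lerDl; exact: sumr_ge0.
have ML : 0 <= M / L by rewrite divr_ge0// ltW.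
have T0 : 0 < T by rewrite ltr_wpDl// addr_ge0//; exact: sumr_ge0.
pose del := Num.min 1 (e / 2 / (D + 1)).
have D1 : 0 < D + 1 by rewrite ltr_wpDl.
have del0 : 0 < del by rewrite lt_min ltr01 !divr_gt0.
have Dd : D * del <= e / 2.
  apply: (@le_trans _ _ (D * (e / 2 / (D + 1)))).
    by apply: ler_wpM2l => //; rewrite ge_min lexx orbT.
  rewrite mulrA ler_pdivrMr//; nra.
exists T, (\max_(i < m) k i).+1, del; split => // y _ [lam [lam0 lami lams] near].
have lam_ge0 u : 0 <= u -> 0 <= lam u.
  by rewrite le_eqVlt => /predU1P[<-|u0]; [rewrite lam0|rewrite -lam0 ltW// lami].
have kK i : (k i < (\max_(i < m) k i).+1)%N by rewrite ltnS; exact: (leq_bigmax i).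
have close u : (forall i, 0 <= u i <= T) -> `|val L y u - val L x (fun i => lam (u i))| <= e / 2.
  move=> uT; apply: le_trans Dd; apply: val_close; first exact: ltW.
    by move=> i; have [h _] := near _ (uT i); rewrite distrC ltW.
  by move=> i; have [_ h] := near _ (uT i); rewrite ltW// h.
have yx : time_penalized_sup L y <= time_penalized_sup L x + e / 2.
  apply: sup_le => u u0.
  have [/forallP h|] := boolP [forall i, u i <= T].
    have := close u; rewrite ler_norml => hc.
    have {}hc : val L y u <= val L x (fun i => lam (u i)) + e / 2.
      have /andP[_] : - (e / 2) <= val L y u - val L x (fun i => lam (u i)) <= e / 2.
        by apply: hc => i; rewrite u0 h.
      by rewrite lerBlDl.
    apply: (le_trans hc); rewrite lerD2r; apply: val_le => //; first exact: ltW.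
    by move=> i; exact: lam_ge0.
  move=> /forallPn; case=> i; rewrite -ltNge => Tu.
  apply: (@le_trans _ _ 0).
    apply: (@val_far _ _ _ i) => //; rewrite mulrC -ler_pdivrMr//.
    by apply: le_trans (ler_norm _); have := tT i; lra.
  by rewrite addr_ge0// ?divr_ge0// ?(ltW e0)//; case/andP: (time_penalized_sup_bound x (ltW L0)).
have xy : time_penalized_sup L x <= time_penalized_sup L y + e / 2.
  apply: sup_le => u u0.
  have /choice[v vP] : forall i, exists v, 0 <= v /\ lam v = u i.
    by move=> i; have [v v0 vu] := lams _ (u0 i); exists v.
  have [/forallP h|] := boolP [forall i, v i <= T].
    have -> : u = (fun i => lam (v i)) by apply/funext => i; have [_ ->] := vP i.
    have := close v; rewrite ler_norml => hc.
    have {}hc : val L x (fun i => lam (v i)) <= val L y v + e / 2.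
      have /andP[+ _] : - (e / 2) <= val L y v - val L x (fun i => lam (v i)) <= e / 2.
        by apply: hc => i; rewrite h andbT; have [] := vP i.
      by rewrite lerNl opprB lerBlDl.
    apply: (le_trans hc); rewrite lerD2r; apply: val_le => //; first exact: ltW.
    by move=> i; have [] := vP i.
  move=> /forallPn; case=> i; rewrite -ltNge => Tv.
  have [v0 vu] := vP i.
  have uT : T - 1 <= u i.
    rewrite -vu; apply: (@le_trans _ _ (lam T)); last exact/ltW/lami/Tv/ltW.
    have [] := near T; first by rewrite lexx ltW.
    rewrite ltr_norml => /andP[h1 _] _.
    have : del <= 1 by rewrite ge_min lexx.
    by lra.
  apply: (@le_trans _ _ 0).
    apply: (@val_far _ _ _ i) => //; rewrite mulrC -ler_pdivrMr//.
    by apply: le_trans (ler_norm _); have := tT i; lra.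
  by rewrite addr_ge0// ?divr_ge0// ?(ltW e0)//; case/andP: (time_penalized_sup_bound y (ltW L0)).
by rewrite (@le_lt_trans _ _ (e / 2))//; [rewrite ler_norml; apply/andP; split; lra|lra].
Qed.

(** Within distance [r] of the prescribed times the path moves by at most [eta]; beyond it the
    penalty exceeds any gain. Together with [le_time_penalized_sup] this pins the supremum to the
    evaluation on continuous paths. *)
Lemma time_penalized_sup_le (L : R) x (r eta : R) : 0 < L -> M <= L * r -> 0 <= eta ->
  (forall i (u : R), 0 <= u -> `|u - t i| < r -> `|x u (k i) - x (t i) (k i)| <= eta) ->
  time_penalized_sup L x <= phi (ev x t) + C * A * eta.
Proof.
move=> L0 Lr eta0 xr; apply: sup_le => u u0.
have [/forallP h|] := boolP [forall i, `|u i - t i| < r].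
  apply: (@le_trans _ _ (phi (ev x u))); first by rewrite lerBlDr lerDl mulr_ge0// ltW.
  rewrite -lerBlDl; apply: (le_trans (ler_norm _)); apply: (le_trans (phiC _ _)).
  rewrite -mulrA; apply: ler_wpM2l => //.
  rewrite /ev -sumrB; apply: (le_trans (ler_norm_sum _ _ _)).
  rewrite /A mulr_suml; apply: ler_sum => i _.
  by rewrite -mulrBr normrM; apply: ler_wpM2l => //; exact: xr.
move=> /forallPn; case=> i; rewrite -leNgt => ri.
apply: (@le_trans _ _ 0).
  by apply: (@val_far _ _ _ i) => //; apply: (le_trans Lr); rewrite ler_pM2l.
by rewrite addr_ge0 ?mulr_ge0//; case/andP: (phi0 (ev x t)).
Qed.

End TimeMarginals.

(** Lets the oscillation near [t] be tested at rational times only, so that a large oscillation is a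
    countable union of events. *)
Lemma within_continuous_rat_dense {R : realType} (f : R -> R) (t r eta : R) :
  {within `[0, +oo[, continuous f} ->
  (forall q : rat, 0 <= ratr q :> R -> `|ratr q - t| < r -> `|f (ratr q) - f t| <= eta) ->
  forall u, 0 <= u -> `|u - t| < r -> `|f u - f t| <= eta.
Proof.
move=> cf h u u0 ur; apply/ler_addgt0Pr => e e0.
have u0' : `[0, +oo[%classic u by rewrite /= in_itv /= u0.
have /cvgrPdist_lt/(_ _ e0) : f x @[x --> within `[0, +oo[ (nbhs u)] --> f u.
  by move/subspace_continuousP : cf; apply.
rewrite near_withinE => /nbhs_ballP[d /= d0 fd].
pose d' := Num.min d (r - `|u - t|).
have d'0 : 0 < d' by rewrite lt_min d0 subr_gt0.
have uud : u < u + d' by rewrite ltrDl.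
have [q] := rat_in_itvoo uud; rewrite in_itv /= => /andP[uq qd].
have uqd : `|u - ratr q| < d' by rewrite distrC gtr0_norm ?subr_gt0// ltrBlDl.
have q0 : 0 <= ratr q :> R by rewrite (le_trans u0)// ltW.
have fq : `|f u - f (ratr q)| < e.
  apply: fd; last by rewrite /= in_itv /= q0.
  by rewrite /ball /= (lt_le_trans uqd)// ge_min lexx.
have qr : `|ratr q - t| < r.
  rewrite (_ : ratr q - t = (u - t) - (u - ratr q)); last by ring.
  apply: (le_lt_trans (ler_normB _ _)).
  have : d' <= r - `|u - t| by rewrite ge_min lexx orbT.
  by lra.
rewrite (_ : f u - f t = (f (ratr q) - f t) + (f u - f (ratr q))); last by ring.
by apply: (le_trans (ler_normD _ _)); rewrite lerD ?h// ltW.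
Qed.

Lemma lipschitz_fct_measurable {R : realType} (phi : R -> R) (C : R) :
  (forall x y, `|phi x - phi y| <= C * `|x - y|) -> measurable_fun [set: R] phi.
Proof.
move=> phiC; apply: continuous_measurable_fun => x.
apply/cvgrPdist_le => e e0; have C1 : 0 < `|C| + 1 by rewrite ltr_wpDl.
near=> y; apply: (le_trans (phiC _ _)).
apply: (@le_trans _ _ ((`|C| + 1) * `|x - y|)).
  by apply: ler_wpM2r => //; have := ler_norm C; lra.
rewrite -ler_pdivlMl//; near: y.
by apply: cvgr_dist_le; [exact: cvg_id|rewrite mulr_gt0// invr_gt0].
Unshelve. all: by end_near. Qed.

Section SkorokhodMarginals.
Context {R : realType}.
Context {d1 : measure_display} {Om1 : measurableType d1} (P : probability Om1 R).
Context {d2 : measure_display} {Om2 : measurableType d2} (Q : probability Om2 R).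
Variables (X : R -> Om1 -> R -> nat -> R) (U : nat -> R -> {RV Q >-> R}).
Hypothesis XU : skorokhod_cvg_in_law P X Q (fun w t k => U k t w).
Hypothesis cU : forall k, {ae Q, forall w, {within `[0, +oo[, continuous (fun t : R => U k t w)}}.
Variables (m : nat) (a : 'I_m -> R) (k : 'I_m -> nat) (t : 'I_m -> R).
Hypothesis t0 : forall i, 0 <= t i.

(** The exceptional event for the limit process: an oscillation above [eta] within 1 / (n + 1) of
    [t i]. Continuity of the paths makes its probability vanish as n grows. *)
Let jump (eta : R) (n : nat) (i : 'I_m) : set Om2 :=
  \bigcup_q (if (0 <= ratr q :> R) && (`|ratr q - t i| < n.+1%:R^-1)
    then [set w | eta < `|U (k i) (ratr q) w - U (k i) (t i) w|] else set0).

Let jump_measurable eta n i : measurable (jump eta n i).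
Proof.
apply: bigcupT_measurable_rat => q; case: ifP => // _.
rewrite -[X in measurable X]setTI.
have mf : measurable_fun [set: Om2] (fun w => `|U (k i) (ratr q) w - U (k i) (t i) w|).
  apply: (measurableT_comp (@normr_measurable R setT)).
  by apply: measurable_funB; exact: measurable_funPT.
rewrite (_ : [set w | _] = (fun w => `|U (k i) (ratr q) w - U (k i) (t i) w|) @^-1` `]eta, +oo[).
  by apply: mf => //; exact: measurable_itv.
by apply/seteqP; split => w /=; rewrite in_itv /= andbT.
Qed.

Let jump_cvg eta i : 0 < eta -> \int[Q]_w \1_(jump eta n i) w @[n --> \oo] --> (0 : R).
Proof.
move=> eta0; rewrite -[X in _ --> X](_ : \int[Q]_w (cst 0) w = 0); last first.
  by rewrite Rintegral_cst// mul0r.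
apply: (@Rintegral_dominated_cvg _ _ R Q setT (fun n => \1_(jump eta n i)) (cst 0) (cst 1)) => //.
- apply: filterS (cU (k i)) => w cw _.
  have /cvgrPdist_lt/(_ _ eta0) : U (k i) x w @[x --> within `[0, +oo[ (nbhs (t i))] --> U (k i) (t i) w.
    by move/subspace_continuousP : cw; apply; rewrite /= in_itv /= t0.
  rewrite near_withinE => /nbhs_ballP[d /= d0 fd].
  apply: cvg_near_cst; near=> n.
  rewrite indicE memNset// => -[q _]; case: ifP => // /andP[q0 qt] /=.
  apply/negP; rewrite -leNgt distrC ltW//; apply: fd; last by rewrite /= in_itv /= q0.
  rewrite /ball /= distrC (lt_le_trans qt)//.
  rewrite -[leRHS]invrK lef_pV2 ?posrE ?invr_gt0//; near: n; exact: near_infty_natSge.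
- exact: finite_measure_integrable_cst.
- by apply: nearW => w n _; exact: indic_norm_le1.
Unshelve. all: by end_near. Qed.

Let lin (x : R -> nat -> R) : R := \sum_(i < m) a i * x (t i) (k i).

(** For the converging processes, evaluation lies below the penalised supremum [F], whose
    expectations converge; for the limit, [F] exceeds evaluation by little outside the jump events.
    This bounds the upper limit only. *)
Let limsup_le (phi : R -> R) (M C : R) : (forall x, 0 <= phi x <= M) -> 0 <= C ->
  (forall x y, `|phi x - phi y| <= C * `|x - y|) -> forall e : R, 0 < e ->
  \forall s \near +oo, fine ('E_P[fun w => phi (lin (X s w))])%E <=
    fine ('E_Q[fun w => phi (lin (fun t k => U k t w))])%E + e.
Proof.
move=> phi0 C0 phiC e e0.
have M0 : 0 <= M by case/andP: (phi0 0) => h1 h2; exact: le_trans h1 h2.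
pose A : R := \sum_(i < m) `|a i|.
have A0 : 0 <= A by exact: sumr_ge0.
pose eta := e / 4 / (C * A + 1).
have CA1 : 0 < C * A + 1 by rewrite ltr_wpDl// mulr_ge0.
have eta0 : 0 < eta by rewrite !divr_gt0.
have CAeta : C * A * eta <= e / 4.
  by rewrite /eta mulrA ler_pdivrMr//; have := mulr_ge0 C0 A0; nra.
have [n nP] : exists n : nat, M * \sum_(i < m) \int[Q]_w \1_(jump eta n i) w <= e / 4.
  have : M * \sum_(i < m) \int[Q]_w \1_(jump eta n i) w @[n --> \oo] --> M * \sum_(i < m) (0 : R).
    by apply: cvgM; [exact: cvg_cst|apply: cvg_fct_sum => i _; exact: jump_cvg].
  rewrite big1// mulr0 => /cvgrPdist_le/(_ (e / 4)) [|n0 _ h]; first by rewrite divr_gt0.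
  exists n0; have := h n0 (leqnn _); rewrite sub0r normrN; exact/le_trans/ler_norm.
(* The window 1 / (n + 1) was fixed from the limit process alone; this slope makes leaving it cost
   at least [M]. *)
pose L := M * n.+1%:R + 1.
have L0 : 0 < L by rewrite ltr_wpDl// mulr_ge0.
pose F := time_penalized_sup a k t phi L.
have F0 x : 0 <= F x <= M by exact: (time_penalized_sup_bound a k t0 phi0 x (ltW L0)).
pose FU w := F (fun t k => U k t w).
have FX : fine ('E_P[fun w => F (X s w)])%E @[s --> +oo] --> fine ('E_Q[FU])%E.
  apply: fine_cvg; rewrite fineK; last first.
    by have [] := @expectation_bound _ _ _ Q FU M => // w; exact: F0.
  apply: XU; last by exists M => x; rewrite ger0_norm; case/andP: (F0 x).
  exact: (@time_penalized_sup_continuous R m a k t t0 phi M C phi0 C0 phiC L L0).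
have cU' : {ae Q, forall w i, {within `[0, +oo[, continuous (fun t : R => U (k i) t w)}}.
  by apply: filterS (ae_foralln cU) => w h i.
have [N [mN N0 NP]] := cU'.
(* A measurable majorant of [FU]. The indicator of the null set [N] covers the discontinuous paths,
   and on jump events the bound [M] is used. *)
pose g w := phi (lin (fun t k => U k t w)) + C * A * eta
  + M * (\sum_(i < m) \1_(jump eta n i) w + \1_N w).
have pCA y : 0 <= phi y + C * A * eta.
  apply: addr_ge0; first by case/andP: (phi0 y).
  by apply: mulr_ge0; [exact: mulr_ge0|exact: ltW].
have cQ c : \int[Q]_w c = c by rewrite Rintegral_cst//= probability_setT mulr1.
have FUg w : FU w <= g w.
  have [wN|wN] := pselect (N w).
    apply: (@le_trans _ _ M); first by case/andP: (F0 (fun t k => U k t w)).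
    rewrite /g indicE mem_set// mulrDr mulr1 addrA lerDr addr_ge0//.
    by rewrite mulr_ge0// sumr_ge0.
  have cw i : {within `[0, +oo[, continuous (fun t : R => U (k i) t w)}.
    by move: i; apply: contrapT => h; apply: wN; exact: NP.
  have [/existsP[i /asboolP wi]|] := boolP [exists i, `[< jump eta n i w >]].
    apply: (@le_trans _ _ M); first by case/andP: (F0 (fun t k => U k t w)).
    apply: (@le_trans _ _ (M * (\sum_(i < m) \1_(jump eta n i) w + \1_N w))); last by rewrite lerDr pCA.
    rewrite -[leLHS]mulr1; apply: ler_wpM2l => //.
    rewrite (bigD1 i)//= {1}indicE mem_set// -!addrA lerDl addr_ge0//.
    by rewrite sumr_ge0.
  move=> /existsPn nw.
  apply: (@le_trans _ _ (phi (lin (fun t k => U k t w)) + C * A * eta)); last first.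
    by rewrite lerDl mulr_ge0// addr_ge0// sumr_ge0.
  apply: (@time_penalized_sup_le R m a k t t0 phi M C phi0 C0 phiC L _ n.+1%:R^-1) => //.
  - by rewrite /L ler_pdivlMr// lerDl.
  - exact: ltW.
  - move=> i u u0 ut; apply: (within_continuous_rat_dense (cw i)) u0 ut => q q0 qt.
    rewrite leNgt; apply/negP => h; move/negP : (nw i); apply; apply/asboolP.
    by exists q => //; rewrite q0 qt.
have mlin : measurable_fun [set: Om2] (fun w => lin (fun t k => U k t w)).
  by apply: measurable_sum => i; apply: measurable_funM => //; exact: measurable_funPT.
have mphi : measurable_fun [set: Om2] (fun w => phi (lin (fun t k => U k t w))).
  exact: measurableT_comp (lipschitz_fct_measurable phiC) mlin.
have phiM w : `|phi (lin (fun t k => U k t w))| <= M.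
  by rewrite ger0_norm; case/andP: (phi0 (lin (fun t k => U k t w))).
have iphi := bounded_integrable Q mphi phiM.
have iind (B : set Om2) : measurable B -> Q.-integrable [set: Om2] (EFin \o (\1_B : Om2 -> R)).
  move=> mB; apply: (bounded_integrable Q (M := 1)); first exact: measurable_indic.
  by move=> w; exact: indic_norm_le1.
have ijump := integrable_fct_sum measurableT (index_enum 'I_m) (fun i => iind _ (jump_measurable eta n i)).
have ibad : Q.-integrable [set: Om2] (EFin \o (fun w => M * (\sum_(i < m) \1_(jump eta n i) w + \1_N w))).
  by apply: integrable_fctZ => //; apply: integrable_fctD => //; exact: iind.
have icst (c : R) : Q.-integrable [set: Om2] (EFin \o (fun=> c)).
  exact: finite_measure_integrable_cst.
have ig : Q.-integrable [set: Om2] (EFin \o g).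
  by apply: integrable_fctD => //; exact: integrable_fctD.
have intg : \int[Q]_w g w = \int[Q]_w phi (lin (fun t k => U k t w)) + C * A * eta
    + M * \sum_(i < m) \int[Q]_w \1_(jump eta n i) w.
  rewrite RintegralD//; last exact: integrable_fctD.
  rewrite RintegralD// cQ; congr (_ + _).
  rewrite RintegralZl//; last by apply: integrable_fctD => //; exact: iind.
  rewrite RintegralD//; last exact: iind.
  rewrite Rintegral_indicT// N0 addr0 Rintegral_fct_sum// => i; exact: iind.
have FUle : fine ('E_Q[FU])%E <= fine ('E_Q[fun w => phi (lin (fun t k => U k t w))])%E + e / 2.
  rewrite (expectation_Rintegral Q mphi phiM) /=.
  apply: (@le_trans _ _ (fine ('E_Q[g])%E)).
    apply: (@fine_le_expectation _ _ _ Q FU g (M + C * A * eta + M * (m%:R + 1))) => // w.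
      by case/andP: (F0 (fun t k => U k t w)).
    rewrite /g !lerD//; first by apply: le_trans (phiM w); exact: ler_norm.
    apply: ler_wpM2l => //; apply: lerD; last by apply: le_trans (indic_norm_le1 N w); exact: ler_norm.
    rewrite -[m in leRHS]card_ord -sumr_const; apply: ler_sum => i _.
    by apply: le_trans (indic_norm_le1 (jump eta n i) w); exact: ler_norm.
  have -> : fine ('E_Q[g])%E = \int[Q]_w g w by rewrite unlock.
  by rewrite intg; lra.
have e4 : 0 < e / 4 by rewrite divr_gt0.
near=> s.
apply: (@le_trans _ _ (fine ('E_P[fun w => F (X s w)])%E)).
  apply: (@fine_le_expectation _ _ _ P _ _ M) => w.
  - by case/andP: (phi0 (lin (X s w))).
  - exact: (@le_time_penalized_sup R m a k t t0 phi M phi0 L (X s w) (ltW L0)).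
  - by case/andP: (F0 (X s w)).
have : `|fine ('E_Q[FU])%E - fine ('E_P[fun w => F (X s w)])%E| <= e / 4.
  by near: s; move/cvgrPdist_le : FX; apply.
rewrite ler_norml => /andP[h1 h2]; lra.
Unshelve. all: by end_near. Qed.

Hypothesis mX : forall s, 0 <= s -> forall t k, 0 <= t -> measurable_fun [set: Om1] (fun w => X s w t k).

(** The one-sided bound applied to the nonnegative functions [phi + M] and [M - phi] gives the upper
    and the lower limit. *)
Lemma skorokhod_marginal_cvg (phi : R -> R) (M C : R) : (forall x, `|phi x| <= M) -> 0 <= C ->
  (forall x y, `|phi x - phi y| <= C * `|x - y|) ->
  \int[P]_w phi (\sum_(i < m) a i * X s w (t i) (k i)) @[s --> +oo] -->
  \int[Q]_w phi (\sum_(i < m) a i * U (k i) (t i) w).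
Proof.
move=> phiM C0 phiC.
have mphi := lipschitz_fct_measurable phiC.
have mlin : measurable_fun [set: Om2] (fun w => lin (fun t k => U k t w)).
  by apply: measurable_sum => i; apply: measurable_funM => //; exact: measurable_funPT.
have mQ := measurableT_comp mphi mlin.
have mlinX s : 0 <= s -> measurable_fun [set: Om1] (fun w => lin (X s w)).
  by move=> s0; apply: measurable_sum => i; apply: measurable_funM => //; exact: mX.
have h1 x : 0 <= phi x + M <= M + M.
  by have := phiM x; rewrite ler_norml => /andP[? ?]; apply/andP; split; lra.
have h2 x : 0 <= M - phi x <= M + M.
  by have := phiM x; rewrite ler_norml => /andP[? ?]; apply/andP; split; lra.
have l1 x y : `|(phi x + M) - (phi y + M)| <= C * `|x - y|.
  by rewrite (_ : _ - _ = phi x - phi y)//; ring.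
have l2 x y : `|(M - phi x) - (M - phi y)| <= C * `|x - y|.
  by rewrite (_ : _ - _ = phi y - phi x); [rewrite (distrC x)|ring].
have EX (d' : measure_display) (T : measurableType d') (P' : probability T R) (Y : T -> R) :
    measurable_fun [set: T] Y ->
    fine ('E_P'[fun w => (phi (Y w) + M)%R])%E = \int[P']_w phi (Y w) + M /\
    fine ('E_P'[fun w => (M - phi (Y w))%R])%E = M - \int[P']_w phi (Y w).
  move=> mY; rewrite unlock.
  have iY : P'.-integrable [set: T] (EFin \o (fun w => phi (Y w))).
    exact: (bounded_integrable P' (measurableT_comp mphi mY) (fun w => phiM _)).
  have icst : P'.-integrable [set: T] (EFin \o (fun=> M)) by exact: finite_measure_integrable_cst.
  have cM : \int[P']_w M = M by rewrite Rintegral_cst//= probability_setT mulr1.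
  split; [transitivity (\int[P']_w (phi (Y w) + M))|transitivity (\int[P']_w (M - phi (Y w)))] => //.
    by rewrite RintegralD// cM.
  by rewrite RintegralB// cM.
apply/cvgrPdist_le => e e0; near=> s.
have s0 : 0 <= s by near: s; exact: nbhs_pinfty_ge.
have b1 : fine ('E_P[fun w => (phi (lin (X s w)) + M)%R])%E <=
    fine ('E_Q[fun w => (phi (lin (fun t k => U k t w)) + M)%R])%E + e.
  by near: s; exact: (limsup_le h1 C0 l1 e0).
have b2 : fine ('E_P[fun w => (M - phi (lin (X s w)))%R])%E <=
    fine ('E_Q[fun w => (M - phi (lin (fun t k => U k t w)))%R])%E + e.
  by near: s; exact: (limsup_le h2 C0 l2 e0).
have [e1 e2] := EX _ _ Q _ mlin; have [e3 e4] := EX _ _ P _ (mlinX s s0).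
rewrite e1 e3 in b1; rewrite e2 e4 in b2.
by rewrite ler_norml; apply/andP; split; rewrite /lin in b1 b2; lra.
Unshelve. all: by end_near. Qed.

End SkorokhodMarginals.

(** * Bernstein operators and trigonometric approximation *)

Section Bernstein.
Context {R : realType}.

(* Expectation of [g] under the binomial law with parameters n and y. *)
Fixpoint bernstein (y : R) (n : nat) (g : nat -> R) : R :=
  if n is k.+1 then y * bernstein y k (fun r => g r.+1) + (1 - y) * bernstein y k g else g 0%N.

Lemma bernstein_cst y n c : bernstein y n (fun=> c) = c.
Proof. by elim: n => [//|n IH] /=; rewrite IH; ring. Qed.

Lemma bernsteinD y n g g' : bernstein y n (fun r => g r + g' r) = bernstein y n g + bernstein y n g'.
Proof. by elim: n g g' => [//|n IH] g g' /=; rewrite !IH; ring. Qed.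

Lemma bernsteinZ y n c g : bernstein y n (fun r => c * g r) = c * bernstein y n g.
Proof. by elim: n g => [//|n IH] g /=; rewrite !IH; ring. Qed.

Lemma bernstein_le y n g g' : 0 <= y <= 1 -> (forall r, (r <= n)%N -> g r <= g' r) ->
  bernstein y n g <= bernstein y n g'.
Proof.
move=> /andP[y0 y1]; elim: n g g' => [|n IH] g g' gg' /=; first exact: gg'.
apply: lerD; apply: ler_wpM2l; rewrite ?subr_ge0//; apply: IH => r rn; apply: gg' => //.
exact: leqW.
Qed.

Lemma bernstein_norm_le y n g c : 0 <= y <= 1 -> (forall r, (r <= n)%N -> `|g r| <= c) ->
  `|bernstein y n g| <= c.
Proof.
move=> y01 gc; rewrite ler_norml -{1}(bernstein_cst y n (- c)) -{2}(bernstein_cst y n c).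
by apply/andP; split; apply: bernstein_le => // r /gc; rewrite ler_norml => /andP[].
Qed.

Lemma bernstein_variance y n :
  bernstein y n (fun r => (r%:R - n%:R * y) ^+ 2) = n%:R * y * (1 - y).
Proof.
(* The offset z is needed for the induction: conditioning on one trial shifts the centre by 1 - y or
   by - y. *)
suff h z : bernstein y n (fun r => (r%:R - n%:R * y + z) ^+ 2) = n%:R * y * (1 - y) + z ^+ 2.
  have := h 0; rewrite expr0n /= addr0 => <-; congr bernstein.
  by apply/funext => r; rewrite addr0.
elim: n z => [|n IH] z /=; first by ring.
rewrite (_ : (fun r => _) = (fun r => (r%:R - n%:R * y + (z + (1 - y))) ^+ 2)); last first.
  by apply/funext => r; rewrite -!natr1; ring.
rewrite [X in _ + _ * bernstein _ _ X](_ : _ = (fun r => (r%:R - n%:R * y + (z - y)) ^+ 2)); last first.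
  by apply/funext => r; rewrite -!natr1; ring.
by rewrite !IH -natr1; ring.
Qed.

(** Chebyshev's inequality for the binomial law: the error is dominated pointwise by [eta] plus a
    multiple of the squared deviation, whose expectation is the variance. *)
Lemma bernstein_approx y n g c eta M del : 0 <= y <= 1 -> 0 < del -> 0 <= eta -> 0 <= M ->
  (forall r, (r <= n.+1)%N -> `|g r - c| <= M) ->
  (forall r, (r <= n.+1)%N -> `|r%:R / n.+1%:R - y| < del -> `|g r - c| <= eta) ->
  `|bernstein y n.+1 g - c| <= eta + M / (n.+1%:R * del ^+ 2).
Proof.
move=> y01 del0 eta0 M0 gM geta.
have n0 : 0 < n.+1%:R :> R by [].
set N := n.+1 in gM geta n0 *.
have d2 : 0 < del ^+ 2 by rewrite exprn_gt0.
pose q (r : nat) : R := eta + M / (N%:R * del) ^+ 2 * (r%:R - N%:R * y) ^+ 2.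
have gq r : (r <= N)%N -> `|g r - c| <= q r.
  move=> rN; have [h|h] := ltP `|r%:R / N%:R - y| del.
    by apply: (le_trans (geta r rN h)); rewrite /q lerDl mulr_ge0 ?sqr_ge0// divr_ge0// sqr_ge0.
  apply: (le_trans (gM r rN)); rewrite /q;
    apply: (@le_trans _ _ (M / (N%:R * del) ^+ 2 * (r%:R - N%:R * y) ^+ 2)).
    rewrite mulrAC ler_pdivlMr ?exprn_gt0 ?mulr_gt0//; apply: ler_wpM2l => //.
    rewrite -[leRHS]real_normK ?num_real// lerXn2r ?nnegrE ?mulr_ge0 ?(ltW del0)//.
    rewrite (_ : r%:R - N%:R * y = N%:R * (r%:R / N%:R - y)); last by field; rewrite lt0r_neq0.
    by rewrite normrM (gtr0_norm n0) ler_pM2l.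
  by rewrite lerDr.
have qE : bernstein y N q <= eta + M / (N%:R * del ^+ 2).
  rewrite /q bernsteinD bernstein_cst bernsteinZ bernstein_variance lerD2l.
  rewrite (_ : M / (N%:R * del) ^+ 2 * (N%:R * y * (1 - y)) = M / (N%:R * del ^+ 2) * (y * (1 - y)));
    last first.
    by field; rewrite !lt0r_neq0.
  rewrite ler_piMr ?divr_ge0 ?mulr_ge0 ?(ltW d2)//; case/andP: y01 => y0 y1; nra.
rewrite -[c](bernstein_cst y N) -[- bernstein _ _ _]mulN1r -bernsteinZ -bernsteinD.
apply: le_trans qE; rewrite ler_norml; apply/andP; split.
  rewrite -[- bernstein _ _ _]mulN1r -bernsteinZ; apply: bernstein_le => // r rN.
  by have := gq r rN; rewrite !mulN1r ler_norml => /andP[].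
apply: bernstein_le => // r rN.
by have := gq r rN; rewrite mulN1r ler_norml => /andP[].
Qed.

End Bernstein.

Section TrigApprox.
Context {R : realType}.
Variable m : nat.
Implicit Types (x y z : 'I_m -> R) (f g : ('I_m -> R) -> R).

(** Real trigonometric polynomials with arbitrary frequencies. The free phase makes them closed
    under products, and their expectations are governed by those of cosines of linear forms. *)
Inductive trig : (('I_m -> R) -> R) -> Prop :=
| trig_cos c a b : trig (fun x => c * cos (\sum_(i < m) a i * x i + b))
| trigD f g : trig f -> trig g -> trig (fun x => f x + g x).

Lemma trig_cst c : trig (fun=> c).
Proof.
rewrite (_ : (fun=> c) = (fun x => c * cos (\sum_(i < m) (fun=> 0) i * x i + 0))); first exact: trig_cos.
by apply/funext => x; rewrite big1 ?addr0 ?cos0 ?mulr1// => i _; rewrite mul0r.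
Qed.

Lemma trigM f g : trig f -> trig g -> trig (fun x => f x * g x).
Proof.
move=> tf; elim: tf g => [c a b|f1 f2 _ IH1 _ IH2] g tg; last first.
  rewrite (_ : (fun x => _) = (fun x => f1 x * g x + f2 x * g x)); last by apply/funext => x; ring.
  by apply: trigD; [exact: IH1|exact: IH2].
elim: tg => [c' a' b'|g1 g2 _ IH1 _ IH2]; last first.
  rewrite (_ : (fun x => _) = (fun x => c * cos (\sum_(i < m) a i * x i + b) * g1 x +
    c * cos (\sum_(i < m) a i * x i + b) * g2 x)); last by apply/funext => x; ring.
  by apply: trigD.
rewrite (_ : (fun x => _) = (fun x =>
    c * c' / 2 * cos (\sum_(i < m) (fun i => a i + a' i) i * x i + (b + b')) +
    c * c' / 2 * cos (\sum_(i < m) (fun i => a i - a' i) i * x i + (b - b')))).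
  by apply: trigD; exact: trig_cos.
apply/funext => x /=.
have -> : \sum_(i < m) (a i + a' i) * x i + (b + b') =
   (\sum_(i < m) a i * x i + b) + (\sum_(i < m) a' i * x i + b').
  by under eq_bigr do rewrite mulrDl; rewrite big_split/=; ring.
have -> : \sum_(i < m) (a i - a' i) * x i + (b - b') =
   (\sum_(i < m) a i * x i + b) - (\sum_(i < m) a' i * x i + b').
  by under eq_bigr do rewrite mulrBl; rewrite sumrB; ring.
set u := \sum_(i < m) a i * x i + b; set v := \sum_(i < m) a' i * x i + b'.
by rewrite (cosD u v) (cosD u (- v)) cosN sinN; field.
Qed.

Lemma trig_bernstein (n : nat) f (g : nat -> ('I_m -> R) -> R) : trig f -> (forall r, trig (g r)) ->
  trig (fun x => bernstein (f x) n (fun r => g r x)).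
Proof.
move=> tf; elim: n g => [|n IH] g tg /=; first exact: tg.
apply: trigD; apply: trigM => //; [exact: IH|..|exact: IH].
rewrite (_ : (fun x => _) = (fun x => 1 + (-1) * f x)); last by apply/funext => x; ring.
by apply: trigD; [exact: trig_cst|apply: trigM => //; exact: trig_cst].
Qed.

Arguments bernstein : simpl never.

Definition upd z (j : 'I_m) (c : R) : 'I_m -> R := fun i => if i == j then c else z i.

Fixpoint multi_bernstein (n : nat) (js : seq 'I_m) f y : R :=
  if js is j :: js' then
    bernstein (y j) n (fun r => multi_bernstein n js' (fun z => f (upd z j (r%:R / n%:R))) y)
  else f y.

(** Once all coordinates in [js] are replaced by grid values, [f] is evaluated at constants; what
    remains is a polynomial in the [Y x i]. *)
Lemma trig_multi_bernstein n js f (Y : ('I_m -> R) -> 'I_m -> R) :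
  (forall i, trig (fun x => Y x i)) ->
  (forall z z', (forall i, i \in js -> z i = z' i) -> f z = f z') ->
  trig (fun x => multi_bernstein n js f (Y x)).
Proof.
move=> tY; elim: js f => [|j js IH] f fdep /=.
  rewrite (_ : (fun x => _) = (fun=> f (fun=> 0))); first exact: trig_cst.
  by apply/funext => x; exact: fdep.
apply: (@trig_bernstein n (fun x => Y x j)
  (fun r x => multi_bernstein n js (fun z => f (upd z j (r%:R / n%:R))) (Y x))) => // r; apply: IH => z z' zz'.
apply: fdep => i; rewrite in_cons /upd; case: eqP => //= _; exact: zz'.
Qed.

Definition unit_cube y := forall i, 0 <= y i <= 1.

(** Coordinates are smoothed one at a time, each at the one-dimensional cost; the modulus of
    continuity is inherited when a coordinate is frozen at a grid value. *)
Lemma multi_bernstein_approx n js f M del eta : 0 < del -> 0 <= eta -> 0 <= M ->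
  (forall y, `|f y| <= M) ->
  (forall y j c, unit_cube y -> 0 <= c <= 1 -> `|c - y j| < del -> `|f (upd y j c) - f y| <= eta) ->
  forall y, unit_cube y ->
  `|multi_bernstein n.+1 js f y| <= M /\
  `|multi_bernstein n.+1 js f y - f y| <= (size js)%:R * (eta + (M + M) / (n.+1%:R * del ^+ 2)).
Proof.
move=> del0 eta0 M0; elim: js f => [|j js IH] f fM fdel y y01 /=.
  by rewrite subrr normr0 mul0r.
have r01 r : (r <= n.+1)%N -> 0 <= (r%:R / n.+1%:R : R) <= 1.
  by move=> rn; rewrite divr_ge0//= ler_pdivrMr// mul1r ler_nat.
have IHr r : (r <= n.+1)%N ->
  `|multi_bernstein n.+1 js (fun z => f (upd z j (r%:R / n.+1%:R))) y| <= M /\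
  `|multi_bernstein n.+1 js (fun z => f (upd z j (r%:R / n.+1%:R))) y - f (upd y j (r%:R / n.+1%:R))|
   <= (size js)%:R * (eta + (M + M) / (n.+1%:R * del ^+ 2)).
  move=> rn; apply: (IH (fun z => f (upd z j (r%:R / n.+1%:R)))) => // z i c z01 c01 zc.
  have [->|ij] := eqVneq i j.
    rewrite (_ : upd (upd z j c) j _ = upd z j (r%:R / n.+1%:R)) ?subrr ?normr0//.
    by apply/funext => l; rewrite /upd; case: eqP.
  rewrite (_ : upd (upd z i c) j _ = upd (upd z j (r%:R / n.+1%:R)) i c); last first.
    apply/funext => l; rewrite /upd; case: (eqVneq l j) => // ->.
    by rewrite eq_sym (negbTE ij).
  apply: fdel => //; last by rewrite /upd (negbTE ij).
  by move=> l; rewrite /upd; case: eqP => // _; exact: r01.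
split; first by apply: bernstein_norm_le => // r /IHr[].
rewrite -[in leRHS]natr1 [leRHS]mulrDl mul1r.
set E := eta + _.
pose g r := f (upd y j (r%:R / n.+1%:R)).
rewrite (_ : _ - f y = (bernstein (y j) n.+1
   (fun r => multi_bernstein n.+1 js (fun z => f (upd z j (r%:R / n.+1%:R))) y) + -1 * bernstein (y j) n.+1 g) +
   (bernstein (y j) n.+1 g - f y)); last by rewrite mulN1r; ring.
apply: (le_trans (ler_normD _ _)); apply: lerD.
  rewrite -bernsteinZ -bernsteinD; apply: bernstein_norm_le => // r /IHr[_].
  by rewrite mulN1r.
apply: bernstein_approx => //; first exact: addr_ge0.
  by move=> r _; apply: (le_trans (ler_normB _ _)); apply: lerD; exact: fM.
by move=> r rn; apply: fdel => //; exact: r01.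
Qed.

End TrigApprox.

(** Derivative of the sine at 0. It provides a bounded trigonometric substitute for a coordinate on
    a bounded range. *)
Lemma sin_approx_id {R : realType} (B e : R) : 0 < e ->
  \forall K \near +oo, forall x, `|x| <= B -> `|K * sin (x / K) - x| <= e.
Proof.
move=> e0.
have [B0|B0] := ltP B 0.
  by near=> K => x xB; have := le_trans (normr_ge0 x) xB; rewrite leNgt B0.
have B1 : 0 < B + 1 by rewrite ltr_wpDl.
have eB : 0 < e / (B + 1) by rewrite divr_gt0.
have d := is_derive_sin (0 : R).
have [dv dE] := d; rewrite cos0 in dE.
have /cvg_ex[/= l hl] := dv.
have l1 : l = 1 by rewrite -dE /derive; apply/esym; apply: cvg_lim => //; exact: hl.
move: hl; rewrite l1 => /cvgrPdist_le/(_ _ eB); rewrite near_withinE => /nbhs_ballP[r /= r0 hr].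
near=> K => x xB.
have K0 : 0 < K by near: K; exact: nbhs_pinfty_gt.
have Kr : B / r < K by near: K; apply: nbhs_pinfty_gt; exact: num_real.
have [->|xn0] := eqVneq x 0; first by rewrite mul0r sin0 mulr0 subrr normr0 ltW.
have xK : ball 0 r (x / K).
  rewrite /ball /= sub0r normrN normrM normfV (gtr0_norm K0) ltr_pdivrMr//.
  by apply: (le_lt_trans xB); rewrite mulrC -ltr_pdivrMr.
have xK0 : x / K != 0 by rewrite mulf_neq0// invr_eq0 lt0r_neq0.
move: (hr (x / K) xK xK0).
rewrite /GRing.scale/= mulr1 addr0 sin0 subr0 => h.
rewrite (_ : K * sin (x / K) - x = - x * (1 - (x / K)^-1 * sin (x / K))); last first.
  by field; rewrite lt0r_neq0.
rewrite normrM normrN; apply: (@le_trans _ _ (B * (e / (B + 1)))); first exact: ler_pM.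
by rewrite mulrA ler_pdivrMr//; nra.
Unshelve. all: by end_near. Qed.

Section TrigDense.
Context {R : realType}.
Variables (m : nat) (f : 'rV[R]_m -> R) (M : R).
Hypothesis cf : continuous f.
Hypothesis fM : forall v, `|f v| <= M.

Let box_unif (B e : R) : 0 < e -> exists2 r : R, 0 < r & forall x y : 'I_m -> R,
  (forall i, `|x i| <= B) -> (forall i, `|y i| <= B) -> (forall i, `|x i - y i| < r) ->
  `|f (\row_i x i) - f (\row_i y i)| < e.
Proof.
move=> e0.
pose A := [set v : 'rV[R]_m | forall i, (`[- B, B]%classic : set R) (v ord0 i)].
have cA : compact A by apply: (@rV_compact R m (fun=> `[- B, B]%classic)) => _; exact: segment_compact.
have [x|r r0 h] := @compact_unif_continuous R 'rV[R]_m A f cA _ e e0.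
  by move=> _; apply: cvg_within_filter; exact: cf.
exists r => // x y xB yB xy; apply: h.
- by move=> i; rewrite mxE /= in_itv /= -ler_norml.
- by move=> i; rewrite mxE /= in_itv /= -ler_norml.
- by split => // i j; rewrite !mxE; exact: xy.
Qed.

(** Each coordinate x is replaced by K sin(x / K), then [f] by its Bernstein polynomial. The sines
    always stay in the cube where that polynomial is bounded by [M], so the bound holds on the whole
    space and not only on the box. *)
Lemma trig_dense (B eta : R) : 0 < eta -> exists g : ('I_m -> R) -> R,
  [/\ trig g, forall x, `|g x| <= M &
      forall x, (forall i, `|x i| <= B) -> `|g x - f (\row_i x i)| <= eta].
Proof.
move=> eta0.
have M0 : 0 <= M by apply: le_trans (fM 0).
have e3 : 0 < eta / 3 by rewrite divr_gt0.
(* The box is enlarged by 1 because K sin(x / K) may leave the original one, by at most 1. *)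
have [r r0 fr] := box_unif (`|B| + 1) e3.
have mr0 : 0 < Num.min 1 (r / 2) by rewrite lt_min ltr01 divr_gt0.
have [K [KB sK]] : exists K : R, 0 < K /\ forall x, `|x| <= B -> `|K * sin (x / K) - x| <= Num.min 1 (r / 2).
  near (pinfty_nbhs R) => K; exists K; split; first by near: K; exact: nbhs_pinfty_gt.
  by near: K; exact: sin_approx_id.
have m1 : 0 < m.+1%:R :> R by [].
have e4 : 0 < eta / 3 / m.+1%:R by rewrite !divr_gt0.
have [r' r'0 fr'] := box_unif K e4.
(* [h] maps [0, 1] onto [-K, K] with slope 2K, which explains [del] below, and [h (Y x i)] is K
   sin(x_i / K). *)
pose h (y : R) := K * (2 * y - 1).
pose F (y : 'I_m -> R) := f (\row_i h (y i)).
pose Y (x : 'I_m -> R) i := (1 + sin (x i / K)) / 2.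
pose del := r' / (2 * K).
have K2 : 0 < 2 * K by rewrite mulr_gt0.
have del0 : 0 < del by rewrite divr_gt0.
have Y01 x : unit_cube (Y x).
  move=> i; have := sin_geN1 (x i / K); have := sin_le1 (x i / K).
  by move=> *; apply/andP; split; rewrite /Y; lra.
have hK y : 0 <= y <= 1 -> `|h y| <= K.
  move=> /andP[y0 y1]; rewrite /h ler_norml; apply/andP; split; nra.
have Fdel y j c : unit_cube y -> 0 <= c <= 1 -> `|c - y j| < del ->
    `|F (upd y j c) - F y| <= eta / 3 / m.+1%:R.
  move=> y01 c01 cy; apply: ltW; apply: fr' => i.
  - by apply: hK; rewrite /upd; case: eqP.
  - exact: hK.
  - rewrite /upd; case: eqP => [->|_]; last by rewrite subrr normr0.
    rewrite (_ : h c - h (y j) = (2 * K) * (c - y j)); last by rewrite /h; ring.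
    by rewrite normrM (gtr0_norm K2) mulrC -ltr_pdivlMr.
have [n nP] : exists n : nat, (M + M) / (n.+1%:R * del ^+ 2) <= eta / 3 / m.+1%:R.
  have d2 : 0 < del ^+ 2 by rewrite exprn_gt0.
  near \oo => n; exists n.
  rewrite (_ : _ / _ = (M + M) / del ^+ 2 / n.+1%:R); last by field; rewrite !lt0r_neq0.
  rewrite ler_pdivrMr// -ler_pdivrMl//; near: n.
  exact: near_infty_natSge.
have FM y : `|F y| <= M by exact: fM.
have main := multi_bernstein_approx n (enum 'I_m) del0 (ltW e4) M0 FM Fdel.
exists (fun x => multi_bernstein n.+1 (enum 'I_m) F (Y x)); split.
- apply: trig_multi_bernstein.
    move=> i; rewrite (_ : (fun x => _) = (fun x => 2^-1 +
       2^-1 * cos (\sum_(l < m) (fun l => if l == i then K^-1 else 0) l * x l + - (pi / 2)))).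
      by apply: trigD; [exact: trig_cst|exact: trig_cos].
    apply/funext => x; rewrite (bigD1 i)//= eqxx big1 ?addr0; last first.
      by move=> l /negbTE ->; rewrite mul0r.
    by rewrite cosBpihalf /Y mulrDl mul1r (mulrC (sin _)) (mulrC K^-1).
  by move=> z z' zz'; congr f; apply/rowP => i; rewrite !mxE zz'// mem_enum.
- by move=> x; have [] := main _ (Y01 x).
- move=> x xB; have [_] := main _ (Y01 x) => h1.
  have hY i : h (Y x i) = K * sin (x i / K) by rewrite /h /Y; field.
  have h2 : `|F (Y x) - f (\row_i x i)| < eta / 3.
    apply: fr => i.
    - have xi := sK _ (xB i); rewrite hY.
      rewrite -[_ * _](subrK (x i)); apply: (le_trans (ler_normD _ _)).
      have : Num.min 1 (r / 2) <= 1 by rewrite ge_min lexx.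
      by have := xB i; have := ler_norm B; lra.
    - by apply: (le_trans (xB i)); have := ler_norm B; lra.
    - rewrite hY; apply: (le_lt_trans (sK _ (xB i))).
      by rewrite gt_min; apply/orP; right; lra.
  have h3 : (size (enum 'I_m))%:R * (eta / 3 / m.+1%:R + (M + M) / (n.+1%:R * del ^+ 2))
      <= 2 * (eta / 3).
    have -> : size (enum 'I_m) = m by rewrite size_enum_ord.
    apply: (@le_trans _ _ (m%:R * (eta / 3 / m.+1%:R + eta / 3 / m.+1%:R))).
      by apply: ler_wpM2l => //; rewrite lerD2l.
    rewrite (_ : _ * _ = m%:R * (2 * (eta / 3)) / m.+1%:R); last by field; rewrite lt0r_neq0.
    rewrite ler_pdivrMr// mulrC; apply: ler_wpM2l; first by lra.
    by rewrite ler_nat.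
  rewrite (_ : _ - f _ = (multi_bernstein n.+1 (enum 'I_m) F (Y x) - F (Y x)) +
     (F (Y x) - f (\row_i x i))); last by ring.
  apply: (le_trans (ler_normD _ _)); rewrite (_ : eta = 2 * (eta / 3) + eta / 3); last by field.
  by apply: lerD; [exact: le_trans h1 h3|exact: ltW].
Unshelve. all: by end_near. Qed.

End TrigDense.

(** * From cosines of linear forms to convergence in law *)

Section CramerWold.
Context {R : realType}.

Section Trig.
Context {d1 : measure_display} {Om : measurableType d1} (P : probability Om R).
Variables (m : nat) (X : Om -> 'I_m -> R).
Hypothesis mX : forall i, measurable_fun [set: Om] (X ^~ i).

Lemma trig_measurable g : trig g -> measurable_fun [set: Om] (fun w => g (X w)).
Proof.
elim=> [c a b|f1 f2 _ m1 _ m2]; last exact: measurable_funD.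
apply: measurable_funM => //; under eq_fun do rewrite -[\sum_(i < m) _]mul1r.
by apply: measurable_cos_affine; apply: measurable_sum => i; exact: measurable_funM.
Qed.

(** The composite is a pointwise limit of trigonometric functions of the coordinates, accurate to 1
    / (n + 1) on the box of radius n + 1. *)
Lemma continuous_row_measurable (f : 'rV[R]_m -> R) (M : R) : continuous f ->
  (forall v, `|f v| <= M) -> measurable_fun [set: Om] (fun w => f (\row_i X w i)).
Proof.
move=> cf fM.
have /choice[g gP] : forall n : nat, exists g : ('I_m -> R) -> R, [/\ trig g, forall x, `|g x| <= M &
    forall x, (forall i, `|x i| <= n.+1%:R) -> `|g x - f (\row_i x i)| <= n.+1%:R^-1].
  by move=> n; apply: trig_dense; rewrite ?invr_gt0.
apply: (@measurable_fun_cvg _ _ _ _ (fun n w => g n (X w))) => //.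
  by move=> n; apply: trig_measurable; have [] := gP n.
move=> w _; apply/cvgrPdist_le => e e0; near=> n.
have [_ _ h] := gP n.
rewrite distrC; apply: (@le_trans _ _ n.+1%:R^-1).
  apply: h => i; apply: (@le_trans _ _ (\sum_(j < m) `|X w j|)).
    by rewrite (bigD1 i)//= lerDl; exact: sumr_ge0.
  by near: n; exact: near_infty_natSge.
rewrite -[leRHS]invrK lef_pV2 ?posrE ?invr_gt0//; near: n; exact: near_infty_natSge.
Unshelve. all: by end_near. Qed.

End Trig.

Section Convergence.
Context {d1 : measure_display} {Om1 : measurableType d1} (P : probability Om1 R).
Context {d2 : measure_display} {Om2 : measurableType d2} (Q : probability Om2 R).
Variables (m : nat) (X : R -> Om1 -> 'I_m -> R) (Y : Om2 -> 'I_m -> R).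
Hypothesis mX : forall s i, 0 <= s -> measurable_fun [set: Om1] (fun w => X s w i).
Hypothesis mY : forall i, measurable_fun [set: Om2] (Y ^~ i).
Hypothesis XY : forall (a : 'I_m -> R) (b : R),
  \int[P]_w cos (\sum_(i < m) a i * X s w i + b) @[s --> +oo] -->
  \int[Q]_w cos (\sum_(i < m) a i * Y w i + b).
Hypothesis tight : forall e : R, 0 < e -> exists B : R, forall i,
  \forall s \near +oo, \int[P]_w \1_[set w | B < `|X s w i|] w <= e.

Let trig_bounded_integrable (d : measure_display) (Om : measurableType d) (P' : probability Om R)
    (Z : Om -> 'I_m -> R) g : (forall i, measurable_fun [set: Om] (Z ^~ i)) ->
  trig g -> P'.-integrable [set: Om] (EFin \o (fun w => g (Z w))).
Proof.
move=> mZ; elim=> [c a b|f1 f2 _ m1 _ m2]; last exact: integrable_fctD.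
apply: integrable_fctZ => //; apply: (bounded_integrable P' (M := 1)) => [|w]; last exact: cos_max.
under eq_fun do rewrite -[\sum_(i < m) _]mul1r.
by apply: measurable_cos_affine; apply: measurable_sum => i; exact: measurable_funM.
Qed.

Let trig_cvg g : trig g -> \int[P]_w g (X s w) @[s --> +oo] --> \int[Q]_w g (Y w).
Proof.
elim=> [c a b|f1 f2 t1 c1 t2 c2].
  rewrite RintegralZl//; last first.
    rewrite (_ : _ \o _ = EFin \o (fun w => 1 * cos (\sum_(i < m) a i * Y w i + b))).
      exact: (trig_bounded_integrable Q mY (trig_cos 1 a b)).
    by apply/funext => w /=; rewrite mul1r.
  have h : c * \int[P]_w cos (\sum_(i < m) a i * X s w i + b) @[s --> +oo] -->
      c * \int[Q]_w cos (\sum_(i < m) a i * Y w i + b).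
    by apply: cvgM; [exact: cvg_cst|exact: XY].
  apply: cvg_trans h; apply: near_eq_cvg; near=> s.
  have s0 : 0 <= s by near: s; exact: nbhs_pinfty_ge.
  rewrite /= RintegralZl//.
  rewrite (_ : _ \o _ = EFin \o (fun w => 1 * cos (\sum_(i < m) a i * X s w i + b))).
    exact: (trig_bounded_integrable P (fun i => mX i s0) (trig_cos 1 a b)).
  by apply/funext => w /=; rewrite mul1r.
rewrite RintegralD//; [|exact: trig_bounded_integrable..].
have h : \int[P]_w f1 (X s w) + \int[P]_w f2 (X s w) @[s --> +oo] -->
    \int[Q]_w f1 (Y w) + \int[Q]_w f2 (Y w) by exact: cvgD.
apply: cvg_trans h; apply: near_eq_cvg; near=> s.
have s0 : 0 <= s by near: s; exact: nbhs_pinfty_ge.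
rewrite /= RintegralD//; apply: trig_bounded_integrable => // i; exact: mX.
Unshelve. all: by end_near. Qed.

Let large_measurable (d : measure_display) (Om : measurableType d) (Z : Om -> R) B :
  measurable_fun [set: Om] Z -> measurable [set w | B < `|Z w|].
Proof.
move=> mZ; rewrite -[X in measurable X]setTI.
rewrite (_ : [set w | _] = (fun w => `|Z w|) @^-1` `]B, +oo[).
  by apply: (measurableT_comp (@normr_measurable R setT) mZ) => //; exact: measurable_itv.
by apply/seteqP; split => w /=; rewrite in_itv /= andbT.
Qed.

Let tightY (e : R) : 0 < e -> exists B : R, forall B' i, B <= B' ->
  \int[Q]_w \1_[set w | B' < `|Y w i|] w <= e.
Proof.
move=> e0.
have h i : \int[Q]_w \1_[set w | n%:R < `|Y w i|] w @[n --> \oo] --> (0 : R).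
  rewrite -[X in _ --> X](_ : \int[Q]_w (cst 0) w = 0); last first.
    by rewrite Rintegral_cst// mul0r.
  apply: (@Rintegral_dominated_cvg _ _ R Q setT (fun n => \1_[set w | n%:R < `|Y w i|]) (cst 0) (cst 1)) => //.
  - by move=> n; apply: measurable_indic; exact: large_measurable.
  - apply: nearW => w _; apply: cvg_near_cst; near=> n.
    have Yn : `|Y w i| <= n%:R.
      near: n; exists (Num.truncn `|Y w i|).+1 => // n /= hn.
      by apply: (le_trans (ltW (truncnS_gt _))); rewrite ler_nat.
    by rewrite indicE memNset//=; apply/negP; rewrite -leNgt.
  - exact: finite_measure_integrable_cst.
  - by apply: nearW => w n _; exact: indic_norm_le1.
have /choice[N NP] : forall i, exists n : nat, \int[Q]_w \1_[set w | n%:R < `|Y w i|] w <= e.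
  move=> i; have /cvgrPdist_le/(_ _ e0)[n _ hn] := h i.
  by exists n; have := hn n (leqnn _); rewrite sub0r normrN; exact/le_trans/ler_norm.
exists (\max_(i < m) N i)%N%:R => B' i BB'; apply: le_trans (NP i).
rewrite !Rintegral_indicT; [|exact: large_measurable..].
apply: fine_le; rewrite ?fin_num_measure//; [exact: large_measurable..|].
apply: le_measure; rewrite ?inE; [exact: large_measurable..|].
move=> w /=; apply: le_lt_trans; apply: le_trans BB'; rewrite ler_nat; exact: (leq_bigmax i).
Unshelve. all: by end_near. Qed.

(** Inside the box the approximation error applies; outside, both functions are bounded by [M], and
    the probability of leaving the box is weighted by 2M. *)
Let approx_integral (d : measure_display) (Om : measurableType d) (P' : probability Om R)
    (Z : Om -> 'I_m -> R) (f : 'rV[R]_m -> R) g (M B eta : R) :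
  (forall i, measurable_fun [set: Om] (Z ^~ i)) -> continuous f -> (forall v, `|f v| <= M) ->
  trig g -> (forall x, `|g x| <= M) ->
  (forall x, (forall i, `|x i| <= B) -> `|g x - f (\row_i x i)| <= eta) -> 0 <= eta ->
  `|\int[P']_w g (Z w) - \int[P']_w f (\row_i Z w i)| <=
   eta + (M + M) * \sum_(i < m) \int[P']_w \1_[set w | B < `|Z w i|] w.
Proof.
move=> mZ cf fM tg gM gf eta0.
have M0 : 0 <= M by apply: le_trans (fM 0).
have i1 := trig_bounded_integrable P' mZ tg.
have mf := continuous_row_measurable mZ cf fM.
have i2 := bounded_integrable P' mf (fun w => fM _).
have iind i : P'.-integrable [set: Om] (EFin \o (\1_[set w | B < `|Z w i|] : Om -> R)).
  apply: (bounded_integrable P' (M := 1)); last by move=> w; exact: indic_norm_le1.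
  by apply: measurable_indic; exact: large_measurable.
have isum := integrable_fct_sum measurableT (index_enum 'I_m) iind.
have icst (c : R) : P'.-integrable [set: Om] (EFin \o (fun=> c)).
  exact: finite_measure_integrable_cst.
have cE (c : R) : \int[P']_w c = c by rewrite Rintegral_cst//= probability_setT mulr1.
rewrite -RintegralB//; have i12 := integrable_fctB measurableT i1 i2.
apply: (le_trans (le_normr_Rintegral _ _)) => //.
rewrite -[X in X + _]cE -Rintegral_fct_sum// -RintegralZl// -RintegralD//; last exact: integrable_fctZ.
apply: le_Rintegral => //; first exact: integrable_norm i12.
  by apply: integrable_fctD => //; exact: integrable_fctZ.
move=> w _; have [/forallP h|] := boolP [forall i, `|Z w i| <= B].
  by apply: (le_trans (gf _ h)); rewrite lerDl mulr_ge0 ?addr_ge0// sumr_ge0.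
move=> /forallPn; case=> i; rewrite -ltNge => Bi.
apply: (@le_trans _ _ (M + M)).
  by apply: (le_trans (ler_normB _ _)); apply: lerD.
apply: (@le_trans _ _ ((M + M) * \sum_(i < m) \1_[set w | B < `|Z w i|] w)); last by rewrite lerDr.
rewrite -[leLHS]mulr1; apply: ler_wpM2l; first exact: addr_ge0.
by rewrite (bigD1 i)//= {1}indicE mem_set// lerDl sumr_ge0.
Qed.

(** With a trigonometric [g] close to [f] on a large box, f(X) is compared with g(X) and g(Y) with
    f(Y) by tightness, while g(X) and g(Y) are compared by the convergence of cosines. *)
Lemma cramer_wold (f : 'rV[R]_m -> R) (M : R) : continuous f -> (forall v, `|f v| <= M) ->
  \int[P]_w f (\row_i X s w i) @[s --> +oo] --> \int[Q]_w f (\row_i Y w i).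
Proof.
move=> cf fM; have M0 : 0 <= M by apply: le_trans (fM 0).
apply/cvgrPdist_le => e e0.
have e8 : 0 < e / 8 by rewrite divr_gt0.
have c0 : 0 < (M + M) * m%:R + 1 by rewrite ltr_wpDl// mulr_ge0// addr_ge0.
pose e' := e / 8 / ((M + M) * m%:R + 1).
have e'0 : 0 < e' by rewrite divr_gt0.
have [B1 tX] := tight e'0; have [B2 tY] := tightY e'0.
pose B := Num.max B1 B2.
have [g [tg gM gf]] := trig_dense cf fM B e8.
have bound (z : 'I_m -> R) : (forall i, z i <= e') -> (M + M) * \sum_(i < m) z i <= e / 8.
  move=> ze; apply: (@le_trans _ _ ((M + M) * (m%:R * e'))).
    apply: ler_wpM2l; first exact: addr_ge0.
    by rewrite mulr_natl -[m in _ *+ m]card_ord -sumr_const; exact: ler_sum.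
  rewrite mulrA /e' mulrA ler_pdivrMr//; have : 0 <= (M + M) * m%:R by rewrite mulr_ge0// addr_ge0.
  by set z' := _ * _; nra.
have hY := approx_integral Q mY cf fM tg gM gf (ltW e8).
have {}hY : `|\int[Q]_w g (Y w) - \int[Q]_w f (\row_i Y w i)| <= e / 8 + e / 8.
  apply: (le_trans hY); rewrite lerD2l; apply: bound => i; apply: tY.
  by rewrite le_max lexx orbT.
near=> s.
have s0 : 0 <= s by near: s; exact: nbhs_pinfty_ge.
have hX := approx_integral P (fun i => mX i s0) cf fM tg gM gf (ltW e8).
have {}hX : `|\int[P]_w g (X s w) - \int[P]_w f (\row_i X s w i)| <= e / 8 + e / 8.
  apply: (le_trans hX); rewrite lerD2l; apply: bound => i.
  apply: (@le_trans _ _ (\int[P]_w \1_[set w | B1 < `|X s w i|] w)).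
    rewrite !Rintegral_indicT; [|exact: large_measurable (mX i s0)..].
    apply: fine_le; rewrite ?fin_num_measure//; [exact: large_measurable (mX i s0)..|].
    apply: le_measure; rewrite ?inE; [exact: large_measurable (mX i s0)..|].
    by move=> w /=; apply: le_lt_trans; rewrite le_max lexx.
  move: i; near: s; apply: filter_forall => i; exact: tX.
have hg : `|\int[Q]_w g (Y w) - \int[P]_w g (X s w)| <= e / 8.
  by near: s; move/cvgrPdist_le : (trig_cvg tg); apply.
move: hX hY hg; rewrite !ler_norml => /andP[h1 h2] /andP[h3 h4] /andP[h5 h6].
by apply/andP; split; lra.
Unshelve. all: by end_near. Qed.

End Convergence.
End CramerWold.

(** * Chebyshev polynomials and orthogonality *)

Section Chebyshev.
Context {R : realType}.
Local Notation T := (@Defs.chebyshev R).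

Lemma chebyshevSS k : T k.+2 = 2%:R *: ('X * T k.+1) - T k. Proof. by []. Qed.

Lemma chebyshev_cos k (th : R) :
  (T k).[cos th] = cos (k%:R * th) /\ (T k.+1).[cos th] = cos (k.+1%:R * th).
Proof.
elim: k => [|k [IH1 IH2]]; first by rewrite /= hornerC hornerX mul0r cos0 mul1r.
split=> //; rewrite chebyshevSS hornerD hornerN hornerZ hornerM hornerX IH1 IH2.
have -> : k.+2%:R * th = k.+1%:R * th + th by rewrite -natr1; ring.
have -> : k%:R * th = k.+1%:R * th - th by rewrite -[k.+1%:R]natr1; ring.
by rewrite (cosD (k.+1%:R * th) th) (cosB (k.+1%:R * th) th); ring.
Qed.

(** The chain rule for T_k(cos th) = cos(k th), derived here from the recurrence; two consecutive
    degrees are carried because the recurrence has order two. *)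
Lemma chebyshev_deriv_sin k (th : R) :
  (T k)^`().[cos th] * sin th = k%:R * sin (k%:R * th) /\
  (T k.+1)^`().[cos th] * sin th = k.+1%:R * sin (k.+1%:R * th).
Proof.
elim: k => [|k [IH1 IH2]].
  by rewrite /= -polyC1 derivC derivX horner0 hornerC !mul0r !mul1r.
split=> //; rewrite chebyshevSS derivB derivZ derivM derivX mul1r.
rewrite hornerD hornerN hornerZ hornerD hornerM hornerX.
have [_ ->] := chebyshev_cos k th.
rewrite mulrBl IH1 mulrDr mulrDl mulrA -(mulrA (2 * cos th)) IH2.
have -> : k.+2%:R * th = k.+1%:R * th + th by rewrite -natr1; ring.
have -> : k%:R * th = k.+1%:R * th - th by rewrite -[k.+1%:R]natr1; ring.
by rewrite (sinD (k.+1%:R * th) th) (sinB (k.+1%:R * th) th) -[k.+2%:R]natr1 -[k.+1%:R]natr1; ring.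
Qed.

Lemma chebyshev_size k : size (T k) = k.+1 /\ size (T k.+1) = k.+2.
Proof.
elim: k => [|k [IH1 IH2]]; first by rewrite /= size_poly1 size_polyX.
split=> //; rewrite chebyshevSS size_polyDl; last first.
  rewrite size_polyN IH1 size_scale ?pnatr_eq0// mulrC size_mulX ?IH2//.
  by rewrite -size_poly_gt0 IH2.
rewrite size_scale ?pnatr_eq0// mulrC size_mulX ?IH2//.
by rewrite -size_poly_gt0 IH2.
Qed.

Lemma chebyshev_deriv_size k : size (T k.+1)^`() = k.+1.
Proof.
apply/eqP; rewrite eqn_leq; apply/andP; split.
  have [_ sz] := chebyshev_size k; rewrite -ltnS -[leqRHS]sz; apply: lt_size_deriv.
  by rewrite -size_poly_gt0 sz.
rewrite ltnNge; apply/negP => /leq_sizeP/(_ k (leqnn k))/eqP.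
rewrite coef_deriv mulrn_eq0 orFb; apply/negP.
have [_ sz] := chebyshev_size k.
have : lead_coef (T k.+1) != 0 by rewrite lead_coef_eq0 -size_poly_gt0 sz.
by rewrite lead_coefE sz /=.
Qed.

(** The derivative of T_(k+1) has degree exactly k, so leading coefficients can be eliminated one
    after another. *)
Lemma chebyshev_deriv_basis (q : {poly R}) : exists (n : nat) (c : nat -> R),
  q = \sum_(k < n) c k *: (T k.+1)^`().
Proof.
suff h n : forall q : {poly R}, (size q <= n)%N -> exists c : nat -> R,
    q = \sum_(k < n) c k *: (T k.+1)^`().
  by exists (size q); exact: h.
elim: n => [|n IH] {}q; first by rewrite leqn0 size_poly_eq0 => /eqP ->; exists (fun=> 0); rewrite big_ord0.
move=> qn; pose a := q`_n / ((T n.+1)^`())`_n.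
have Tn : ((T n.+1)^`())`_n != 0.
  have : lead_coef (T n.+1)^`() != 0 by rewrite lead_coef_eq0 -size_poly_gt0 chebyshev_deriv_size.
  by rewrite lead_coefE chebyshev_deriv_size.
have [|c cE] := IH (q - a *: (T n.+1)^`()).
  apply/leq_sizeP => j; rewrite leq_eqVlt => /predU1P[<-|nj].
    by rewrite coefB coefZ /a divfK// subrr.
  rewrite coefB coefZ !nth_default ?mulr0 ?subr0//; last exact: leq_trans nj.
  by rewrite chebyshev_deriv_size.
exists (fun k => if k == n then a else c k); rewrite big_ord_recr/= eqxx.
rewrite -[LHS](subrK (a *: (T n.+1)^`())) cE; congr (_ + _).
by apply: eq_bigr => k _; rewrite ltn_eqF.
Qed.

(* [sin (k arccos x)] for k >= 1, in a form that is visibly continuous. *)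
Definition sin_arccos (k : nat) (x : R) : R := Num.sqrt (1 - x ^+ 2) * (T k)^`().[x] / k%:R.

Lemma sin_arccosE k th : (0 < k)%N -> 0 <= th <= pi -> sin_arccos k (cos th) = sin (k%:R * th).
Proof.
move=> k0 /andP[t0 tpi].
have s0 : 0 <= sin th by apply: sin_ge0_pi; rewrite t0.
rewrite /sin_arccos -sin2cos2 sqrtr_sqr ger0_norm//.
have [h _] := chebyshev_deriv_sin k th.
by rewrite (mulrC (sin th)) h mulrC mulKf// pnatr_eq0 -lt0n.
Qed.

Lemma continuous_sin_arccos k : continuous (sin_arccos k).
Proof.
move=> x; apply: cvgM; last exact: cvg_cst.
apply: cvgM; last exact: continuous_horner.
apply: (@continuous_comp _ _ _ (fun y : R => 1 - y ^+ 2) Num.sqrt); last exact: sqrt_continuous.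
by apply: cvgB; [exact: cvg_cst|exact: exprn_continuous].
Qed.

Lemma sin_natpi n : sin (n%:R * pi) = 0 :> R.
Proof.
elim: n => [|n IH]; first by rewrite mul0r sin0.
by rewrite -natr1 mulrDl mul1r sinDpi IH oppr0.
Qed.

(** Under x = cos th the Jacobian sin th turns T_j'(cos th) into j sin(j th), which leaves the
    orthogonality of sines on [0, pi]. *)
Lemma integral_chebyshev_sin (j k : nat) : (0 < j)%N -> (0 < k)%N ->
  \int[lebesgue_measure]_(x in `[(-1)%R, 1]) ((T j)^`().[x] * sin_arccos k x) =
  if j == k then k%:R * pi / 2 else 0.
Proof.
move=> j0 k0.
have pi0 : (0 : R) < pi by exact: pi_gt0.
pose G x : R := (T j)^`().[x] * sin_arccos k x.
have cG : continuous G.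
  by move=> x; apply: cvgM; [exact: continuous_horner|exact: continuous_sin_arccos].
pose f th : R := j%:R / 2 * (cos ((j%:R - k%:R) * th) - cos ((j + k)%:R * th)).
have cc (a : R) : continuous (fun th => cos (a * th)).
  move=> th; apply: (@continuous_comp _ _ _ (fun th => a * th) cos); last exact: continuous_cos.
  by apply: cvgM; [exact: cvg_cst|exact: cvg_id].
have cf : continuous f.
  by move=> th; apply: cvgM; [exact: cvg_cst|apply: cvgB; exact: cc].
have -> : \int[lebesgue_measure]_(x in `[(-1)%R, 1]) G x = \int[lebesgue_measure]_(th in `[0, pi]) f th.
  rewrite /Rintegral -[X in `[X, _]]cospi -[X in `[_, X]]cos0; congr fine.
  have dcos : cos^`()%classic = (fun x : R => - sin x).
    by apply/funext => x; rewrite derive1E; apply: derive_val.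
  rewrite (@integration_by_substitution_decreasing _ cos G 0 pi) ?ltW//.
  - apply: eq_integral => th; rewrite inE/= in_itv/= => tpi.
    congr EFin; rewrite !fctE dcos opprK /G sin_arccosE//.
    have [h _] := chebyshev_deriv_sin j th.
    rewrite mulrAC h /f natrD mulrBl mulrDl cosB cosD; by field.
  - by move=> x y xI yI; rewrite ltr_cos.
  - by rewrite dcos => x _; apply: continuousN; exact: continuous_sin.
  - rewrite dcos; apply/cvg_ex; exists (- sin 0); apply: cvgN; apply: cvg_at_right_filter;
    exact: continuous_sin.
  - rewrite dcos; apply/cvg_ex; exists (- sin pi); apply: cvgN; apply: cvg_at_left_filter;
    exact: continuous_sin.
  - split.
    + by move=> x _; exact: ex_derive.
    + by apply: cvg_at_right_filter; exact: continuous_cos.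
    + by apply: cvg_at_left_filter; exact: continuous_cos.
  - by apply: continuous_subspaceT.
have jk0 : (j + k)%:R != 0 :> R by rewrite pnatr_eq0 -lt0n addn_gt0 j0.
have [jk|/eqP jk] := eqVneq j k.
  have dF (x : R) : is_derive x (1 : R)
      (fun th => j%:R / 2 * (th - sin ((j + k)%:R * th) / (j + k)%:R)) (f x).
    apply: is_derive_eq; rewrite /f /GRing.scale/= jk subrr mul0r cos0; field.
    by move: jk0; rewrite natrD jk.
  rewrite (Rintegral_FTC dF)//.
  by rewrite sin_natpi mulr0 sin0 mul0r jk !subr0 mulr0 subr0; field.
have jk1 : j%:R - k%:R != 0 :> R by rewrite subr_eq0 eqr_nat; apply/eqP.
have dF (x : R) : is_derive x (1 : R)
    (fun th => j%:R / 2 * (sin ((j%:R - k%:R) * th) / (j%:R - k%:R)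
      - sin ((j + k)%:R * th) / (j + k)%:R)) (f x).
  apply: is_derive_eq; rewrite /f /GRing.scale/=; field.
  by rewrite jk1 andbT -natrD.
rewrite (Rintegral_FTC dF)//.
by rewrite sin_natpi (mulrBl pi) sinB !sin_natpi !mulr0 sin0 !mul0r; ring.
Qed.

End Chebyshev.

(** * Sine series of the logarithmic kernel *)

Section LogSeries.
Context {R : realType}.
Implicit Types r a b : R.

Lemma poisson_denominator_ge r k : 0 <= r -> k <= 1 -> (1 - r) ^+ 2 <= 1 - 2 * r * k + r ^+ 2.
Proof. by move=> r0 k1; nra. Qed.

(** Imaginary part of the finite geometric series in z = r e^(ia), multiplied by |1 - z|^2. *)
Lemma sum_sin_geometric r (a : R) n :
  (1 - 2 * r * cos a + r ^+ 2) * (\sum_(k < n) r ^+ k.+1 * sin (k.+1%:R * a)) =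
  r * sin a - r ^+ n.+1 * sin (n.+1%:R * a) + r ^+ n.+2 * sin (n%:R * a).
Proof.
elim: n => [|n IH]; first by rewrite big_ord0 mul0r sin0 mul1r !mulr0 addr0 expr1 subrr.
rewrite big_ord_recr mulrDr IH.
have -> : n.+2%:R * a = n.+1%:R * a + a by rewrite -natr1; ring.
have -> : n%:R * a = n.+1%:R * a - a by rewrite -[n.+1%:R]natr1; ring.
by rewrite (sinD (n.+1%:R * a) a) (sinB (n.+1%:R * a) a) !exprS; ring.
Qed.

(* Comparing derivatives reduces this to the finite geometric sum above. *)
Lemma log_poisson_series r a b n : 0 <= r < 1 ->
  `|(ln (1 - 2 * r * cos a + r ^+ 2) - ln (1 - 2 * r * cos b + r ^+ 2))
     + 2 * (\sum_(k < n) r ^+ k.+1 / k.+1%:R * (cos (k.+1%:R * a) - cos (k.+1%:R * b)))|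
  <= 4 / (1 - r) ^+ 2 * `|a - b| * r ^+ n.
Proof.
move=> /andP[r0 r1].
have D0 (x : R) : 0 < 1 - 2 * r * cos x + r ^+ 2.
  apply: lt_le_trans (poisson_denominator_ge r0 (cos_le1 x)).
  by rewrite exprn_gt0// subr_gt0.
pose F (x : R) := ln (1 - 2 * r * cos x + r ^+ 2)
  + 2 * (\sum_(k < n) r ^+ k.+1 / k.+1%:R * cos (k.+1%:R * x)).
pose f (x : R) := 2 * (r ^+ n.+1 * sin (n.+1%:R * x) - r ^+ n.+2 * sin (n%:R * x))
  / (1 - 2 * r * cos x + r ^+ 2).
have dF (x : R) : is_derive x (1 : R) F (f x).
  have dS : is_derive x (1 : R) (\sum_(k < n) (fun x : R => r ^+ k.+1 / k.+1%:R * cos (k.+1%:R * x)))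
     (\sum_(k < n) (- (r ^+ k.+1 * sin (k.+1%:R * x)))).
    apply: is_derive_sum => k; apply: is_derive_eq; rewrite /GRing.scale/=.
    by field.
  have dL : is_derive x (1:R) (fun x : R => ln (1 - 2 * r * cos x + r ^+ 2)) ((1 - 2 * r * cos x +
    r ^+ 2)^-1 * (2 * r * sin x)).
    have dG : is_derive x (1:R) (fun x : R => 1 - 2 * r * cos x + r ^+ 2) (2 * r * sin x).
      apply: is_derive_eq; rewrite /GRing.scale/=; ring.
    exact: (@is_derive1_comp _ _ (fun x : R => 1 - 2 * r * cos x + r ^+ 2) _ _ _ (is_derive1_ln (D0 x)) dG).
  have -> : F = (fun x => ln (1 - 2 * r * cos x + r ^+ 2) + 2 * (\sum_(k < n)
    (fun x : R => r ^+ k.+1 / k.+1%:R * cos (k.+1%:R * x))) x).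
    by apply/funext => y; rewrite /F fct_sumE.
  apply: is_derive_eq; rewrite /GRing.scale/= sumrN /f.
  have := sum_sin_geometric r x n.
  move: (\sum_(k < n) _) (D0 x) => s D h.
  apply: (mulfI (lt0r_neq0 D)).
  rewrite [RHS]mulrC divfK ?lt0r_neq0// mulrDr mulVKf ?lt0r_neq0//.
  by rewrite mulrCA mulrN h; ring.
(* The numerator is at most 4 r^n and the denominator at least (1 - r)^2. *)
have fle x : `|f x| <= 4 / (1 - r) ^+ 2 * r ^+ n.
  have D1 := poisson_denominator_ge r0 (cos_le1 x).
  have d0 : 0 < (1 - r) ^+ 2 by rewrite exprn_gt0// subr_gt0.
  have rle k : (n <= k)%N -> r ^+ k <= r ^+ n by move=> nk; apply: ler_wiXn2l => //; exact: ltW.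
  have sle k (y : R) : (n <= k)%N -> `|r ^+ k * sin y| <= r ^+ n.
    move=> nk; rewrite normrM normrX (ger0_norm r0) -[leRHS]mulr1.
    by rewrite ler_pM ?exprn_ge0// ?rle// ler_norml sin_geN1 sin_le1.
  rewrite /f normrM [leRHS]mulrAC; apply: ler_pM => //; last first.
    rewrite normfV (ger0_norm (ltW (D0 x))) lef_pV2 ?posrE ?D0//; exact: d0.
  rewrite normrM normr_nat.
  have -> : 4 * r ^+ n = 2 * (r ^+ n + r ^+ n) by ring.
  by rewrite ler_wpM2l//; apply: (le_trans (ler_normB _ _)); apply: lerD; apply: sle; lia.
have -> : (ln (1 - 2 * r * cos a + r ^+ 2) - ln (1 - 2 * r * cos b + r ^+ 2))
     + 2 * (\sum_(k < n) r ^+ k.+1 / k.+1%:R * (cos (k.+1%:R * a) - cos (k.+1%:R * b))) = F a - F b.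
  rewrite /F (eq_bigr (fun k : 'I_n => r ^+ k.+1 / k.+1%:R * cos (k.+1%:R * a) - r ^+ k.+1 / k.+1%:R *
    cos (k.+1%:R * b))); last first.
    by move=> k _; rewrite mulrBr.
  rewrite sumrB; ring.
have cF : continuous F by move=> x; apply: differentiable_continuous; apply/derivable1_diffP;
  exact: (@ex_derive _ _ _ _ _ _ _ (dF x)).
wlog ba : a b / b <= a => [W|].
  have [|/ltW] := leP b a; first exact: W.
  by rewrite distrC (distrC a b); exact: W.
have [c _ ->] := @MVT_segment _ F f b a ba (fun x _ => dF x) (continuous_subspaceT cF).
by rewrite normrM mulrAC ler_wpM2r.
Qed.

End LogSeries.

Section LogKernel.
Context {R : realType}.
Local Notation T := (@Defs.chebyshev R).
Local Notation mu := (@lebesgue_measure R).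
Local Notation I := (`[(-1)%R, 1%R]%classic : set R).
Implicit Types (r x y : R) (q : {poly R}) (c : nat -> R).

Definition chebyshev_deriv_sum (n : nat) c : {poly R} := \sum_(k < n) c k *: (T k.+1)^`().

Lemma continuous_integrable_itv (f : R -> R) : continuous f -> mu.-integrable I (EFin \o f).
Proof.
move=> cf; apply: continuous_compact_integrable; first exact: segment_compact.
exact: continuous_subspaceT.
Qed.

Lemma poly_bounded q : exists M : R, forall x, -1 <= x <= 1 -> `|q.[x]| <= M.
Proof.
exists (\sum_(i < size q) `|q`_i|) => x xI; rewrite horner_coef.
apply: (le_trans (ler_norm_sum _ _ _)); apply: ler_sum => i _.
by rewrite normrM normrX ler_piMr// exprn_ile1// ler_norml.
Qed.

Lemma integral_expansion_sin n c k :
  \int[mu]_(x in I) ((chebyshev_deriv_sum n c).[x] * sin_arccos k.+1 x) =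
  if (k < n)%N then c k * (k.+1%:R * pi / 2) else 0.
Proof.
have iS (j : nat) : mu.-integrable I (EFin \o (fun x => (T j.+1)^`().[x] * sin_arccos k.+1 x)).
  apply: continuous_integrable_itv => x.
  by apply: cvgM; [exact: continuous_horner|exact: continuous_sin_arccos].
have E x : (chebyshev_deriv_sum n c).[x] * sin_arccos k.+1 x =
    \sum_(j < n) c j * ((T j.+1)^`().[x] * sin_arccos k.+1 x).
  rewrite /chebyshev_deriv_sum horner_sum mulr_suml.
  by apply: eq_bigr => j _; rewrite hornerZ -mulrA.
transitivity (\int[mu]_(x in I) \sum_(j < n) c j * ((T j.+1)^`().[x] * sin_arccos k.+1 x)).
  apply: eq_Rintegral => x _; exact: E.
rewrite (Rintegral_fct_sum _ _ (fun j : 'I_n => integrable_fctZ _ _ (iS j)))//.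
under eq_bigr => j _ do rewrite RintegralZl// integral_chebyshev_sin// eqSS.
case: ifPn => [kn|]; last first.
  by rewrite -leqNgt => nk; rewrite big1// => j _; rewrite ltn_eqF ?mulr0// (leq_trans (ltn_ord j)).
rewrite (bigD1 (Ordinal kn))//= eqxx big1 ?addr0// => j; rewrite -val_eqE/= => /negPf ->.
by rewrite mulr0.
Qed.

(** The free field covariance of two points at angles a = acos x and b = acos y, with r the ratio of
    the smaller to the larger radius: the arguments of [ln] involve cos(a + b) and cos(a - b), and 4
    pi replaces 2 pi because the moduli are squared. *)
Definition log_kernel r x y : R :=
  let s := Num.sqrt (1 - x ^+ 2) * Num.sqrt (1 - y ^+ 2) in
  (4 * pi)^-1 * (ln (1 - 2 * r * (x * y - s) + r ^+ 2) - ln (1 - 2 * r * (x * y + s) + r ^+ 2)).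

(** [log_poisson_series] at the angles a + b and a - b, where the difference of cosines is -2
    sin(ka) sin(kb). The angles differ by 2b <= 2 pi, so the prefactor 1 / (4 pi) leaves the
    constant 2. *)
Lemma log_kernel_series r x y n : 0 <= r < 1 -> -1 <= x <= 1 -> -1 <= y <= 1 ->
  `|log_kernel r x y
    - pi^-1 * (\sum_(k < n) r ^+ k.+1 / k.+1%:R * (sin_arccos k.+1 x * sin_arccos k.+1 y))|
  <= 2 / (1 - r) ^+ 2 * r ^+ n.
Proof.
move=> r01 xI yI; have pi0 : (0 : R) < pi := pi_gt0 R.
set a := acos x; set b := acos y.
have aI : 0 <= a <= pi by rewrite acos_ge0 ?acos_lepi.
have bI : 0 <= b <= pi by rewrite acos_ge0 ?acos_lepi.
have xE : x = cos a by rewrite acosK ?in_itv.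
have yE : y = cos b by rewrite acosK ?in_itv.
have h := log_poisson_series (a + b) (a - b) n r01.
have -> : log_kernel r x y
    - pi^-1 * (\sum_(k < n) r ^+ k.+1 / k.+1%:R * (sin_arccos k.+1 x * sin_arccos k.+1 y)) =
  (4 * pi)^-1 * ((ln (1 - 2 * r * cos (a + b) + r ^+ 2) - ln (1 - 2 * r * cos (a - b) + r ^+ 2))
     + 2 * (\sum_(k < n) r ^+ k.+1 / k.+1%:R * (cos (k.+1%:R * (a + b)) - cos (k.+1%:R * (a - b))))).
  rewrite mulrDr /log_kernel -!sin_acos// cosD cosB -xE -yE; congr (_ + _).
  rewrite mulrA !mulr_sumr -sumrN; apply: eq_bigr => k _.
  rewrite xE yE !sin_arccosE// (mulrDr k.+1%:R a b) (mulrBr k.+1%:R a b) cosD cosB.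
  have : k.+1%:R != 0 :> R by rewrite pnatr_eq0.
  move: (k.+1%:R : R) (pi : R) (lt0r_neq0 pi0) => l p p0 l0; field.
  by rewrite l0 p0.
rewrite normrM gtr0_norm; last by rewrite invr_gt0 mulr_gt0.
rewrite mulrC ler_pdivrMr ?mulr_gt0//; apply: (le_trans h).
have -> : 4 / (1 - r) ^+ 2 * `|a + b - (a - b)| * r ^+ n =
  r ^+ n / (1 - r) ^+ 2 * (4 * `|a + b - (a - b)|) by ring.
have -> : 2 / (1 - r) ^+ 2 * r ^+ n * (4 * pi) = r ^+ n / (1 - r) ^+ 2 * (8 * pi) by ring.
have /andP[r0 r1] := r01.
apply: ler_wpM2l; first by rewrite mulr_ge0 ?invr_ge0 ?exprn_ge0// subr_ge0 ltW.
have /andP[b0 bp] := bI.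
have -> : a + b - (a - b) = 2 * b by ring.
rewrite ger0_norm ?mulr_ge0//; lra.
Qed.

Lemma measurable_log_kernel r x : measurable_fun setT (log_kernel r x).
Proof.
have cs (e : R) : continuous (fun y : R => 1 - 2 * r * (x * y +
  e * (Num.sqrt (1 - x ^+ 2) * Num.sqrt (1 - y ^+ 2))) + r ^+ 2).
  move=> y; apply: cvgD; last exact: cvg_cst.
  apply: cvgB; first exact: cvg_cst.
  apply: cvgM; first exact: cvg_cst.
  apply: cvgD; first by apply: cvgM; [exact: cvg_cst|exact: cvg_id].
  apply: cvgM; first exact: cvg_cst.
  apply: cvgM; first exact: cvg_cst.
  apply: (@continuous_comp _ _ _ (fun y : R => 1 - y ^+ 2) Num.sqrt); last exact: sqrt_continuous.
  by apply: cvgB; [exact: cvg_cst|exact: exprn_continuous].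
apply: measurable_funM => //; apply: measurable_funB.
  apply: (measurableT_comp (f := @ln R)) => //.
  have := continuous_measurable_fun (cs (-1)); congr measurable_fun.
  by apply/funext => y; rewrite mulN1r.
apply: (measurableT_comp (f := @ln R)) => //.
have := continuous_measurable_fun (cs 1); congr measurable_fun.
by apply/funext => y; rewrite mul1r.
Qed.

(** By orthogonality the integrals of the partial sums no longer change from order [n] on; the
    partial sums are bounded uniformly, so their limit can be taken under the integral. *)
Lemma integral_log_kernel_lt1 r x n c : 0 <= r < 1 -> -1 <= x <= 1 ->
  \int[mu]_(y in I) (log_kernel r x y * (chebyshev_deriv_sum n c).[y]) =
  \sum_(k < n) c k * (r ^+ k.+1 / 2) * sin_arccos k.+1 x.
Proof.
move=> r01 xI; set q := chebyshev_deriv_sum n c.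
have pi0 : (0 : R) < pi := pi_gt0 R.
have [M qM] := poly_bounded q.
pose S m y := pi^-1 * (\sum_(k < m) r ^+ k.+1 / k.+1%:R * (sin_arccos k.+1 x * sin_arccos k.+1 y)).
have iq (k : nat) : mu.-integrable I (EFin \o (fun y => q.[y] * sin_arccos k.+1 y)).
  apply: continuous_integrable_itv => y.
  by apply: cvgM; [exact: continuous_horner|exact: continuous_sin_arccos].
have SqE m y : S m y * q.[y] = \sum_(k < m) (pi^-1 * (r ^+ k.+1 / k.+1%:R * sin_arccos k.+1 x)) *
  (q.[y] * sin_arccos k.+1 y).
  by rewrite /S mulr_sumr mulr_suml; apply: eq_bigr => k _; ring.
have IS m : (n <= m)%N -> \int[mu]_(y in I) (S m y * q.[y]) =
  \sum_(k < n) c k * (r ^+ k.+1 / 2) * sin_arccos k.+1 x.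
  move=> nm; transitivity (\int[mu]_(y in I) \sum_(k < m) (pi^-1 * (r ^+ k.+1 / k.+1%:R *
    sin_arccos k.+1 x)) * (q.[y] * sin_arccos k.+1 y)).
    by apply: eq_Rintegral => y _; rewrite SqE.
  rewrite (Rintegral_fct_sum _ _ (fun k : 'I_m => integrable_fctZ _ _ (iq k)))//.
  under eq_bigr => k _ do rewrite RintegralZl// integral_expansion_sin.
  rewrite (big_ord_widen_cond _ predT (fun k => c k * (r ^+ k.+1 / 2) *
    sin_arccos k.+1 x) nm) [RHS]big_mkcond/=.
  apply: eq_bigr => k _; case: ifP => _; last by rewrite mulr0.
  have : k.+1%:R != 0 :> R by rewrite pnatr_eq0.
  move: (k.+1%:R : R) (pi : R) (lt0r_neq0 pi0) => l p p0 l0; field.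
  by rewrite l0 p0.
have S_cvg y : -1 <= y <= 1 -> S ^~ y @ \oo --> log_kernel r x y.
  move=> yI; apply/cvgrPdist_le => e e0.
  have d0 : 0 < (1 - r) ^+ 2 by rewrite exprn_gt0// subr_gt0; case/andP: r01.
  have cr : `|r| < 1 by case/andP: r01 => ? ?; rewrite ger0_norm.
  have : 2 / (1 - r) ^+ 2 * r ^+ m @[m --> \oo] --> 0.
    rewrite -(mulr0 (2 / (1 - r) ^+ 2)); apply: cvgM; first exact: cvg_cst.
    exact: cvg_expr.
  move=> /cvgrPdist_le/(_ e e0); apply: filterS => m; rewrite sub0r normrN => h.
  apply: (le_trans (log_kernel_series m r01 xI yI)); apply: le_trans h; exact: ler_norm.
have kb y : -1 <= y <= 1 -> `|log_kernel r x y| <= 2 / (1 - r) ^+ 2.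
  by move=> yI; have := log_kernel_series 0 r01 xI yI; rewrite big_ord0 mulr0 subr0 expr0 mulr1.
have sb m y : -1 <= y <= 1 -> `|S m y| <= 4 / (1 - r) ^+ 2.
  move=> yI; have h1 := kb y yI; have h2 := log_kernel_series m r01 xI yI.
  rewrite -/(S m y) in h2.
  have h3 : `|log_kernel r x y - S m y| <= 2 / (1 - r) ^+ 2.
    apply: (le_trans h2); rewrite ler_piMr//; first by rewrite mulr_ge0 ?invr_ge0 ?sqr_ge0.
    by apply: exprn_ile1; case/andP: r01 => // _ /ltW.
  rewrite -[S m y](subKr (log_kernel r x y)); apply: (le_trans (ler_normB _ _)).
  by apply: (le_trans (lerD h1 h3)); rewrite -mulrDl -natrD.
have cv : \int[mu]_(y in I) (S m y * q.[y]) @[m --> \oo] --> \int[mu]_(y in I) (log_kernel r x y * q.[y]).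
  apply: (@Rintegral_dominated_cvg _ _ R mu I (fun m y => S m y * q.[y]) _ (cst (4 / (1 - r) ^+ 2 * M))).
  - exact: measurable_itv.
  - move=> m; apply/measurable_EFinP.
    rewrite (_ : (fun y => _) = fun y => \sum_(k < m) (pi^-1 * (r ^+ k.+1 / k.+1%:R *
      sin_arccos k.+1 x)) * (q.[y] * sin_arccos k.+1 y)); last exact/funext.
    have := integrable_fct_sum _ (index_enum 'I_m)
      (fun k : 'I_m => integrable_fctZ _ (pi^-1 * (r ^+ k.+1 / k.+1%:R * sin_arccos k.+1 x)) (iq k)).
    move/(_ (measurable_itv _) (measurable_itv _)).
    exact: measurable_int.
  - apply: measurable_funS (measurable_funM (measurable_log_kernel r x) _) => //.
    by apply: continuous_measurable_fun; exact: continuous_horner.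
  - apply/aeW => y; rewrite /= in_itv/= => yI; apply: cvgM; [exact: S_cvg|exact: cvg_cst].
  - by apply: continuous_integrable_itv => y; exact: cvg_cst.
  - apply/aeW => y m; rewrite /= in_itv/= => yI; rewrite normrM.
    by apply: ler_pM; [| |exact: sb|exact: qM].
apply: (cvg_unique _ cv) => //; apply: cvg_near_cst; exists n => // m /= nm.
Qed.

End LogKernel.

(** * The singular kernel and the free field covariance *)

Section GFFKernel.
Context {R : realType}.
Local Notation mu := (@lebesgue_measure R).
Local Notation I := (`[(-1)%R, 1%R]%classic : set R).
Implicit Types (r x y : R) (c : nat -> R).

(** The middle expression is the inner product of two unit vectors, and the squared length of their
    difference is twice 1 minus it. *)
Lemma half_circle_le x y : -1 <= x <= 1 -> -1 <= y <= 1 ->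
  [/\ 0 <= Num.sqrt (1 - x ^+ 2) * Num.sqrt (1 - y ^+ 2),
      x * y + Num.sqrt (1 - x ^+ 2) * Num.sqrt (1 - y ^+ 2) <= 1 &
      x != y -> x * y + Num.sqrt (1 - x ^+ 2) * Num.sqrt (1 - y ^+ 2) < 1].
Proof.
move=> xI yI.
have hx : Num.sqrt (1 - x ^+ 2) ^+ 2 = 1 - x ^+ 2 by rewrite sqr_sqrtr//; nra.
have hy : Num.sqrt (1 - y ^+ 2) ^+ 2 = 1 - y ^+ 2 by rewrite sqr_sqrtr//; nra.
have := sqrtr_ge0 (1 - x ^+ 2); have := sqrtr_ge0 (1 - y ^+ 2).
move: (Num.sqrt (1 - x ^+ 2)) (Num.sqrt (1 - y ^+ 2)) hx hy => a b hx hy b0 a0.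
have e : (x - y) ^+ 2 + (a - b) ^+ 2 = 2 * (1 - (x * y + a * b)) by nra.
split; first exact: mulr_ge0.
  by have := sqr_ge0 (x - y); have := sqr_ge0 (a - b); lra.
rewrite -subr_eq0 => xy; have : 0 < (x - y) ^+ 2 by rewrite lt0r sqrf_eq0 xy sqr_ge0.
by have := sqr_ge0 (a - b); lra.
Qed.

Lemma poisson_denominator_gt0 r k : 0 <= r <= 1 -> k <= 1 -> (r < 1) || (k < 1) ->
  0 < 1 - 2 * r * k + r ^+ 2.
Proof.
move=> /andP[r0 r1] k1; have h := poisson_denominator_ge r0 k1.
have [lr1 _|ler1 /= k1'] := ltP r 1; first by apply: lt_le_trans h; rewrite exprn_gt0// subr_gt0.
have -> : r = 1 by apply/eqP; rewrite eq_le r1.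
lra.
Qed.

Lemma log_kernel_ge0 r x y : 0 <= r <= 1 -> -1 <= x <= 1 -> -1 <= y <= 1 ->
  (r < 1) || (x != y) -> 0 <= log_kernel r x y.
Proof.
move=> r01 xI yI rxy; have [s0 k1 k1'] := half_circle_le xI yI.
rewrite /log_kernel; move: (_ * Num.sqrt _) s0 k1 k1' => s s0 k1 k1'.
have p0 : 0 <= (4 * pi)^-1 :> R by rewrite invr_ge0 mulr_ge0// pi_ge0.
have k2 : x * y - s <= 1 by lra.
rewrite mulr_ge0// subr_ge0 ler_ln ?posrE; first by nra.
  by apply: poisson_denominator_gt0 => //; case/orP: rxy => [->//|/k1' ->]; rewrite orbT.
apply: poisson_denominator_gt0 => //; case/orP: rxy => [->//|/k1' h].
by rewrite (_ : _ < 1) ?orbT//; lra.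
Qed.

(** Provides the dominating function for r tending to 1. After exponentiation and clearing
    denominators the difference of the two sides is 4 s (1 - r)^2. *)
Lemma log_kernel_le1 r x y : 0 <= r <= 1 -> -1 <= x <= 1 -> -1 <= y <= 1 -> x != y ->
  log_kernel r x y <= log_kernel 1 x y.
Proof.
move=> r01 xI yI xy; have [s0 k1 /(_ xy) k1'] := half_circle_le xI yI.
rewrite /log_kernel; move: (_ * Num.sqrt _) s0 k1 k1' => s s0 k1 k1'.
have k2 : x * y - s <= 1 by lra.
have k2' : x * y - s < 1 by lra.
have A0 : 0 < 1 - 2 * r * (x * y + s) + r ^+ 2 by apply: poisson_denominator_gt0; rewrite // k1' orbT.
have B0 : 0 < 1 - 2 * r * (x * y - s) + r ^+ 2 by apply: poisson_denominator_gt0; rewrite // k2' orbT.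
have C0 : 0 < 1 - 2 * 1 * (x * y + s) + 1 ^+ 2 by lra.
have D0 : 0 < 1 - 2 * 1 * (x * y - s) + 1 ^+ 2 by lra.
have p0 : 0 <= (4 * pi)^-1 :> R by rewrite invr_ge0 mulr_ge0// pi_ge0.
apply: ler_wpM2l => //.
suff : ln ((1 - 2 * r * (x * y - s) + r ^+ 2) * (1 - 2 * 1 * (x * y + s) + 1 ^+ 2)) <=
       ln ((1 - 2 * 1 * (x * y - s) + 1 ^+ 2) * (1 - 2 * r * (x * y + s) + r ^+ 2)).
  by rewrite !lnM ?posrE//; lra.
rewrite ler_ln ?posrE ?mulr_gt0// -subr_ge0.
have -> : (1 - 2 * 1 * (x * y - s) + 1 ^+ 2) * (1 - 2 * r * (x * y + s) + r ^+ 2) -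
  (1 - 2 * r * (x * y - s) + r ^+ 2) * (1 - 2 * 1 * (x * y + s) + 1 ^+ 2) = 4 * s * (1 - r) ^+ 2 by ring.
by rewrite mulr_ge0 ?sqr_ge0// mulr_ge0.
Qed.

Lemma cvg_1_harmonicS : (fun n : nat => 1 - n.+2%:R^-1) @ \oo --> (1 : R).
Proof.
rewrite -[X in _ --> X](subr0 1); apply: cvgB; first exact: cvg_cst.
by have := @cvg_harmonic R; rewrite -(cvg_shiftS (@harmonic R)).
Qed.

Lemma log_kernel_cvg x y : -1 <= x <= 1 -> -1 <= y <= 1 -> x != y ->
  log_kernel (1 - n.+2%:R^-1) x y @[n --> \oo] --> log_kernel 1 x y.
Proof.
move=> xI yI xy; have [s0 k1 /(_ xy) {}k1'] := half_circle_le xI yI.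
have r1 := cvg_1_harmonicS.
have ck (k : R) : k < 1 -> ln (1 - 2 * (1 - n.+2%:R^-1) * k + (1 - n.+2%:R^-1) ^+ 2) @[n --> \oo] -->
  ln (1 - 2 * 1 * k + 1 ^+ 2).
  move=> k1''; apply: continuous_cvg; first by apply: continuous_ln; lra.
  apply: cvgD; last exact: cvgM.
  apply: cvgB; first exact: cvg_cst.
  by apply: cvgM; [apply: cvgM; [exact: cvg_cst|]|exact: cvg_cst].
by apply: cvgM; [exact: cvg_cst|apply: cvgB; apply: ck; lra].
Qed.

Lemma deriv_chebyshev1 x : (chebyshev_deriv_sum 1 (cst 1)).[x] = 1 :> R.
Proof. by rewrite /chebyshev_deriv_sum big_ord1 scale1r /= derivX hornerC. Qed.

Lemma ae_neq_lebesgue x (A : R -> Prop) : (forall y, x != y -> A y) -> {ae mu, forall y, A y}.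
Proof.
move=> h; exists [set x]; split; [exact: measurable_set1|exact: lebesgue_measure_set1|].
by move=> y /= nA; apply: contrapT => /eqP yx; apply: nA; apply: h; rewrite eq_sym.
Qed.

Lemma integrable_log_kernel_lt1 r x : 0 <= r < 1 -> -1 <= x <= 1 ->
  mu.-integrable I (EFin \o log_kernel r x).
Proof.
move=> r01 xI; apply: (@dominated_integrable _ _ R mu I _ (cst (2 / (1 - r) ^+ 2))).
- exact: measurable_itv.
- by apply: measurable_funTS; exact: measurable_log_kernel.
- move=> y; rewrite /= in_itv/= => yI.
  by have := log_kernel_series 0 r01 xI yI; rewrite big_ord0 mulr0 subr0 expr0 mulr1.
- by apply: continuous_integrable_itv => y; exact: cvg_cst.
Qed.

(* Fatou along [r -> 1], the integrals for r < 1 being known. *)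
Lemma integrable_log_kernel1 x : -1 <= x <= 1 -> mu.-integrable I (EFin \o log_kernel 1 x).
Proof.
move=> xI; have mI : measurable I by exact: measurable_itv.
have mk r : measurable_fun I (log_kernel r x) by apply: measurable_funTS; exact: measurable_log_kernel.
pose r_ n : R := 1 - n.+2%:R^-1.
have r01 n : 0 <= r_ n < 1.
  by rewrite /r_ subr_ge0 invf_le1// ler1n/= ltrBlDr ltrDl invr_gt0.
pose f n y := (log_kernel (r_ n) x y)%:E.
(* The constant 1 is the derivative of T_1, so the formula for r < 1 gives the integral of the
   kernel itself. *)
have fE n : (\int[mu]_(y in I) f n y)%E = (r_ n / 2 * sin_arccos 1 x)%:E.
  have := @integral_log_kernel_lt1 R (r_ n) x 1 (cst 1) (r01 n) xI.
  under eq_Rintegral do rewrite deriv_chebyshev1 mulr1.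
  rewrite big_ord1 mul1r expr1 => <-; rewrite /Rintegral fineK//.
  exact: integrable_fin_num (integrable_log_kernel_lt1 (r01 n) xI).
(* The diagonal point is removed: there the kernel at r = 1 contains [ln 0], which has the default
   value 0, while the kernels for r < 1 blow up as r tends to 1. *)
pose D := I `\` [set x].
have mD : measurable D by exact: measurableD.
have DI y : D y -> (-1 <= y <= 1) /\ x != y.
  by case=> /=; rewrite in_itv/= => yI /eqP; rewrite eq_sym.
have mf n : measurable_fun D (f n).
  by apply/measurable_EFinP; apply: measurable_funTS; exact: measurable_log_kernel.
have f0 n y : D y -> (0 <= f n y)%E.
  move=> /DI[yI _]; have /andP[rn0 rn1] := r01 n.
  rewrite lee_fin; apply: log_kernel_ge0 => //; last by rewrite rn1.
  by rewrite rn0 ltW.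
have f_cvg y : D y -> limn_einf (f^~ y) = (log_kernel 1 x y)%:E.
  move=> /DI[yI xy]; apply: (cvg_limn_einf_sup _).1.
  by apply: cvg_EFin; [exact: nearW|exact: log_kernel_cvg].
apply/(@negligible_integrable _ _ R mu I [set x]) => //.
- by apply/measurable_EFinP; exact: mk.
- exact: lebesgue_measure_set1.
apply/integrableP; split; first by apply/measurable_EFinP; apply: measurable_funTS;
  exact: measurable_log_kernel.
rewrite (_ : (\int[mu]_(y in _) _)%E = (\int[mu]_(y in D) limn_einf (f^~ y))%E); last first.
  apply: eq_integral => y; rewrite inE => Dy; rewrite f_cvg//= ger0_norm//.
  by have [yI xy] := DI y Dy; rewrite log_kernel_ge0 ?xy ?orbT ?ler01 ?lexx.
have F := @fatou _ _ R mu D mD f mf f0.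
refine (le_lt_trans F _).
have -> : (fun n => \int[mu]_(y in D) f n y)%E = (fun n => (r_ n / 2 * sin_arccos 1 x)%:E).
  apply/funext => n; rewrite -fE -negligible_integral//; first exact: integrable_log_kernel_lt1.
  exact: lebesgue_measure_set1.
have rc : (fun n => (r_ n / 2 * sin_arccos 1 x)%:E) @ \oo --> (1 / 2 * sin_arccos 1 x)%:E; last first.
  by rewrite (cvg_limn_einf_sup rc).1 ltry.
apply: cvg_EFin; first exact: nearW.
apply: cvgM; last exact: cvg_cst.
by apply: cvgM; [exact: cvg_1_harmonicS|exact: cvg_cst].
Qed.

Lemma integral_log_kernel r x n c : 0 <= r <= 1 -> -1 <= x <= 1 ->
  \int[mu]_(y in I) (log_kernel r x y * (chebyshev_deriv_sum n c).[y]) =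
  \sum_(k < n) c k * (r ^+ k.+1 / 2) * sin_arccos k.+1 x.
Proof.
move=> /andP[r0 r1] xI; have [rlt1|rge1] := ltP r 1.
  by apply: integral_log_kernel_lt1 => //; rewrite r0.
have {r0 r1 rge1} -> : r = 1 by apply/eqP; rewrite eq_le r1.
set q := chebyshev_deriv_sum n c; have [M qM] := poly_bounded q.
pose r_ m : R := 1 - m.+2%:R^-1.
have r01 m : 0 <= r_ m < 1.
  by rewrite /r_ subr_ge0 invf_le1// ler1n/= ltrBlDr ltrDl invr_gt0.
have mkq r' : measurable_fun I (fun y => log_kernel r' x y * q.[y]).
  apply: measurable_funTS; apply: measurable_funM (measurable_log_kernel r' x) _.
  by apply: continuous_measurable_fun; exact: continuous_horner.
have cv : \int[mu]_(y in I) (log_kernel (r_ m) x y * q.[y]) @[m --> \oo] -->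
  \int[mu]_(y in I) (log_kernel 1 x y * q.[y]).
  apply: (@Rintegral_dominated_cvg _ _ R mu I (fun m y => log_kernel (r_ m) x y * q.[y]) _
    (fun y => M * `|log_kernel 1 x y|)).
  - exact: measurable_itv.
  - by move=> m; exact: mkq.
  - exact: mkq.
  - apply: (ae_neq_lebesgue (x := x)) => y xy; rewrite /= in_itv/= => yI.
    by apply: cvgM; [exact: log_kernel_cvg|exact: cvg_cst].
  - apply: integrable_fctZ => //; exact: integrable_norm (integrable_log_kernel1 xI).
  - apply: (ae_neq_lebesgue (x := x)) => y xy m; rewrite /= in_itv/= => yI.
    have /andP[rm0 rm1] := r01 m.
    rewrite normrM mulrC; apply: ler_pM => //; first exact: qM.
    rewrite ger0_norm; first by apply: (le_trans _ (ler_norm _)); apply: log_kernel_le1; rewrite // rm0 ltW.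
    by apply: log_kernel_ge0; rewrite ?rm1// rm0 ltW.
have cE : (fun m => \int[mu]_(y in I) (log_kernel (r_ m) x y * q.[y])) =
    (fun m => \sum_(k < n) c k * (r_ m ^+ k.+1 / 2) * sin_arccos k.+1 x).
  by apply/funext => m; exact: integral_log_kernel_lt1.
rewrite cE in cv; apply: (cvg_unique _ cv) => //.
apply: cvg_fct_sum => k _.
apply: cvgM; last exact: cvg_cst.
apply: cvgM; first exact: cvg_cst.
apply: cvgM; last exact: cvg_cst.
apply: (@continuous_cvg _ _ _ _ _ r_ (fun z : R => z ^+ k.+1)); last exact: cvg_1_harmonicS.
exact: exprn_continuous.
Qed.

Lemma integrable_log_kernelM r x (q : {poly R}) : 0 <= r <= 1 -> -1 <= x <= 1 ->
  mu.-integrable I (EFin \o (fun y => log_kernel r x y * q.[y])).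
Proof.
move=> /andP[r0 r1] xI; have [M qM] := poly_bounded q.
have mI : measurable I by exact: measurable_itv.
apply: (@dominated_integrable _ _ R mu I _ (fun y => M * `|log_kernel r x y|)) => //.
- apply: measurable_funTS; apply: measurable_funM (measurable_log_kernel r x) _.
  by apply: continuous_measurable_fun; exact: continuous_horner.
- by move=> y; rewrite /= in_itv/= => yI; rewrite normrM mulrC ler_wpM2r// qM.
- apply: integrable_fctZ => //; apply: integrable_norm; have [rlt1|rge1] := ltP r 1.
    by apply: integrable_log_kernel_lt1 => //; rewrite r0.
  have -> : r = 1 by apply/eqP; rewrite eq_le r1.
  exact: integrable_log_kernel1.
Qed.

(** Serves for [gff_covariance], which is identified only off the diagonal; the measurability of [f]
    is deduced from that of [g]. *)
Lemma Rintegral_eq_except1 (f g : R -> R) x (D : set R) : measurable D -> D x ->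
  measurable_fun D g -> (forall y, D y -> x != y -> f y = g y) ->
  \int[mu]_(y in D) f y = \int[mu]_(y in D) g y.
Proof.
move=> mD Dx mg fg; have mx : measurable [set x] by exact: measurable_set1.
suff mf : measurable_fun D f.
  rewrite /Rintegral; congr fine; apply: ae_eq_integral => //; [exact/measurable_EFinP..|].
  by apply: (ae_neq_lebesgue (x := x)) => y xy Dy; rewrite fg.
have -> : D = (D `\` [set x]) `|` [set x].
  apply/seteqP; split => y /=; first by have [->|/eqP] := eqVneq y x; [right|left].
  by case=> [[]//|->].
apply/measurable_funU => //; first exact: measurableD.
split; last exact: measurable_fun_set1.
apply: (@eq_measurable_fun _ _ _ _ _ g) => [y|]; last by apply: measurable_funS mg => // y [].
by rewrite inE => -[Dy /eqP]; rewrite eq_sym => xy; rewrite fg.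
Qed.

Lemma ln_sqrt (z : R) : 0 < z -> ln (Num.sqrt z) = ln z / 2.
Proof.
move=> z0; rewrite -[z in RHS]sqr_sqrtr ?ltW// lnXn ?sqrtr_gt0//.
by rewrite -[X in X / _]mulr_natr mulfK.
Qed.

Lemma gff_covariance_log_kernel x y (t u : R) : -1 <= x <= 1 -> -1 <= y <= 1 -> x != y ->
  gff_covariance (Omega x t) (Omega y u) = log_kernel (expR (- `|t - u|)) x y.
Proof.
move=> xI yI xy.
have hx : Num.sqrt (1 - x ^+ 2) ^+ 2 = 1 - x ^+ 2 by rewrite sqr_sqrtr//; nra.
have hy : Num.sqrt (1 - y ^+ 2) ^+ 2 = 1 - y ^+ 2 by rewrite sqr_sqrtr//; nra.
have [s0 k1 /(_ xy) k1'] := half_circle_le xI yI.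
rewrite /gff_covariance normrM normfV /log_kernel /Omega.
move: (Num.sqrt (1 - x ^+ 2)) (Num.sqrt (1 - y ^+ 2)) hx hy s0 k1 k1' => a b hx hy s0 k1 k1'.
rewrite !normc_def/= !(mul0r, subr0, addr0).
set E1 := (_ ^+ 2 + (_ - expR u * b) ^+ 2).
set E2 := ((_ - expR u * y) ^+ 2 + _).
(* The larger radius [m] factors out of both squared distances and cancels in their quotient, so
   that only r = e^(-|t - u|) remains. *)
have [m m0 hm] : exists2 m : R, 0 < m & forall k, expR t ^+ 2 + expR u ^+ 2 - 2 * (expR t * expR u * k) =
    m ^+ 2 * (1 - 2 * expR (- `|t - u|) * k + expR (- `|t - u|) ^+ 2).
  have [tu|ut] := leP t u.
    exists (expR u); rewrite ?expR_gt0// => k.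
    have -> : expR t = expR u * expR (- `|t - u|).
      by rewrite -expRD ler0_norm ?subr_le0//; congr expR; ring.
    ring.
  exists (expR t); rewrite ?expR_gt0// => k.
  have -> : expR u = expR t * expR (- `|t - u|).
    by rewrite -expRD gtr0_norm ?subr_gt0//; congr expR; ring.
  ring.
have r01 : 0 <= expR (- `|t - u|) <= 1 by rewrite expR_ge0 expR_le1 oppr_le0 normr_ge0.
move: (expR (- `|t - u|)) r01 hm => r r01 hm.
have E1E : E1 = m ^+ 2 * (1 - 2 * r * (x * y + a * b) + r ^+ 2) by rewrite -hm /E1; nra.
have E2E : E2 = m ^+ 2 * (1 - 2 * r * (x * y - a * b) + r ^+ 2) by rewrite -hm /E2; nra.
have A0 : 0 < 1 - 2 * r * (x * y + a * b) + r ^+ 2 by apply: poisson_denominator_gt0; rewrite // k1' orbT.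
have B0 : 0 < 1 - 2 * r * (x * y - a * b) + r ^+ 2.
  by apply: poisson_denominator_gt0 => //; [lra|rewrite (_ : _ < 1) ?orbT//; lra].
have m20 : 0 < m ^+ 2 by rewrite exprn_gt0.
have E10 : 0 < E1 by rewrite E1E mulr_gt0.
have E20 : 0 < E2 by rewrite E2E mulr_gt0.
have -> : Num.sqrt E1 * (Num.sqrt E2 / (Num.sqrt E2 ^+ 2 + 0 ^+ 2)) = Num.sqrt E1 / Num.sqrt E2.
  have : Num.sqrt E2 != 0 by rewrite lt0r_neq0 ?sqrtr_gt0.
  move: (Num.sqrt E1) (Num.sqrt E2) => f g g0; field.
  by [].
rewrite ln_div ?posrE ?sqrtr_gt0//.
rewrite !ln_sqrt// E1E E2E !lnM ?posrE//.
have := lt0r_neq0 (pi_gt0 R); move: (pi : R) => p p0; field.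
by [].
Qed.

(** The inner integral contributes r^(k+1) / 2, the outer one (k + 1) pi / 2 by orthogonality; hence
    pi / 4. *)
Lemma gff_covariance_integral (n m : nat) c c' (t u : R) :
  \int[mu]_(x in `[(-1)%R, 1]) \int[mu]_(y in `[(-1)%R, 1])
    ((chebyshev_deriv_sum n c).[x] * gff_covariance (Omega x t) (Omega y u) * (chebyshev_deriv_sum m c').[y]) =
  \sum_(k < n) \sum_(k' < m | k' == k :> nat)
    c k * c' k' * (pi / 4 * (k.+1%:R * expR (- `|t - u|) ^+ k.+1)).
Proof.
set r := expR (- `|t - u|).
have r01 : 0 <= r <= 1 by rewrite expR_ge0 expR_le1 oppr_le0 normr_ge0.
transitivity (\int[mu]_(x in I) (\sum_(k < m) (c' k * (r ^+ k.+1 / 2)) *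
  ((chebyshev_deriv_sum n c).[x] * sin_arccos k.+1 x))).
  apply: eq_Rintegral => x; rewrite inE/= in_itv/=; move: x.
  suff h (x : R) : -1 <= x <= 1 -> \int[mu]_(y in I)
      ((chebyshev_deriv_sum n c).[x] * gff_covariance (Omega x t) (Omega y u) *
        (chebyshev_deriv_sum m c').[y]) =
      \sum_(k < m) (c' k * (r ^+ k.+1 / 2)) * ((chebyshev_deriv_sum n c).[x] * sin_arccos k.+1 x) by exact: h.
  move=> xI; have -> : \int[mu]_(y in I)
      ((chebyshev_deriv_sum n c).[x] * gff_covariance (Omega x t) (Omega y u) * (chebyshev_deriv_sum m c').[y])
    = \int[mu]_(y in I) ((chebyshev_deriv_sum n c).[x] * (log_kernel r x y * (chebyshev_deriv_sum m c').[y])).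
    apply: (@Rintegral_eq_except1 _ _ x I).
    - exact: measurable_itv.
    - by rewrite /= in_itv.
    - apply: measurable_funTS; apply: measurable_funM; first exact: measurable_cst.
      apply: measurable_funM (measurable_log_kernel r x) _.
      by apply: continuous_measurable_fun; exact: continuous_horner.
    - by move=> y; rewrite /= in_itv/= => yI xy; rewrite gff_covariance_log_kernel// -mulrA.
  rewrite RintegralZl//; last exact: integrable_log_kernelM.
  rewrite integral_log_kernel// mulr_sumr; apply: eq_bigr => k _; ring.
have iS (k : nat) : mu.-integrable I (EFin \o (fun x => (chebyshev_deriv_sum n c).[x] * sin_arccos k.+1 x)).
  apply: continuous_integrable_itv => x.
  by apply: cvgM; [exact: continuous_horner|exact: continuous_sin_arccos].
rewrite (Rintegral_fct_sum _ _ (fun k : 'I_m => integrable_fctZ _ _ (iS k)))//.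
under [RHS]eq_bigr do rewrite big_mkcond.
rewrite [RHS]exchange_big/=; apply: eq_bigr => k _.
rewrite RintegralZl// integral_expansion_sin; case: ifPn => [kn|]; last first.
  rewrite -leqNgt mulr0 => nk; rewrite big1// => j _.
  by rewrite gtn_eqF// (leq_trans (ltn_ord j)).
rewrite (bigD1 (Ordinal kn))//= eqxx big1 => [|j]; last first.
  by rewrite -val_eqE/= eq_sym => /negPf ->.
by rewrite addr0; field.
Qed.

End GFFKernel.

(** * Eigenvalues of symmetric matrices and their counting functions *)

Section SymmetricEigenvalues.
Context {R : realType}.

Lemma char_poly_similar (F : fieldType) n (B P D : 'M[F]_n) : P \in unitmx ->
  B = invmx P *m D *m P -> char_poly B = char_poly D.
Proof.
move=> Pu ->; rewrite /char_poly; set Q := map_mx polyC P.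
have Qu : map_mx polyC (invmx P) *m Q = 1%:M by rewrite -map_mxM mulVmx// map_mx1.
have Qu' : Q *m map_mx polyC (invmx P) = 1%:M by rewrite -map_mxM mulmxV// map_mx1.
have -> : char_poly_mx (invmx P *m D *m P) = map_mx polyC (invmx P) *m char_poly_mx D *m Q.
  rewrite /char_poly_mx mulmxBr mulmxBl !map_mxM; congr (_ - _).
  by rewrite scalar_mxC -mulmxA Qu mulmx1.
rewrite !det_mulmx mulrC mulrA -det_mulmx Qu' det1 mul1r//.
Qed.

(** Over [R[i]] the matrix is Hermitian, hence unitarily diagonalisable with real spectrum; the
    factorisation descends because the embedding of real polynomials is injective. *)
Lemma symmetric_char_poly_split n (A : 'M[R]_n) : A^T = A ->
  exists s : seq R, char_poly A = \prod_(a <- s) ('X - a%:P).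
Proof.
move=> sA; pose B : 'M[R[i]]_n := map_mx (@real_complex R) A.
have hB : B \is hermsymmx.
  apply: realsym_hermsym.
  - by apply/is_hermitianmxP; rewrite expr0 scale1r map_mx_id// /B map_trmx sA.
  - by apply/mxOverP => i j; rewrite mxE; apply/complex_realP; exists (A i j).
have /orthomx_spectralP B_E := hermitian_normalmx hB.
have dreal := hermitian_spectral_diag_real hB.
exists [seq complex.Re (spectral_diag B 0 i) | i : 'I_n].
apply: (map_poly_inj (real_complex R)).
rewrite map_char_poly -/B (char_poly_similar (spectral_unit B) B_E) char_poly_trig ?diag_mx_is_trig//.
rewrite rmorph_prod big_map big_enum/=; apply: eq_bigr => i _.
rewrite rmorphB/= map_polyX map_polyC/= mxE eqxx mulr1n RRe_real//.
by move/mxOverP: dreal; apply.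
Qed.

Lemma eigenvalues_symmetric n (A : 'M[R]_n) : A^T = A -> size (eigenvalues A) = n.
Proof.
move=> /symmetric_char_poly_split[s sE].
have h : char_poly A = \prod_(a <- eigenvalues A) ('X - a%:P).
  by apply: (@xgetPex _ [::] [set s : seq R | char_poly A = \prod_(a <- s) ('X - a%:P)]); exists s.
by apply/eqP; rewrite -eqSS -(size_char_poly A) h size_prod_XsubC.
Qed.

End SymmetricEigenvalues.

Section CountingFunction.
Context {R : realType}.
Local Notation mu := (@lebesgue_measure R).
Implicit Types (x a sc : R) (q Q : {poly R}) (s : seq R).

Definition counting s sc x : R := (count (fun a => a <= sc * x) s)%:R.

(* [1_(a <= x) - 1_(0 <= x)]: subtracting a fixed step makes the counting
   function integrable against polynomials. *)
Definition step_diff a x : R := (a <= x)%R%:R - (0 <= x)%R%:R.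

(** Up to sign, the integrand is [q] on the interval between 0 and [a], where the fundamental
    theorem of calculus applies. *)
Lemma integral_step_diff q Q a : Q^`() = q ->
  mu.-integrable setT (EFin \o (fun x => q.[x] * step_diff a x)) /\
  \int[mu]_x (q.[x] * step_diff a x) = Q.[0] - Q.[a].
Proof.
move=> Qq.
have H (u v : R) : u <= v -> mu.-integrable setT (EFin \o (fun x => q.[x] * ((u <= x)%R%:R - (v <= x)%R%:R))) /\
    \int[mu]_x (q.[x] * ((u <= x)%R%:R - (v <= x)%R%:R)) = Q.[v] - Q.[u].
  move=> uv.
  have E : (fun x => q.[x] * ((u <= x)%R%:R - (v <= x)%R%:R)) = (fun x => q.[x]) \_ `[u, v[.
    apply/funext => x; rewrite patchE mem_setE in_itv/=.
    have [vx|xv] := leP v x.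
      by rewrite (le_trans uv vx) subrr mulr0 andbF.
    by rewrite subr0 andbT; case: (u <= x); rewrite ?mulr1 ?mulr0.
  have iq : mu.-integrable `[u, v] (EFin \o (fun x => q.[x])).
    apply: continuous_compact_integrable; first exact: segment_compact.
    by apply: continuous_subspaceT => x; exact: continuous_horner.
  have iuv : mu.-integrable `[u, v[ (EFin \o (fun x => q.[x])).
    by apply: integrableS iq => //; exact: subset_itv_co_cc.
  rewrite E; split; first by have := (@integrable_mkcond _ _ R mu `[u, v[ (EFin \o
    (fun x => q.[x])) (measurable_itv _)).1 iuv; rewrite restrict_EFin.
  rewrite -Rintegral_mkcond Rintegral_itv_bndo_bndc//.
  move: uv; rewrite le_eqVlt => /predU1P[<-|uv]; first by rewrite subrr set_itv1 Rintegral_set1.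
  apply: Rintegral_FTC => //; last by move=> x; exact: continuous_horner.
  by move=> x; rewrite -Qq; exact: is_derive_poly.
rewrite /step_diff; have [a0|a0] := leP a 0; first exact: H.
have [i e] := H 0 a (ltW a0).
have E : (fun x => q.[x] * ((a <= x)%R%:R - (0 <= x)%R%:R)) =
  (fun x => -1 * (q.[x] * ((0 <= x)%R%:R - (a <= x)%R%:R))).
  by apply/funext => x; ring.
rewrite E; split; first exact: integrable_fctZ.
by rewrite RintegralZl// e mulN1r opprB.
Qed.

Lemma counting_step_diff s sc x : 0 < sc ->
  counting s sc x = \sum_(a <- s) step_diff (a / sc) x + (size s)%:R * (0 <= x)%R%:R.
Proof.
move=> sc0; rewrite /counting; elim: s => [|a s IH]; first by rewrite big_nil /= mul0r addr0.
rewrite big_cons /= natrD IH /step_diff ler_pdivrMr// (mulrC x) -natr1; ring.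
Qed.

(** A single counting function is not compactly supported. Since all lists have length [n] and the
    weights sum to 1, the reference steps at 0 cancel, and so do the terms in Q(0). *)
Lemma integral_counting_average (I : finType) (w : I -> R) n s0 (s : I -> seq R) q Q sc :
  0 < sc -> Q^`() = q -> \sum_i w i = 1 -> size s0 = n -> (forall i, size (s i) = n) ->
  \int[mu]_x (q.[x] * (counting s0 sc x - \sum_i w i * counting (s i) sc x)) =
  \sum_i w i * (\sum_(a <- s i) Q.[a / sc]) - \sum_(a <- s0) Q.[a / sc].
Proof.
move=> sc0 Qq w1 s0n sn.
pose G s x := \sum_(a <- s) q.[x] * step_diff (a / sc) x.
have iG s1 : mu.-integrable setT (EFin \o G s1).
  by apply: integrable_fct_sum => // a; exact: (integral_step_diff _ Qq).1.
have IG s1 : size s1 = n -> \int[mu]_x G s1 x = n%:R * Q.[0] - \sum_(a <- s1) Q.[a / sc].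
  move=> <-; rewrite Rintegral_fct_sum//; last by move=> a; exact: (integral_step_diff _ Qq).1.
  under eq_bigr do rewrite (integral_step_diff _ Qq).2.
  by rewrite sumrB big_const_seq count_predT iter_addr_0 mulr_natl.
have E x : q.[x] * (counting s0 sc x - \sum_i w i * counting (s i) sc x) = G s0 x - \sum_i w i * G (s i) x.
  have -> : \sum_i w i * counting (s i) sc x =
      \sum_i w i * \sum_(a <- s i) step_diff (a / sc) x + n%:R * (0 <= x)%R%:R.
    have h i : counting (s i) sc x = \sum_(a <- s i) step_diff (a / sc) x + n%:R * (0 <= x)%R%:R.
      by rewrite counting_step_diff// sn.
    move: (n%:R * _) h => y h.
    rewrite -[y]mul1r -[in RHS]w1 mulr_suml -big_split/=.
    by apply: eq_bigr => i _; rewrite h mulrDr.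
  rewrite counting_step_diff// s0n opprD addrACA subrr addr0 mulrBr; congr (_ - _).
    by rewrite mulr_sumr.
  by rewrite mulr_sumr; apply: eq_bigr => i _; rewrite /G -mulr_sumr mulrCA.
rewrite (_ : (fun x => _) = fun x => G s0 x - \sum_i w i * G (s i) x); last exact/funext.
rewrite RintegralB//; last by apply: integrable_fct_sum => // i; exact: integrable_fctZ.
rewrite (Rintegral_fct_sum _ _ (fun i => integrable_fctZ _ (w i) (iG (s i))))//.
under eq_bigr do rewrite RintegralZl// IG// mulrBr.
rewrite IG// sumrB -mulr_suml w1 mul1r; ring.
Qed.

End CountingFunction.

(** * Graph functionals and conditional expectations as finite averages *)

Lemma xget_nat_preimage {Om : Type} (A : Om -> set nat) (n : nat) :
  (forall w m m', A w m -> A w m' -> m = m') ->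
  (fun w => xget 0%N (A w)) @^-1` [set n] =
  [set w | A w n] `|` (if n == 0%N then ~` (\bigcup_m [set w | A w m]) else set0).
Proof.
move=> Au; apply/seteqP; split => w /=.
  case: xgetP => [m -> Am <-|nA <-]; first by left.
  by right; rewrite eqxx => -[m _] /nA.
case=> [An|]; first by case: xgetP => [m _ Am|/(_ n)//]; exact: Au Am An.
by case: eqP => // -> nA; rewrite xgetPN// => m Am; apply: nA; exists m.
Qed.

Section GraphStatistics.
Context {disp : measure_display} {Om : measurableType disp} {R : realType}.
Variable P : probability Om R.
Variables (tau : nat -> forall n, Om -> 'S_n) (T : nat -> {RV P >-> R}).
Hypothesis mtau : forall l n (s : 'S_n), measurable (tau l n @^-1` [set s]).

Lemma measurable_num_vertices (t : R) n : measurable (num_vertices T t @^-1` [set n]).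
Proof.
have mS k : measurable_fun setT (fun w => \sum_(i < k) T i w).
  by apply: measurable_sum => i; exact: measurable_funPT.
have mle k : measurable [set w | \sum_(i < k) T i w <= t].
  rewrite [X in measurable X](_ : _ = (fun w => \sum_(i < k) T i w) @^-1` `]-oo, t]%classic); last first.
    by apply/seteqP; split => w /=; rewrite in_itv.
  by rewrite -[X in measurable X]setTI; exact: mS.
have mA m : measurable [set w | \sum_(i < m) T i w <= t /\ forall k, \sum_(i < k) T i w <= t -> (k <= m)%N].
  rewrite [X in measurable X](_ : _ = [set w | \sum_(i < m) T i w <= t] `&`
     \bigcap_k (if (k <= m)%N then setT else ~` [set w | \sum_(i < k) T i w <= t])); last first.
    apply/seteqP; split => w /= [wm h]; split=> // k.
      by move=> _; case: ifPn => // km /h; rewrite (negbTE km).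
    by have := h k I; case: ifPn => // km /=.
  apply: measurableI => //; apply: bigcapT_measurable => k.
  by case: ifP => // _; exact: measurableC.
rewrite xget_nat_preimage => [|w m m' [h1 h2] [h1' h2']]; last first.
  by apply/eqP; rewrite eqn_leq h2' ?h2.
apply: measurableU; first exact: mA.
(* The value 0 also collects, as a default, the sample points where the defining set has no
   maximum. *)
case: (n == 0%N); last exact: measurable0.
by apply: measurableC; exact: bigcupT_measurable.
Qed.

Variables (t : R) (g : nat).
Local Notation N := (num_vertices T t).

(** [adjacency g] reads only the permutations of index below [g]; the identity elsewhere is a
    filler. *)
Definition sample_adjacency n (s : {ffun 'I_g -> 'S_n}) : 'M[R]_n :=
  adjacency g (fun l => if insub l is Some i then s i else 1%g).

(** These countably many events partition the space and every functional of the graph is constant on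
    each, so measurability and conditioning reduce to sums over cells. *)
Definition sample_cell n (s : {ffun 'I_g -> 'S_n}) : set Om :=
  N @^-1` [set n] `&` [set w | forall l : 'I_g, tau l n w = s l].

Definition graph_statistic (Phi : forall n, 'M[R]_n -> R) (w : Om) : R :=
  Phi _ (growing_adjacency tau T t g w).

Lemma measurable_sample_cell n (s : {ffun 'I_g -> 'S_n}) : measurable (sample_cell s).
Proof.
apply: measurableI; first exact: measurable_num_vertices.
rewrite [X in measurable X](_ : _ = \bigcap_(l in [set: 'I_g]) (tau l n @^-1` [set s l])).
  by apply: fin_bigcap_measurable => // l _; exact: mtau.
by apply/seteqP; split => [w h l _|w h l]; [exact: h|exact: h l I].
Qed.

Lemma graph_statistic_cell Phi n (s : {ffun 'I_g -> 'S_n}) w : sample_cell s w ->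
  graph_statistic Phi w = Phi n (sample_adjacency s).
Proof.
move=> [/= Nn]; case: n / Nn s => s h.
rewrite /graph_statistic /growing_adjacency /sample_adjacency /adjacency.
congr Phi; apply/matrixP => i j; rewrite !mxE; apply: eq_bigr => l _.
by rewrite valK h.
Qed.

Lemma sample_cell_total w : sample_cell [ffun l : 'I_g => tau l (N w) w] w.
Proof. by split=> //= l; rewrite ffunE. Qed.

Lemma sample_cell_uniq n (s : {ffun 'I_g -> 'S_n}) w :
  sample_cell s w -> s = [ffun l : 'I_g => tau l n w].
Proof. by move=> [_ h]; apply/ffunP => l; rewrite ffunE h. Qed.

Lemma measurable_graph_statistic Phi : measurable_fun setT (graph_statistic Phi).
Proof.
move=> _ Y mY; rewrite setTI.
rewrite [X in measurable X](_ : _ = \bigcup_n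
   \bigcup_(s in [set s : {ffun 'I_g -> 'S_n} | Y (Phi n (sample_adjacency s))]) sample_cell s).
  apply: bigcupT_measurable => n; apply: fin_bigcup_measurable => [|s _]; first exact: finite_finset.
  exact: measurable_sample_cell.
apply/seteqP; split => w /=.
  move=> Yw; exists (N w) => //; exists [ffun l : 'I_g => tau l (N w) w]; last exact: sample_cell_total.
  by rewrite /= -(graph_statistic_cell Phi (sample_cell_total w)).
by move=> [n _ [s /= Ys /graph_statistic_cell ->]].
Qed.

Definition cell_weight n (s : {ffun 'I_g -> 'S_n}) : R :=
  fine (P (sample_cell s)) / fine (P (N @^-1` [set n])).

Lemma integral_graph_statistic Phi n :
  \int[P]_(w in N @^-1` [set n]) graph_statistic Phi w =
  \sum_(s : {ffun 'I_g -> 'S_n}) Phi n (sample_adjacency s) * fine (P (sample_cell s)).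
Proof.
have mN := measurable_num_vertices t n.
have i1 (s : {ffun 'I_g -> 'S_n}) : P.-integrable (N @^-1` [set n]) (EFin \o (\1_(sample_cell s) : Om -> R)).
  have mc := measurable_sample_cell s.
  apply: (@integrableS _ _ _ _ setT) => //.
  by apply: (@bounded_integrable _ _ _ _ _ 1); [exact: measurable_indic|exact: indic_norm_le1].
transitivity (\int[P]_(w in N @^-1` [set n])
    \sum_(s : {ffun 'I_g -> 'S_n}) Phi n (sample_adjacency s) * (\1_(sample_cell s) w)).
  apply: eq_Rintegral => w; rewrite inE/= => Nn; case: n / Nn {mN i1}.
  rewrite (bigD1 [ffun l : 'I_g => tau l (N w) w])//= (graph_statistic_cell Phi (sample_cell_total w)).
  rewrite indicE mem_set ?mulr1; last exact: sample_cell_total.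
  rewrite big1 ?addr0// => s /eqP sn; rewrite indicE memNset ?mulr0// => /sample_cell_uniq.
  exact: sn.
rewrite (Rintegral_fct_sum _ _ (fun s => integrable_fctZ _ _ (i1 s)))//.
apply: eq_bigr => s _; rewrite RintegralZl//; congr (_ * _).
rewrite /Rintegral integral_indic//; last exact: measurable_sample_cell.
by congr (fine (P _)); rewrite setIidl// => w [].
Qed.

Lemma cond_exp_graph_statistic Phi w :
  cond_exp P (graph_statistic Phi) N w =
  \sum_s cell_weight s * Phi (N w) (sample_adjacency s).
Proof.
rewrite /cond_exp integral_graph_statistic mulr_suml; apply: eq_bigr => s _.
by rewrite /cell_weight -mulrA mulrC.
Qed.

Lemma sum_cell_weight n : fine (P (N @^-1` [set n])) != 0 ->
  \sum_(s : {ffun 'I_g -> 'S_n}) cell_weight s = 1.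
Proof.
move=> Pn; rewrite -mulr_suml.
have := integral_graph_statistic (fun _ _ => 1) n; rewrite Rintegral_cst//; last exact: measurable_num_vertices.
by under [in X in _ = X -> _]eq_bigr do rewrite mul1r; rewrite mul1r => <-; rewrite mulfV.
Qed.

(** There are countably many values of [N], so those of probability 0 together form a null event.
    Outside it the cell weights sum to 1. *)
Lemma ae_num_vertices_charged : {ae P, forall w, fine (P (N @^-1` [set (N w)])) != 0}.
Proof.
have [A [mA A0 sA]] : P.-negligible (\bigcup_n [set w | N w = n /\ P (N @^-1` [set n]) = 0%E]).
  apply: negligible_bigcup => n.
  have [Pn|Pn] := eqVneq (P (N @^-1` [set n])) 0%E.
    exists (N @^-1` [set n]); split=> //; first exact: measurable_num_vertices.
    by move=> w [].
  by apply: negligibleS (negligible_set0 P) => w /= -[_ /eqP]; rewrite (negbTE Pn).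
exists A; split=> // w /= /negP; rewrite negbK => h; apply: sA; exists (N w) => //=; split=> //.
have mN := measurable_num_vertices t (N w).
by rewrite -[LHS]fineK ?fin_num_measure// (eqP h).
Qed.

End GraphStatistics.

(** * The height integral as a combination of centered traces *)

Section HeightIntegrals.
Context {disp : measure_display} {Om : measurableType disp} {R : realType}.
Variable P : probability Om R.
Variables (tau : nat -> forall n, Om -> 'S_n) (T : nat -> {RV P >-> R}).
Hypothesis mtau : forall l n (s : 'S_n), measurable (tau l n @^-1` [set s]).
Variable d : R -> nat.
Implicit Types (s t : R) (c : nat -> R) (w : Om).

Lemma adjacency_sym g n (p : nat -> 'S_n) : (adjacency g p : 'M[R]_n)^T = adjacency g p.
Proof. by apply/matrixP => i j; rewrite !mxE; apply: eq_bigr => l _; rewrite addrC. Qed.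

Lemma centered_tracesE s t w k :
  centered_traces tau T d s w t k =
  graph_statistic tau T (s + t) (d (s + t)) (fun n A => graph_trace (d (s + t)) A (Defs.chebyshev k.+1)) w -
  \sum_(s' : {ffun 'I_(d (s + t)) -> 'S_(num_vertices T (s + t) w)}) cell_weight tau T (s + t) s' *
     graph_trace (d (s + t)) (sample_adjacency s') (Defs.chebyshev k.+1).
Proof. by rewrite -(cond_exp_graph_statistic T mtau (s + t) (d (s + t))
  (fun n A => graph_trace (d (s + t)) A (Defs.chebyshev k.+1))). Qed.

Lemma heightE s x t w :
  height tau T d s x t w =
  Num.sqrt (pi / 2) * (graph_statistic tau T (s + t) (d (s + t))
      (fun n A => counting (eigenvalues A) (spectral_scale (d (s + t))) x) w -
    \sum_(s' : {ffun 'I_(d (s + t)) -> 'S_(num_vertices T (s + t) w)}) cell_weight tau T (s + t) s' *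
      counting (eigenvalues (sample_adjacency s')) (spectral_scale (d (s + t))) x).
Proof. by rewrite -(cond_exp_graph_statistic T mtau (s + t) (d (s + t))
  (fun n A => counting (eigenvalues A) (spectral_scale (d (s + t))) x)). Qed.

Lemma measurable_centered_traces s t k : measurable_fun setT (fun w => centered_traces tau T d s w t k).
Proof.
rewrite (_ : (fun w => _) = graph_statistic tau T (s + t) (d (s + t))
  (fun n A => graph_trace (d (s + t)) A (Defs.chebyshev k.+1) -
  \sum_(s' : {ffun 'I_(d (s + t)) -> 'S_n}) cell_weight tau T (s + t) s' *
     graph_trace (d (s + t)) (sample_adjacency s') (Defs.chebyshev k.+1)));
       first exact: measurable_graph_statistic.
by apply/funext => w; rewrite centered_tracesE.
Qed.

(** With the integral over x placed inside the functional, the pairing is again a function of the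
    graph alone, hence constant on cells. *)
Lemma measurable_integral_height s t (q : {poly R}) :
  measurable_fun setT (fun w => \int[lebesgue_measure]_x (q.[x] * height tau T d s x t w)).
Proof.
rewrite (_ : (fun w => _) = graph_statistic tau T (s + t) (d (s + t))
  (fun n A => \int[lebesgue_measure]_x (q.[x] *
  (Num.sqrt (pi / 2) * (counting (eigenvalues A) (spectral_scale (d (s + t))) x -
    \sum_(s' : {ffun 'I_(d (s + t)) -> 'S_n}) cell_weight tau T (s + t) s' *
      counting (eigenvalues (sample_adjacency s')) (spectral_scale (d (s + t))) x)))));
        first exact: measurable_graph_statistic.
by apply/funext => w; apply: eq_Rintegral => x _; rewrite heightE.
Qed.

(** The sign is that of integration by parts: an eigenvalue a contributes the integral of the
    polynomial over x >= a, which involves - Q(a). *)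
Lemma integral_height s t w n c : (0 < d (s + t))%N ->
  fine (P (num_vertices T (s + t) @^-1` [set (num_vertices T (s + t) w)])) != 0 ->
  \int[lebesgue_measure]_x ((chebyshev_deriv_sum n c).[x] * height tau T d s x t w) =
  - Num.sqrt (pi / 2) * \sum_(k < n) c k * centered_traces tau T d s w t k.
Proof.
move=> d0 PN; set g := d (s + t) in d0 *; set m := num_vertices T (s + t) w in PN *.
pose Q : {poly R} := \sum_(k < n) c k *: Defs.chebyshev k.+1.
have Qq : Q^`() = chebyshev_deriv_sum n c.
  by rewrite /Q raddf_sum; apply: eq_bigr => k _; exact: derivZ.
have sc0 : 0 < spectral_scale g :> R.
  rewrite /spectral_scale mulr_gt0// sqrtr_gt0 subr_gt0 -natrM ltr1n; lia.
pose A0 : 'M[R]_m := growing_adjacency tau T (s + t) g w.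
pose tr k (A : 'M[R]_m) := \sum_(a <- eigenvalues A) (Defs.chebyshev k.+1).[a / spectral_scale g].
have w1 := sum_cell_weight mtau g PN.
have QE (A : 'M[R]_m) : \sum_(a <- eigenvalues A) Q.[a / spectral_scale g] = \sum_(k < n) c k * tr k A.
  rewrite /Q; under eq_bigr do rewrite horner_sum.
  rewrite exchange_big/=; apply: eq_bigr => k _; rewrite /tr mulr_sumr.
  by apply: eq_bigr => a _; rewrite hornerZ.
have cE k : centered_traces tau T d s w t k =
    tr k A0 - \sum_(s' : {ffun 'I_g -> 'S_m}) cell_weight tau T (s + t) s' * tr k (sample_adjacency s').
  rewrite centered_tracesE /graph_statistic -/g -/A0 /graph_trace.
  (* The correction subtracted in [graph_trace] depends only on the degree and the number of
     vertices, so it drops out once centered by weights of sum 1. *)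
  have wK (K : R) (f : {ffun 'I_g -> 'S_m} -> R) :
      \sum_s' cell_weight tau T (s + t) s' * (f s' - K) = \sum_s' cell_weight tau T (s + t) s' * f s' - K.
    by under eq_bigr do rewrite mulrBr; rewrite sumrB -mulr_suml w1 mul1r.
  by rewrite wK /tr; ring.
pose Q' := Num.sqrt (pi / 2) *: Q.
transitivity (\int[lebesgue_measure]_x (Q'^`().[x] *
   (counting (eigenvalues A0) (spectral_scale g) x -
    \sum_(s' : {ffun 'I_g -> 'S_m}) cell_weight tau T (s + t) s' *
      counting (eigenvalues (sample_adjacency s')) (spectral_scale g) x))).
  apply: eq_Rintegral => x _; rewrite heightE /Q' derivZ Qq hornerZ mulrA.
  by rewrite (mulrC (_ .[x])).
have Q'E (A : 'M[R]_m) : \sum_(a <- eigenvalues A) Q'.[a / spectral_scale g] =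
    Num.sqrt (pi / 2) * \sum_(k < n) c k * tr k A.
  by rewrite -QE mulr_sumr; apply: eq_bigr => a _; rewrite hornerZ.
rewrite (@integral_counting_average _ _ _ m _ _ _ Q')//; first last.
- by move=> s'; rewrite eigenvalues_symmetric// adjacency_sym.
- by rewrite eigenvalues_symmetric// adjacency_sym.
rewrite Q'E; under eq_bigr do rewrite Q'E mulrCA.
rewrite -mulr_sumr -mulrBr mulNr -mulrN; congr (_ * _).
under [in RHS]eq_bigr do rewrite cE mulrBr.
rewrite sumrB opprB; congr (_ - _).
under eq_bigr do rewrite mulr_sumr.
rewrite exchange_big/=; apply: eq_bigr => k _; rewrite mulr_sumr.
by apply: eq_bigr => s' _; rewrite mulrCA.
Qed.

End HeightIntegrals.

(** * Complex rows as pairs of real rows *)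

Section ComplexRows.
Context {R : realType}.

Lemma Re_horner_real (p : {poly R[i]}) (x : R) :
  complex.Re p.[x%:C] = (map_poly (@complex.Re R) p).[x].
Proof.
have h : (size (map_poly (@complex.Re R) p) <= size p)%N by exact: size_poly.
rewrite (horner_coef_wide _ h) horner_coef raddf_sum; apply: eq_bigr => i _.
by rewrite coef_map_id0// -rmorphXn; case: (p`_i) => a b /=; rewrite mulr0 subr0.
Qed.

Lemma Im_horner_real (p : {poly R[i]}) (x : R) :
  complex.Im p.[x%:C] = (map_poly (@complex.Im R) p).[x].
Proof.
have h : (size (map_poly (@complex.Im R) p) <= size p)%N by exact: size_poly.
rewrite (horner_coef_wide _ h) horner_coef raddf_sum; apply: eq_bigr => i _.
by rewrite coef_map_id0// -rmorphXn; case: (p`_i) => a b /=; rewrite mulr0 add0r.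
Qed.

(** Real parts come first, imaginary parts second; test functions on complex rows thus become test
    functions on real rows of double length. *)
Definition complex_row n (v : 'rV[R]_(n + n)) : 'rV[R[i]^o]_n :=
  \row_i (v 0 (lshift n i) +i* v 0 (rshift n i)).

Lemma continuous_complex_row n : continuous (@complex_row n).
Proof.
move=> v A [B nB BA].
suff : \forall w \near v, forall i, B 0 i ((w : 'rV[R]_(n + n)) 0 (lshift n i) +i* (w : 'rV[R]_(n + n))
  0 (rshift n i)).
  apply: filterS => w h; apply: BA => i j /=; rewrite ord1 mxE; exact: h.
apply: (@filter_forall _ _ (fun i (w : 'rV[R]_(n + n)) => B 0 i (w 0 (lshift n i) +i* w 0 (rshift n
  i))) (nbhs v) (nbhs_filter v)) => i.
have := nB 0 i; rewrite mxE.
have ca := @coord_continuous R 1 (n + n) 0 (lshift n i) v.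
have cb := @coord_continuous R 1 (n + n) 0 (rshift n i) v.
move=> /nbhs_ballP[[e e'] /= e0 eB].
(* The radius of a ball in [R[i]] is itself complex; positivity forces its imaginary part to be
   0. *)
move: e0 eB; rewrite ltcE/= => /andP[/eqP -> e0] eB.
have e2 : 0 < e / 2 by rewrite divr_gt0.
have ha := @cvgr_dist_lt _ _ _ _ (nbhs_filter v) _ _ ca _ e2.
have hb := @cvgr_dist_lt _ _ _ _ (nbhs_filter v) _ _ cb _ e2.
near=> w; apply: eB; rewrite /ball/= normc_def ltcR/=.
have : `|v 0 (lshift n i) - w 0 (lshift n i)| < e / 2 by near: w.
have : `|v 0 (rshift n i) - w 0 (rshift n i)| < e / 2 by near: w.
rewrite !ltr_norml => /andP[b1 b2] /andP[a1 a2].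
rewrite -[ltRHS]gtr0_norm// -sqrtr_sqr ltr_sqrt ?exprn_gt0//; nra.
Unshelve. all: by end_near.
Qed.

End ComplexRows.

(** * Variance of the free field integrals *)

Section FreeFieldVariance.
Context {disp : measure_display} {Om : measurableType disp} {R : realType}.
Variables (Q : probability Om R) (h : {poly R} -> R -> {RV Q >-> R}).

(** The Gaussian law comes with some variance, which the second moment identifies. Expanding the
    square requires integrable products; this follows from |xy| <= x^2 + y^2 and the finite Gaussian
    second moments. *)
Lemma gff_variance : gff_integrals h -> forall (m : nat) (a : 'I_m -> R) (p : 'I_m -> {poly R})
  (t : 'I_m -> R) (v : R),
  (forall j, 0 <= t j) -> 0 <= v ->
  has_law Q (fun w => \sum_(j < m) a j * h (p j) (t j) w) (gaussian_law 0 v) ->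
  v = \sum_(j < m) \sum_(j' < m) a j * a j' *
    \int[lebesgue_measure]_(x in `[(-1)%R, 1]) \int[lebesgue_measure]_(y in `[(-1)%R, 1])
      ((p j).[x] * gff_covariance (Omega x (t j)) (Omega y (t j')) * (p j').[y]).
Proof.
move=> [_ hlaw hcov] m a p t v t0 v0 law.
have mh q u : measurable_fun setT (h q u : Om -> R) by exact: measurable_funPT.
have i2 q u : 0 <= u -> Q.-integrable setT (EFin \o (fun w => h q u w ^+ 2)).
  move=> u0; have [//|v1 v10 law1] := hlaw 1%N (fun=> 1) (fun=> q) (fun=> u).
  have E : (fun w => \sum_(j < 1) 1 * h q u w) = h q u by apply/funext => w; rewrite big_ord1 mul1r.
  rewrite E in law1; have V := gaussian_variance v10 (mh q u) law1.
  apply/integrableP; split; first by apply/measurable_EFinP; exact: measurable_funX.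
  under eq_integral do rewrite /= ger0_norm ?sqr_ge0//.
  by rewrite V ltry.
have ip j j' : Q.-integrable setT (EFin \o (fun w => h (p j) (t j) w * h (p j') (t j') w)).
  apply: (@dominated_integrable _ _ R Q setT _ (fun w => h (p j) (t j) w ^+ 2 + h (p j') (t j') w ^+ 2)) => //.
  - exact: measurable_funM.
  - move=> w _; rewrite ler_norml; have := sqr_ge0 (h (p j) (t j) w + h (p j') (t j') w).
    have := sqr_ge0 (h (p j) (t j) w - h (p j') (t j') w); nra.
  - by apply: integrable_fctD => //; exact: i2.
have V : (\int[Q]_w ((\sum_(j < m) a j * h (p j) (t j) w) ^+ 2)%:E = v%:E)%E :=
  gaussian_variance v0 (measurable_sum _ (fun j : 'I_m => measurable_funM (measurable_cst (a j))
  (mh (p j) (t j)))) law.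
have -> : v = \int[Q]_w (\sum_(j < m) a j * h (p j) (t j) w) ^+ 2 by rewrite /Rintegral V.
transitivity (\int[Q]_w \sum_(j < m) \sum_(j' < m) a j * a j' * (h (p j) (t j) w * h (p j') (t j') w)).
  apply: eq_Rintegral => w _; rewrite expr2 mulr_suml; apply: eq_bigr => j _.
  by rewrite mulr_sumr; apply: eq_bigr => j' _; ring.
have iS j := integrable_fct_sum measurableT (index_enum 'I_m)
  (fun j' : 'I_m => integrable_fctZ measurableT (a j * a j') (ip j j')).
rewrite (Rintegral_fct_sum measurableT _ iS); apply: eq_bigr => j _.
rewrite (Rintegral_fct_sum measurableT _ (fun j' => integrable_fctZ measurableT (a j * a j') (ip j j'))).
apply: eq_bigr => j' _; rewrite RintegralZl//; congr (_ * _).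
by rewrite /Rintegral; have := hcov (p j) (p j') _ _ (t0 j) (t0 j'); rewrite unlock => ->.
Qed.

End FreeFieldVariance.

(** Flattens the pairs (time, Chebyshev index) into one ordinal index, the form in which marginals
    of the trace process are stated. *)
Lemma sum_sigma_enum {V : zmodType} (m : nat) (n_ : 'I_m -> nat) (F : 'I_m -> nat -> V) :
  \sum_(j < m) \sum_(k < n_ j) F j k =
  \sum_(e < #|{: {j : 'I_m & 'I_(n_ j)}}|) F (tag (enum_val e)) (tagged (enum_val e)).
Proof.
rewrite (sig_big_dep _ (fun _ => xpredT) (fun j (k : 'I_(n_ j)) => F j k))/=.
exact: (reindex _ (onW_bij _ (@enum_val_bij _))).
Qed.

Lemma cos_lipschitz {R : realType} (b x y : R) : `|cos (x + b) - cos (y + b)| <= 1 * `|x - y|.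
Proof.
wlog xy : x y / y <= x => [W|].
  have [|/ltW] := leP y x; first exact: W.
  by rewrite distrC (distrC x); exact: W.
have dF (z : R) : is_derive z (1 : R) (fun z => cos (z + b)) (- sin (z + b)).
  by apply: is_derive_eq; rewrite /GRing.scale/=; ring.
have [|c _ ->] := @MVT_segment _ (fun z => cos (z + b)) (fun z => - sin (z + b)) y x xy (fun z _ => dF z).
  apply: continuous_subspaceT => z; apply: differentiable_continuous; apply/derivable1_diffP.
  exact: (@ex_derive _ _ _ _ _ _ _ (dF z)).
by rewrite normrM ler_wpM2r// normrN ler_norml sin_geN1 sin_le1.
Qed.

Lemma clamp_lipschitz {R : realType} (x y : R) :
  `|Num.max 0 (Num.min 1 x) - Num.max 0 (Num.min 1 y)| <= `|x - y|.
Proof.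
have h1 := ler_norm (x - y); have h2 := ler_norm (- (x - y)); rewrite normrN in h2.
rewrite ler_norml.
case: (lerP 1 x) => ?; case: (lerP 1 y) => ?; rewrite ?(max_r ler01);
  do ?case: (lerP 0 _) => ?; apply/andP; split; lra.
Qed.

(** * Convergence and tightness of the height pairings *)

Section HeightConvergence.
Context {disp : measure_display} {Om : measurableType disp} {R : realType}.
Variable P : probability Om R.
Variables (tau : nat -> forall n, Om -> 'S_n) (T : nat -> {RV P >-> R}) (d : R -> nat).
Hypothesis mtau : forall l n (s : 'S_n), measurable (tau l n @^-1` [set s]).
Hypothesis d0 : forall t : R, 0 <= t -> (0 < d t)%N.
Context {disp' : measure_display} {Om' : measurableType disp'} {Q : probability Om' R}.
Variables (U W : nat -> R -> {RV Q >-> R}).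
Hypothesis OU : stationary_OU_family U W.
Hypothesis XU : skorokhod_cvg_in_law P (centered_traces tau T d) Q (fun w t k => U k t w).
Variables (m : nat) (p : 'I_m -> {poly R}) (t : 'I_m -> R).
Variables (n_ : 'I_m -> nat) (c : 'I_m -> nat -> R).
Hypothesis t0 : forall j, 0 <= t j.
Hypothesis pE : forall j, p j = chebyshev_deriv_sum (n_ j) (c j).

Definition height_pairing (s : R) (w : Om) (j : 'I_m) : R :=
  \int[lebesgue_measure]_x ((p j).[x] * height tau T d s x (t j) w).

Local Notation E := #|{: {j : 'I_m & 'I_(n_ j)}}|.
Local Notation jj e := (tag (enum_val (e : 'I_E))).
Local Notation kk e := (tagged (enum_val (e : 'I_E)) : nat).
Let weight (a : 'I_m -> R) (e : 'I_E) : R := - Num.sqrt (pi / 2) * a (jj e) * c (jj e) (kk e).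

Lemma measurable_height_pairing s j : measurable_fun setT (fun w => height_pairing s w j).
Proof. exact: measurable_integral_height. Qed.

(** Almost surely the combination of pairings is a finite combination of coordinates of the trace
    process at the fixed times [t j], so the marginal convergence applies. The cosines and the ramps
    used for tightness are both instances of [phi]. *)
Lemma height_pairing_cvg a (phi : R -> R) (M C : R) : (forall x, `|phi x| <= M) -> 0 <= C ->
  (forall x y, `|phi x - phi y| <= C * `|x - y|) ->
  \int[P]_w phi (\sum_(j < m) a j * height_pairing s w j) @[s --> +oo] -->
  \int[Q]_w phi (\sum_(e < E) weight a e * U (kk e) (t (jj e)) w).
Proof.
move=> phiM C0 phiC; have [_ _ cU _ _] := OU.
have mct s (u : R) k : measurable_fun setT (fun w => centered_traces tau T d s w u k).
  exact: measurable_centered_traces.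
have := skorokhod_marginal_cvg XU cU (a := weight a) (k := fun e => kk e) (t := fun e => t (jj e))
  (fun e => t0 _) (fun s _ u k _ => mct s u k) phiM C0 phiC.
apply: cvg_trans; apply: near_eq_cvg; near=> s.
have s0 : 0 <= s by near: s; exact: nbhs_pinfty_ge.
have mphi := lipschitz_fct_measurable phiC.
apply: ae_eq_Rintegral.
- apply: (measurableT_comp (f := phi)) => //; apply: measurable_sum => e.
  by apply: measurable_funM => //; exact: mct.
- apply: (measurableT_comp (f := phi)) => //; apply: measurable_sum => j.
  by apply: measurable_funM => //; exact: measurable_height_pairing.
have FF : Filter (almost_everywhere P) by typeclasses eauto.
have := @filter_forall _ _ (fun j w => fine (P (num_vertices T (s + t j) @^-1` [set (num_vertices T (s
  + t j) w)])) != 0)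
  (almost_everywhere P) FF (fun j => ae_num_vertices_charged T (s + t j)).
apply: filterS => w h; congr phi.
rewrite (_ : \sum_(j < m) _ = \sum_(j < m) \sum_(k < n_ j) - Num.sqrt (pi / 2) * a j * c j k *
  centered_traces tau T d s w (t j) k).
  by rewrite (@sum_sigma_enum _ m n_ (fun j k => - Num.sqrt (pi / 2) * a j * c j k *
    centered_traces tau T d s w (t j) k)).
apply: eq_bigr => j _; rewrite /height_pairing pE integral_height//; last by apply: d0; rewrite addr_ge0.
by rewrite mulrCA mulrA mulr_sumr; apply: eq_bigr => k _; rewrite mulrA.
Unshelve. all: by end_near.
Qed.

Lemma height_pairing_cos_cvg a (b : R) :
  \int[P]_w cos (\sum_(j < m) a j * height_pairing s w j + b) @[s --> +oo] -->
  cos b * expR (- ((\sum_(j < m) \sum_(j' < m) a j * a j' *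
    \int[lebesgue_measure]_(x in `[(-1)%R, 1]) \int[lebesgue_measure]_(y in `[(-1)%R, 1])
      ((p j).[x] * gff_covariance (Omega x (t j)) (Omega y (t j')) * (p j').[y])) / 2)).
Proof.
have cb (x : R) : `|cos (x + b)| <= 1 by rewrite ler_norml cos_geN1 cos_le1.
have := height_pairing_cvg (a := a) cb ler01 (cos_lipschitz b).
have := stationary_OU_cf OU (weight a) (fun e => kk e) (t := fun e => t (jj e)) (fun e => t0 _) 1 b.
under eq_Rintegral do rewrite mul1r.
move=> ->; rewrite expr1n mul1r; set v := (X in expR (- (X / 2))).
set v' := (X in _ -> _ --> cos b * expR (- (X / 2))); suff -> : v = v' by [].
pose G j k j' k' : R := if k' == k then - Num.sqrt (pi / 2) * a j * c j k *
  (- Num.sqrt (pi / 2) * a j' * c j' k') * (k.+1%:R / 2 * expR (- (k.+1%:R * `|t j - t j'|))) else 0.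
transitivity (\sum_(j < m) \sum_(k < n_ j) \sum_(j' < m) \sum_(k' < n_ j') G j k j' k').
  rewrite (@sum_sigma_enum _ m n_ (fun j k => \sum_(j' < m) \sum_(k' < n_ j') G j k j' k')).
  apply: eq_bigr => e _; rewrite (@sum_sigma_enum _ m n_ (G (jj e) (kk e))) big_mkcond.
  by apply: eq_bigr => e' _; rewrite /G.
apply: eq_bigr => j _; rewrite exchange_big; apply: eq_bigr => j' _.
rewrite !pE gff_covariance_integral mulr_sumr; apply: eq_bigr => k _.
rewrite -big_mkcond mulr_sumr; apply: eq_bigr => k' _.
have S2 : Num.sqrt (pi / 2) * Num.sqrt (pi / 2) = pi / 2 :> R.
  by rewrite -expr2 sqr_sqrtr// divr_ge0// pi_ge0.
rewrite -mulrN expRM_natl.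
(* The normalisation of the height contributes pi / 2, which together with the factor (k + 1) / 2 of
   the traces gives the (k + 1) pi / 4 of the free field. *)
transitivity (Num.sqrt (pi / 2) * Num.sqrt (pi / 2) * (a j * c j k * (a j' * c j' k') * (k.+1%:R / 2 *
  expR (- `|t j - t j'|) ^+ k.+1))); first by ring.
by rewrite S2; field.
Qed.

(** The Lipschitz ramp [phi n] vanishes up to n and equals 1 from n + 1 on. Its expectation
    converges as s grows, to a limit that is small for large n, and it dominates the indicator of
    exceeding n + 1. *)
Lemma height_pairing_tight (e : R) : 0 < e -> exists B : R, forall j : 'I_m,
  \forall s \near +oo, \int[P]_w \1_[set w0 | B < `|height_pairing s w0 j|] w <= e.
Proof.
move=> e0.
pose phi n (x : R) := Num.max 0 (Num.min 1 (`|x| - n%:R)).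
have phi01 n x : 0 <= phi n x <= 1.
  by rewrite /phi le_max lexx ge_max ler01 ge_min lexx.
have phi1 n x : `|phi n x| <= 1 by have /andP[? ?] := phi01 n x; rewrite ger0_norm.
have phiL n x y : `|phi n x - phi n y| <= 1 * `|x - y|.
  rewrite mul1r; apply: le_trans (ler_dist_dist x y); apply: (le_trans (clamp_lipschitz _ _)).
  by rewrite opprB addrA subrK.
have mphi n := lipschitz_fct_measurable (phiL n).
have /choice[n_e n_eP] : forall j, exists n, \forall s \near +oo, \int[P]_w phi n (height_pairing s w j) <= e.
  move=> j; pose a (j' : 'I_m) : R := (j' == j)%:R.
  have aE s w : \sum_(j' < m) a j' * height_pairing s w j' = height_pairing s w j.
    by rewrite (bigD1 j)//= big1 /a ?eqxx ?mul1r ?addr0// => j' /negPf ->; rewrite mul0r.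
  pose L w := \sum_(e < E) weight a e * U (kk e) (t (jj e)) w.
  have mL : measurable_fun setT L.
    by apply: measurable_sum => i; apply: measurable_funM => //; exact: measurable_funPT.
  have lim0 : \int[Q]_w phi n (L w) @[n --> \oo] --> 0.
    have -> : 0 = \int[Q]_w (fun=> 0 : R) w by rewrite Rintegral_cst// mul0r.
    apply: (@Rintegral_dominated_cvg _ _ R Q setT (fun n w => phi n (L w)) _ (cst 1)) => //.
    - by move=> n; apply: (measurableT_comp (f := phi n)).
    - apply/aeW => w _; apply: cvg_near_cst; near=> n.
      rewrite /phi; apply/max_idPl; rewrite ge_min subr_le0; apply/orP; right.
      by near: n; exact: nbhs_infty_ger.
    - exact: finite_measure_integrable_cst.
    - by apply/aeW => w n _; exact: phi1.
  have [n hn] : exists n, \int[Q]_w phi n (L w) < e.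
    have [n _ /(_ n (leqnn n)) /= h] := cvgr_lt _ lim0 _ e0.
    by exists n.
  exists n; have := height_pairing_cvg (a := a) (phi1 n) ler01 (phiL n).
  under eq_fun do under eq_Rintegral do rewrite aE.
  move=> /cvgr_lt/(_ _ hn); apply: filterS => s; exact: ltW.
(* The sum serves as a common bound above every [n_e j + 1], the level from which the ramp is 1. *)
exists (\sum_(j < m) (n_e j).+1%:R) => j; have := n_eP j; apply: filterS => s; apply: le_trans.
have mX := measurable_height_pairing s j.
have mI : measurable [set w0 | \sum_(j < m) (n_e j).+1%:R < `|height_pairing s w0 j|].
  rewrite (_ : [set w0 | _] = (fun w0 => `|height_pairing s w0 j|) @^-1` `]\sum_(j < m)
    (n_e j).+1%:R, +oo[%classic); last first.
    by apply/seteqP; split => w0 /=; rewrite in_itv/= andbT.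
  by rewrite -[X in measurable X]setTI; exact: (measurableT_comp (f := @Num.norm R R)).
apply: le_Rintegral => //.
- by apply: (@bounded_integrable _ _ _ _ _ 1); [exact: measurable_indic|exact: indic_norm_le1].
- by apply: (@bounded_integrable _ _ _ _ _ 1) => [|w];
  [exact: (measurableT_comp (f := phi (n_e j)))|exact: phi1].
move=> w _; rewrite indicE; case: (boolP (w \in _)) => [|_];
  last by have /andP[] := phi01 (n_e j) (height_pairing s w j).
rewrite inE/= => h; rewrite /phi le_max le_min lexx/=; apply/orP; right.
rewrite lerBrDr addrC natr1; apply: le_trans (ltW h).
by rewrite (bigD1 j)//= lerDl sumr_ge0.
Unshelve. all: by end_near.
Qed.

End HeightConvergence.

Theorem theorem4p6 (R : realType)
    (disp1 : measure_display) (Om1 : measurableType disp1) (P : probability Om1 R)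
    (tau : nat -> forall n : nat, Om1 -> 'S_n) (T : nat -> {RV P >-> R})
    (d : R -> nat)
    (disp2 : measure_display) (Om2 : measurableType disp2) (Q : probability Om2 R)
    (h : {poly R} -> R -> {RV Q >-> R}) :
  growing_graph_model tau T ->
  admissible_degree tau T d ->
  gff_integrals h ->
  forall (n : nat) (p : 'I_n -> {poly R[i]}) (t : 'I_n -> R),
    (forall i, 0 <= t i) ->
    cvg_in_law P
      (fun (s : R) (w : Om1) =>
         \row_(i < n) height_integral tau T d (p i) s (t i) w : 'rV[R[i]^o]_n)
      Q
      (fun w : Om2 =>
         \row_(i < n) gff_integral h (p i) (t i) w : 'rV[R[i]^o]_n).

Proof.
move=> [mod_tau _ _] [d0 _ _ _ [disp' [Om' [Q' [U [W [OU XU]]]]]]] hh n p t t0 f cf [M fM].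
have mtau l k (s : 'S_k) : measurable (tau l k @^-1` [set s]) by have [] := mod_tau l.
(* Each complex polynomial yields two real ones at the same time; the order matches that of
   [complex_row]. *)
pose pr (j : 'I_(n + n)) : {poly R} := match fintype.split j with
  inl i => map_poly (@complex.Re R) (p i) | inr i => map_poly (@complex.Im R) (p i) end.
pose tr (j : 'I_(n + n)) : R := match fintype.split j with inl i => t i | inr i => t i end.
have tr0 j : 0 <= tr j by rewrite /tr; case: (fintype.split j).
have /choice[nc ncE] : forall j, exists nc : nat * (nat -> R), pr j = chebyshev_deriv_sum nc.1 nc.2.
  by move=> j; have [k [c E]] := chebyshev_deriv_basis (pr j); exists (k, c).
pose X s w j := height_pairing tau T d pr tr s w j.
pose Y w j := h (pr j) (tr j) w.
pose g (v : 'rV[R]_(n + n)) := f (complex_row v).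
have cg : continuous g by move=> v; apply: continuous_comp; [exact: continuous_complex_row|exact: cf].
have gM v : `|g v| <= M by exact: fM.
have mX s j : measurable_fun setT (fun w => X s w j) by exact: measurable_height_pairing.
have mY j : measurable_fun setT (Y^~ j) by exact: measurable_funPT.
have XE s w : \row_(i < n) height_integral tau T d (p i) s (t i) w = complex_row (\row_j X s w j).
  apply/rowP => i; rewrite !mxE /X /height_pairing /pr /tr.
  rewrite (unsplitK (inl i : 'I_n + 'I_n)) (unsplitK (inr i : 'I_n + 'I_n)) /height_integral.
  congr (_ +i* _); apply: eq_Rintegral => x _.
    rewrite -Re_horner_real; case: (p i).[x%:C] => a b /=; by rewrite mulr0 subr0.
  rewrite -Im_horner_real; case: (p i).[x%:C] => a b /=; by rewrite mulr0 add0r.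
have YE w : \row_(i < n) gff_integral h (p i) (t i) w = complex_row (\row_j Y w j).
  apply/rowP => i; rewrite !mxE /Y /pr /tr.
  by rewrite (unsplitK (inl i : 'I_n + 'I_n)) (unsplitK (inr i : 'I_n + 'I_n)).
have mfX s := continuous_row_measurable (mX s) cg gM.
have mfY := continuous_row_measurable mY cg gM.
have -> : (fun w => f (\row_(i < n) gff_integral h (p i) (t i) w)) = (fun w => g (\row_j Y w j)).
  by apply/funext => w; rewrite YE.
have -> : (fun s => 'E_P[fun w => f (\row_(i < n) height_integral tau T d (p i) s (t i) w)])%E =
    (fun s => (\int[P]_w g (\row_j X s w j))%:E).
  apply/funext => s; rewrite -(expectation_Rintegral P (mfX s) (fun w => gM (\row_j X s w j))).
  by congr ('E_P[_])%E; apply/funext => w; rewrite XE.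
rewrite (expectation_Rintegral Q mfY (fun w => gM (\row_j Y w j))).
apply: cvg_EFin; first exact: nearW.
apply: (cramer_wold (fun s j _ => mX s j) mY _ _ cg gM).
(* Rewriting [v] as the double integral of the covariance gives the limiting cosine expectation the
   very form reached on the graph side. *)
- move=> a b; have [_ hlaw _] := hh; have [v v0 law] := hlaw _ a pr tr tr0.
  have mL : measurable_fun setT (fun w => \sum_(j < n + n) a j * h (pr j) (tr j) w).
    by apply: measurable_sum => j; apply: measurable_funM => //; exact: measurable_funPT.
  have := gaussian_cos 1 b v0 mL law; under eq_Rintegral do rewrite mul1r.
  rewrite expr1n mul1r (gff_variance hh tr0 v0 law) => ->.
  exact: (height_pairing_cos_cvg mtau d0 OU XU tr0 ncE).
- exact: (height_pairing_tight mtau d0 OU XU tr0 ncE).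
Qed.
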